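(* Let $n\ge 1$, $L\ge 1$, and let $\{\psi^{(\epsilon)}_{j,k}\}$, $\{\tilde\psi^{(\epsilon)}_{j,k}\}$ ($1\le\epsilon\le L$, $j\in\mathbb{Z}$, $k\in\mathbb{Z}^n$) be a pair of band-limited biorthogonal Riesz wavelet bases of $L^2(\mathbb{R}^n)$ (see context), with $\psi^{(\epsilon)}\in M^\tau$ and $\tilde\psi^{(\epsilon)}\in\mathcal{D}_\sigma$ for some $\tau>0$ and $\sigma>2n$. Let $s>0$, $1<p<\infty$, $0<q<\infty$, $w\in A_p$. Let $\psi:=\psi^{(1)}$, $\tilde\psi:=\tilde\psi^{(1)}$, $K_U:=K_U(\psi)$, $K_L:=K_L(\tilde\psi)$, $K_\eta:=\max_{|i|\le M}K_U(\varphi_i*\psi)$ (see context), and $$c_\flat:=\frac{(1-2^{-n})^{1/p}\,2^{-s}}{K_L\,K_\eta\,C'_M},\qquad c_\sharp:=(1-2^{-n})^{1/p}\,2^{-s}\,K_U\,K_L\,C_M,$$ which are independent of $N$ and $w$. Then for every integer $m\ge0$ and $N:=2^{mn}$ there exists a finite wavelet sum $f^*_N$ of generation $m+1$ (a finite linear combination of elements of $\mathcal{F}$ with scale index $j=m+1$), belonging to the localized class $\dot B^s_{p,q}(w;Q_0)$, such that $$c_\flat\,[w]_{A_p}^{-2/p}\le\frac{E_N^{\mathcal{F}}(f^*_N)_{L^p_w}}{N^{-s/n}\,\|f^*_N\|_{\dot B^s_{p,q}(w)}}\le c_\sharp\,[w]_{A_p}^{2/p}.$$ The ratio also lies between $c_\flat[w]_{A_p}^{-2\theta(p)}$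 and $c_\sharp[w]_{A_p}^{2\theta(p)}$, where $\theta(p):=\frac12\max\{1,(p-1)^{-1}\}$. In particular, for fixed $w$, for no $s'>s$ does there exist a constant $C'$ independent of $N$ and $f$ such that $E_N^{\mathcal{F}}(f)_{L^p_w}\le C'N^{-s'/n}\|f\|_{\dot B^s_{p,q}(w)}$ for all $f\in\dot B^s_{p,q}(w;Q_0)$ and all integers $N\ge1$.
   Context: Conventions. $\hat f(\xi)=\int_{\mathbb{R}^n} f(x)e^{-2\pi i x\cdot\xi}dx$. $|\cdot|$ is the Euclidean norm, $|\cdot|_\infty$ the maximum norm. $\langle f,g\rangle=\int f\,\overline{g}$. $1/p+1/p'=1$. $\mathcal{S}$ denotes Schwartz functions, $\mathcal{S}'$ tempered distributions, $\mathcal{P}$ polynomials on $\mathbb{R}^n$. For a function $h$, $h_{j,k}(x):=2^{jn/2}h(2^jx-k)$ for $j\in\mathbb{Z}$, $k\in\mathbb{Z}^n$. $Q_{j,k}:=2^{-j}(k+[0,1)^n)$, $\|g\|_{L^p_w}:=(\int|g|^pw)^{1/p}$. Wavelet system. Generators $\psi^{(1)},\dots,\psi^{(L)}$ and dual generators $\tilde\psi^{(1)},\dots,\tilde\psi^{(L)}$ have Fourier transforms in $C_c^\infty(\mathbb{R}^n)$ supported in $\{a\le|\xi|\le b\}$ for fixed $0<a<b$ (band-limited). Each of the systems $\{\psi^{(\epsilon)}_{j,k}\}$, $\{\tilde\psi^{(\epsilon)}_{j,k}\}$ is a Riesz basis of $L^2(\mathbb{R}^n)$: closed linear span $L^2$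 and $A\sum|c|^2\le\|\sum c^{(\epsilon)}_{j,k}\psi^{(\epsilon)}_{j,k}\|_{L^2}^2\le B\sum|c|^2$ for finitely supported coefficients (Riesz bounds $A,B>0$), similarly for the dual system; $\langle\psi^{(\epsilon)}_{j,k},\tilde\psi^{(\epsilon')}_{j',k'}\rangle=\delta_{\epsilon,\epsilon'}\delta_{j,j'}\delta_{k,k'}$; and every $f\in L^2$ satisfies $f=\sum_{\epsilon,j,k}\langle f,\tilde\psi^{(\epsilon)}_{j,k}\rangle\psi^{(\epsilon)}_{j,k}$ in $L^2$. $\mathcal{F}$ denotes the system $\{\psi^{(\epsilon)}_{j,k}\}$. $N$-term error. $E_N^{\mathcal{F}}(f)_{L^p_w}:=\inf\|f-\sum_{(\epsilon,j,k)\in\Lambda}d^{(\epsilon)}_{j,k}\psi^{(\epsilon)}_{j,k}\|_{L^p_w}$ over all index sets $\Lambda$ with $\#\Lambda\le N$ and all complex coefficients. Weights. A weight is a locally integrable, a.e. positive function on $\mathbb{R}^n$; $w\in A_p$ iff $[w]_{A_p}:=\sup_Q(\frac1{|Q|}\int_Qw)(\frac1{|Q|}\int_Qw^{-1/(p-1)})^{p-1}<\infty$, sup over cubes with sides parallel to the axes. Littlewood–Paley and Besov space. Fix $\varphi\in\mathcal{S}(\mathbb{R}^n)$ with $\hat\varphi$ real-valued, radial, supported in $\{c_1\le|\xi|\le c_2\}$ ($0<c_1<c_2$), $\sum_{j\in\mathbb{Z}}\hat\varphi(2^{-j}\xi)=1$ for $\xi\neq0$; $\varphi_j(x):=2^{jn}\varphi(2^jx)$,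 $\Delta_jf:=\varphi_j*f$. $\dot B^s_{p,q}(w)$ is the set of $f\in\mathcal{S}'/\mathcal{P}$ with $\|f\|_{\dot B^s_{p,q}(w)}:=(\sum_{j\in\mathbb{Z}}2^{jsq}\|\Delta_jf\|_{L^p_w}^q)^{1/q}<\infty$. Every $f\in L^p_w$ ($w\in A_p$) defines a tempered distribution and has absolutely convergent pairings $\langle f,\tilde\psi^{(\epsilon)}_{j,k}\rangle$; $L^p_w\cap\dot B^s_{p,q}(w)$ consists of $f\in L^p_w$ whose class modulo polynomials is in $\dot B^s_{p,q}(w)$. Finite-band quantities. $M:=\lceil\max\{\log_2(b/c_1),\log_2(c_2/a),0\}\rceil$, $C_M:=\sum_{|i|\le M}2^{is}$, $C'_M:=(\sum_{|i|\le M}2^{isq})^{1/q}$ ($i$ integer). Localized class. $Q_0:=[0,1)^n$, $\mathcal{D}(Q_0):=\{(j,k):j\ge0,\ Q_{j,k}\subset Q_0\}$. For $f\in L^p_w$, $J\ge0$: $T_Jf:=\sum_{\epsilon=1}^L\sum_{j=0}^J\sum_{k:(j,k)\in\mathcal{D}(Q_0)}\langle f,\tilde\psi^{(\epsilon)}_{j,k}\rangle\psi^{(\epsilon)}_{j,k}$. $\dot B^s_{p,q}(w;Q_0)$ is the set of $f\in L^p_w\cap\dot B^s_{p,q}(w)$ with $T_Jf\to f$ in $L^p_w$ as $J\to\infty$. Decay quantities. $\psi\in M^\tau$ iff $|\psi|_{M^\tau}:=\sup_x(1+|x|)^{2n+\tau}|\psi(x)|<\infty$; $\tilde\psi\in\mathcal{D}_\sigma$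 iff $|\tilde\psi|_{\mathcal{D}_\sigma}:=\int(1+|x|^\sigma)|\tilde\psi(x)|dx<\infty$. For a function $h$, its decay envelope is $\beta_0(h):=\sup|h|$, $\beta_m(h):=\sup\{|h(z)|:|z|_\infty\ge m-1\}$ for $m\ge1$, and $K_U(h):=\sum_{i\ge0}(\beta_i(h)-\beta_{i+1}(h))(2i+1)^{n+n/p'}$, $K_L(h):=\sum_{i\ge0}(\beta_i(h)-\beta_{i+1}(h))(2i+1)^{n+n/p}$. *)

(* Defs.v *)
From HB Require Import structures.
From mathcomp Require Import all_boot all_order all_algebra finmap.
From mathcomp Require Import complex.
From mathcomp Require Import all_classical all_reals all_analysis.

Set Implicit Arguments.
Unset Strict Implicit.
Unset Printing Implicit Defensive.

Import Order.TTheory GRing.Theory Num.Theory.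
Import numFieldNormedType.Exports.

Local Open Scope classical_set_scope.
Local Open Scope ring_scope.
Local Open Scope complex_scope.

(* 'rV[R]_n carries the Borel sigma-algebra, generated by the coordinates as in
   the library instance for n.-tuple. *)
Definition rV_display : measure_display. Proof. exact. Qed.

Section measurable_rV.
Context (R : realType) (n : nat).

Let coord (i : 'I_n) (x : 'rV[R]_n) : R := x ord0 i.

Let rV_set0 : g_sigma_preimage coord set0.
Proof. exact: sigma_algebra0. Qed.

Let rV_setC A : g_sigma_preimage coord A -> g_sigma_preimage coord (~` A).
Proof. exact: sigma_algebraC. Qed.

Let rV_bigcup (F : _^nat) : (forall i, g_sigma_preimage coord (F i)) ->
  g_sigma_preimage coord (\bigcup_i (F i)).
Proof. exact: sigma_algebra_bigcup. Qed.

HB.instance Definition _ := @isMeasurable.Build rV_display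
  'rV[R]_n (g_sigma_preimage coord) rV_set0 rV_setC rV_bigcup.

End measurable_rV.

Lemma measurable_coord (R : realType) n (i : 'I_n) :
  measurable_fun [set: 'rV[R]_n] (fun x : 'rV[R]_n => x ord0 i).
Proof.
move=> _ Y mY; rewrite setTI; apply: sub_sigma_algebra => /=.
rewrite -bigcup_seq/=; exists i => /=; first by rewrite mem_index_enum.
by exists Y => //; rewrite setTI.
Qed.

Lemma measurable_fun_rV d (T : measurableType d) (R : realType) n
    (f : T -> 'rV[R]_n) :
  (forall i, measurable_fun [set: T] (fun t => f t ord0 i)) ->
  measurable_fun [set: T] f.
Proof.
move=> mf; apply: (@measurability _ _ _ _ setT f
  (\big[setU/set0]_(i < n) preimage_set_system setT
     (fun x : 'rV[R]_n => x ord0 i) measurable)) => //.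
move=> _ [A + <-]; rewrite -bigcup_seq => -[i _ [B mB <-]].
by rewrite setTI; exact: mf.
Qed.

Definition cons_rV (R : realType) n (z : measurableTypeR R * 'rV[R]_n) : 'rV[R]_n.+1 :=
  row_mx z.1%:M z.2.

Lemma cons_rV0 (R : realType) n (z : measurableTypeR R * 'rV[R]_n) : cons_rV z ord0 ord0 = z.1.
Proof.
transitivity (row_mx z.1%:M z.2 ord0 (lshift n (@ord0 0))).
  by congr (row_mx _ _ _ _); apply/val_inj.
by rewrite row_mxEl mxE eqxx mulr1n.
Qed.

Lemma cons_rVS (R : realType) n (z : measurableTypeR R * 'rV[R]_n) i :
  cons_rV z ord0 (lift ord0 i) = z.2 ord0 i.
Proof.
transitivity (row_mx z.1%:M z.2 ord0 (rshift 1 i)); last by rewrite row_mxEr.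
by congr (row_mx _ _ _ _); apply/val_inj.
Qed.

Lemma measurable_cons_rV (R : realType) n :
  measurable_fun [set: measurableTypeR R * 'rV[R]_n] (@cons_rV R n).
Proof.
apply: measurable_fun_rV => i; case: (unliftP ord0 i) => [j ->|->].
  rewrite (_ : (fun t => _) = (fun x : 'rV[R]_n => x ord0 j) \o snd).
    exact: measurableT_comp (measurable_coord j) measurable_snd.
  by apply/funext => t; rewrite cons_rVS.
by rewrite (_ : (fun t => _) = fst)//; apply/funext => t; rewrite cons_rV0.
Qed.

Section lebesgue_step.
Context (R : realType) (n : nat).
Variable m : {sigma_finite_measure set 'rV[R]_n -> \bar R}.

Definition lebesgue_step : set 'rV[R]_n.+1 -> \bar R :=
  pushforward (lebesgue_measure \x m)%E (@cons_rV R n).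

Let lebesgue_step0 : lebesgue_step set0 = 0%E.
Proof. by rewrite /lebesgue_step /pushforward preimage_set0 measure0. Qed.

Let lebesgue_step_ge0 A : (0 <= lebesgue_step A)%E.
Proof. by rewrite /lebesgue_step /pushforward measure_ge0. Qed.

Let lebesgue_step_sigma_additive : semi_sigma_additive lebesgue_step.
Proof.
move=> F mF tF mUF; rewrite /lebesgue_step /pushforward preimage_bigcup.
apply: measure_semi_sigma_additive.
- by move=> k; rewrite -[X in measurable X]setTI; exact: measurable_cons_rV.
- apply/trivIsetP => /= i j _ _ ij; rewrite -preimage_setI.
  by move/trivIsetP : tF => /(_ _ _ _ _ ij) ->//; rewrite preimage_set0.
- by rewrite -preimage_bigcup -[X in measurable X]setTI;
    exact: measurable_cons_rV.
Qed.

HB.instance Definition _ := isMeasure.Build _ _ _ lebesgue_step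
  lebesgue_step0 lebesgue_step_ge0 lebesgue_step_sigma_additive.

Lemma lebesgue_step_sigma_finite : sigma_finite setT lebesgue_step.
Proof.
have /sigma_finiteP[F [TF ndF Foo]] := sigma_finiteT (@lebesgue_measure R).
have /sigma_finiteP[G [TG ndG Goo]] := sigma_finiteT m.
pose un (v : 'rV[R]_n.+1) : measurableTypeR R * 'rV[R]_n :=
  (v ord0 ord0, \row_i v ord0 (lift ord0 i)).
have unK z : un (cons_rV z) = z.
  case: z => a v; rewrite /un cons_rV0; congr pair.
  by apply/rowP => i; rewrite mxE cons_rVS.
have mun : measurable_fun setT un.
  apply: measurable_fun_pair; first exact: measurable_coord.
  apply: measurable_fun_rV => i.
  rewrite (_ : (fun t => _) = (fun x : 'rV[R]_n.+1 => x ord0 (lift ord0 i))).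
    exact: measurable_coord.
  by apply/funext => v; rewrite mxE.
exists (fun k => un @^-1` (F k `*` G k)).
  apply/esym; rewrite -subTset => v _.
  have [k _ Fk] : (\bigcup_i F i) (un v).1 by rewrite -TF.
  have [l _ Gl] : (\bigcup_i G i) (un v).2 by rewrite -TG.
  exists (maxn k l) => //; split => /=.
  - have /subsetPset : (F k <= F (maxn k l))%O by exact/ndF/leq_maxl.
    exact.
  - have /subsetPset : (G l <= G (maxn k l))%O by exact/ndG/leq_maxr.
    exact.
move=> k; have [mF ?] := Foo k; have [mG ?] := Goo k; split.
  by rewrite -[X in measurable X]setTI; apply: mun => //; exact: measurableX.
rewrite /lebesgue_step /pushforward (_ : _ @^-1` _ = F k `*` G k).
  by rewrite product_measure1E// lte_mul_pinfty// ge0_fin_numE.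
by apply/seteqP; split => z; rewrite /preimage /mkset unK.
Qed.

HB.instance Definition _ :=
  Measure_isSigmaFinite.Build _ _ _ lebesgue_step lebesgue_step_sigma_finite.

End lebesgue_step.

(* Lebesgue measure on R^n as an iterated product measure; see lebesgue_rV_box
   for its value on boxes. *)
Fixpoint lebesgue_rV (R : realType) (n : nat) :
    {sigma_finite_measure set 'rV[R]_n -> \bar R} :=
  match n with
  | 0 => \d_(0 : 'rV[R]_0)
  | n'.+1 => lebesgue_step (lebesgue_rV R n')
  end.

Lemma lebesgue_rV_box (R : realType) (n : nat)
    (A : 'I_n -> set (measurableTypeR R)) :
  (forall i, measurable (A i)) ->
  lebesgue_rV R n [set x | forall i, A i (x ord0 i)] =
    (\prod_(i < n) lebesgue_measure (A i))%E.
Proof.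
elim: n A => [|n IH] A mA.
  rewrite big_ord0 /= diracE mem_set//; by case.
have mB : measurable
    [set x : 'rV[R]_n | forall i : 'I_n, A (lift ord0 i) (x ord0 i)].
  rewrite (_ : mkset _ = \bigcap_(i in [set: 'I_n])
      ((fun x : 'rV[R]_n => x ord0 i) @^-1` A (lift ord0 i))).
    apply: fin_bigcap_measurable => // i _.
    rewrite -[X in measurable X]setTI.
    exact: (@measurable_coord R n i _ _ (mA (lift ord0 i))).
  by apply/seteqP; split => x /= h i; [move=> _|]; exact: h.
rewrite big_ord_recl /= /lebesgue_step /pushforward.
transitivity ((lebesgue_measure \x lebesgue_rV R n)%E (A ord0 `*`
    [set x : 'rV[R]_n | forall i : 'I_n, A (lift ord0 i) (x ord0 i)])); last first.
  rewrite (product_measure1E _ _ (mA ord0) mB); congr (_ * _)%E.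
  by apply: IH => i; exact: mA.
congr ((_ \x _)%E _).
apply/seteqP; split => -[a v] /=.
  move=> h; split; first by have := h ord0; rewrite cons_rV0.
  by move=> i; have := h (lift ord0 i); rewrite cons_rVS.
move=> [h0 h] i; case: (unliftP ord0 i) => [j ->|->].
  by rewrite cons_rVS; exact: h.
by rewrite cons_rV0.
Qed.

Section euclidean.
Context (R : realType) (n : nat).
Local Notation E := 'rV[R]_n.
Local Notation C := R[i].
Local Notation mu := (lebesgue_rV R n).

(* The library norm `|x| on 'rV[R]_n is the maximum norm, hence enorm for the
   Euclidean one. *)
Definition dotv (x y : E) : R := \sum_(i < n) x ord0 i * y ord0 i.

Definition enorm (x : E) : R := Num.sqrt (dotv x x).

Definition cmod (z : C) : R := ComplexField.Normc.normc z.

Definition cmeasurable (f : E -> C) : Prop :=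
  measurable_fun setT (fun x => complex.Re (f x)) /\
  measurable_fun setT (fun x => complex.Im (f x)).

Definition ccontinuous (f : E -> C) : Prop :=
  continuous (fun x => complex.Re (f x)) /\
  continuous (fun x => complex.Im (f x)).

Definition cintegrable (f : E -> C) : Prop :=
  mu.-integrable setT (fun x => (complex.Re (f x))%:E) /\
  mu.-integrable setT (fun x => (complex.Im (f x))%:E).

(* Meaningful when [cintegrable f]. *)
Definition cintegral (f : E -> C) : C :=
  (\int[mu]_x complex.Re (f x)) +i* (\int[mu]_x complex.Im (f x)).

Definition cpair (f g : E -> C) : C := cintegral (fun x => f x * (g x)^*%C).

Definition convol (f g : E -> C) (x : E) : C :=
  cintegral (fun y => f (x - y) * g y).

Definition fourier (f : E -> C) (xi : E) : C :=
  cintegral (fun x => f x *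
    (cos (2 * pi * dotv x xi) -i* sin (2 * pi * dotv x xi))).

(* A multi-index derivative is given by the list of its directions; C^oo means
   that all iterated partial derivatives are differentiable everywhere. *)
Definition pderiv (al : seq 'I_n) (f : E -> R) : E -> R :=
  foldr (fun i g x => 'D_(delta_mx ord0 i) g x) f al.

Definition cpderiv (al : seq 'I_n) (f : E -> C) (x : E) : C :=
  (pderiv al (fun y => complex.Re (f y)) x) +i*
  (pderiv al (fun y => complex.Im (f y)) x).

Definition csmooth (f : E -> C) : Prop :=
  forall (al : seq 'I_n) (x : E),
    differentiable (pderiv al (fun y => complex.Re (f y))) x /\
    differentiable (pderiv al (fun y => complex.Im (f y))) x.

Definition schwartz (f : E -> C) : Prop :=
  csmooth f /\
  forall (al : seq 'I_n) (N : nat), exists K : R,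
    forall x, (1 + enorm x) ^+ N * cmod (cpderiv al f x) <= K.

Definition supported_in_annulus (r1 r2 : R) (g : E -> C) : Prop :=
  forall xi, ~~ (r1 <= enorm xi <= r2) -> g xi = 0.

Definition Lpw_norm (p : R) (w : E -> R) (g : E -> C) : \bar R :=
  ((\int[mu]_x (cmod (g x) `^ p * w x)%:E) `^ p^-1)%E.

Definition Lpw (p : R) (w : E -> R) : set (E -> C) :=
  [set g | cmeasurable g /\ (Lpw_norm p w g < +oo)%E].

Definition L2_norm : (E -> C) -> \bar R := Lpw_norm 2 (fun=> 1).

Definition L2 : set (E -> C) := Lpw 2 (fun=> 1).

Definition weight (w : E -> R) : Prop :=
  [/\ measurable_fun setT w,
      (forall K : set E, compact K -> mu.-integrable K (EFin \o w)) &
      {ae mu, forall x, 0 < w x}].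

Definition cube (x : E) (r : R) : set E :=
  [set y | forall i, x ord0 i <= y ord0 i <= x ord0 i + r].

Definition average (Q : set E) (g : E -> R) : \bar R :=
  ((fine (mu Q))^-1%:E * \int[mu]_(y in Q) (g y)%:E)%E.

Definition Ap_const (p : R) (w : E -> R) : \bar R :=
  ereal_sup [set z | exists (x : E) (r : R), 0 < r /\
    z = (average (cube x r) w *
         average (cube x r) (fun y => w y `^ (- (p - 1)^-1))%R `^ (p - 1))%E].

Definition in_Ap (p : R) (w : E -> R) : Prop :=
  weight w /\ (Ap_const p w < +oo)%E.

(* A distribution is a functional on test functions; only its values on
   Schwartz functions matter. The second clause of [tempered] is continuity for
   the topology of the Schwartz seminorms. *)
Definition distribution := (E -> C) -> C.

Definition tempered (u : distribution) : Prop :=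
  (forall (c : C) g h, schwartz g -> schwartz h ->
    u (fun x => c * g x + h x) = c * u g + u h) /\
  exists (N : nat) (K : R), forall g (B : R), schwartz g ->
    (forall (al : seq 'I_n) x, (size al <= N)%N ->
      (1 + enorm x) ^+ N * cmod (cpderiv al g x) <= B) ->
    cmod (u g) <= K * B.

Definition distr_of (f : E -> C) : distribution :=
  fun g => cintegral (fun x => f x * g x).

Definition polynomial_fun (P : E -> C) : Prop :=
  exists t : seq (C * {ffun 'I_n -> nat}),
    P = fun x => \sum_(c <- t) c.1 * \prod_(i < n) (x ord0 i)%:C%C ^+ c.2 i.

(* The element of S'/P represented by u. *)
Definition class_mod_poly (u : distribution) : set distribution :=
  [set v | tempered v /\ exists P, polynomial_fun P /\
    forall g, schwartz g -> v g = u g + distr_of P g].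

Definition dilate (phi : E -> C) (j : int) (x : E) : C :=
  ((2 : R) ^ (j * n%:Z))%:C%C * phi ((2 : R) ^ j *: x).

Definition littlewood_paley (c1 c2 : R) (phi : E -> C) : Prop :=
  [/\ schwartz phi,
      (forall xi, complex.Im (fourier phi xi) = 0),
      (forall xi eta, enorm xi = enorm eta -> fourier phi xi = fourier phi eta),
      supported_in_annulus c1 c2 (fourier phi) &
      forall xi, xi != 0 ->
        \sum_(j \in [set: int]) fourier phi ((2 : R) ^ (- j) *: xi) = 1].

(* phi_j * u, as a function *)
Definition lp_block (phi : E -> C) (j : int) (u : distribution) (x : E) : C :=
  u (fun y => dilate phi j (x - y)).

(* Depends only on the class of u modulo polynomials, because the Fourier
   transform of phi vanishes near the origin. *)
Definition besov_norm (phi : E -> C) (s p q : R) (w : E -> R)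
    (u : distribution) : \bar R :=
  ((\esum_(j in [set: int]) ((2 `^ (j%:~R * s * q))%:E *
      Lpw_norm p w (lp_block phi j u) `^ q)) `^ q^-1)%E.

Definition besov_space (phi : E -> C) (s p q : R) (w : E -> R) :
    set (set distribution) :=
  [set X | exists2 u, tempered u /\ (besov_norm phi s p q w u < +oo)%E &
    X = class_mod_poly u].

Definition wav (h : E -> C) (j : int) (k : 'rV[int]_n) (x : E) : C :=
  (2 `^ (j%:~R * n%:R / 2))%:C%C *
    h ((2 : R) ^ j *: x - map_mx (fun z : int => z%:~R) k).

Definition dyadic (j : int) (k : 'rV[int]_n) : set E :=
  [set x | forall i, (2 : R) ^ (- j) * (k ord0 i)%:~R <= x ord0 i
                     < (2 : R) ^ (- j) * ((k ord0 i)%:~R + 1)].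

Definition unit_cube : set E := [set x | forall i, 0 <= x ord0 i < 1].

(* Continuity selects the everywhere defined representative of a generator
   given through its Fourier transform, so that suprema of its modulus make
   sense; integrability gives the Fourier integral its meaning. *)
Definition band_limited (a b : R) (h : E -> C) : Prop :=
  [/\ ccontinuous h, cintegrable h, csmooth (fourier h) &
      supported_in_annulus a b (fourier h)].

Definition in_M (tau : R) (h : E -> C) : Prop :=
  exists K : R, forall x, (1 + enorm x) `^ (2 * n%:R + tau) * cmod (h x) <= K.

Definition in_D (sigma : R) (h : E -> C) : Prop :=
  cmeasurable h /\
  (\int[mu]_x ((1 + enorm x `^ sigma) * cmod (h x))%:E < +oo)%E.

Definition envelope (h : E -> C) (m : nat) : R :=
  match m with
  | 0 => sup [set cmod (h z) | z in [set: E]]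
  | m'.+1 => sup [set cmod (h z) | z in [set z : E | m'%:R <= `|z|]]
  end.

(* The terms are nonnegative; the sum is finite whenever h decays rapidly. *)
Definition decay_sum (e : R) (h : E -> C) : R :=
  fine (\sum_(0 <= i <oo)
    ((envelope h i - envelope h i.+1) * (i.*2.+1%:R `^ e))%:E)%E.

Definition conj_exp (p : R) : R := p / (p - 1).

Definition K_U (p : R) (h : E -> C) : R :=
  decay_sum (n%:R + n%:R / conj_exp p) h.

Definition K_L (p : R) (h : E -> C) : R := decay_sum (n%:R + n%:R / p) h.

End euclidean.

Section wavelets.
Context (R : realType) (n L : nat).
Local Notation E := 'rV[R]_n.
Local Notation C := R[i].

Definition windex : choiceType := ('I_L * int * 'rV[int]_n)%type.

Implicit Types (psi psit : 'I_L -> E -> C) (Lam : {fset windex}).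

Definition wsys psi (l : windex) : E -> C := wav (psi l.1.1) l.1.2 l.2.

Definition wcomb psi Lam (d : windex -> C) (x : E) : C :=
  \sum_(l <- Lam) d l * wsys psi l x.

Definition riesz_basis psi : Prop :=
  [/\ (forall l, L2 (wsys psi l)),
      (forall f, L2 f -> forall e : R, 0 < e -> exists Lam d,
         (L2_norm (fun x => (f x - wcomb psi Lam d x)%R) < e%:E)%E) &
      exists A B : R, [/\ 0 < A, 0 < B & forall Lam d,
        ((A * \sum_(l <- Lam) cmod (d l) ^+ 2)%:E
           <= L2_norm (wcomb psi Lam d) `^ 2
           <= (B * \sum_(l <- Lam) cmod (d l) ^+ 2)%:E)%E]].

(* The expansion is understood as unconditional convergence in L2: along the
   net of finite sets of indices. *)
Definition wavelet_pair (a b : R) psi psit : Prop :=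
  [/\ (forall e, band_limited a b (psi e) /\ band_limited a b (psit e)),
      riesz_basis psi, riesz_basis psit,
      (forall l l', cpair (wsys psi l) (wsys psit l') = (l == l')%:R) &
      forall f, L2 f -> forall e : R, 0 < e ->
        exists Lam0, forall Lam, (Lam0 `<=` Lam)%fset ->
          (L2_norm (fun x => (f x
             - wcomb psi Lam (fun l => cpair f (wsys psit l)) x)%R) < e%:E)%E].

Definition nterm_error psi (p : R) (w : E -> R) (N : nat) (f : E -> C) :
    \bar R :=
  ereal_inf [set z | exists Lam d, (#|` Lam| <= N)%N /\
    z = Lpw_norm p w (fun x => f x - wcomb psi Lam d x)].

Definition partial_expansion psi psit (f : E -> C) (J : nat) (x : E) : C :=
  \sum_(e < L) \sum_(0 <= j < J.+1)
    \sum_(k \in [set k | dyadic j%:Z k `<=` @unit_cube R n])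
      cpair f (wsys psit (e, j%:Z, k)) * wsys psi (e, j%:Z, k) x.

Definition localized_besov psi psit (phi : E -> C) (s p q : R) (w : E -> R) :
    set (E -> C) :=
  [set f | [/\ Lpw p w f,
    besov_space phi s p q w (class_mod_poly (distr_of f)) &
    Lpw_norm p w (fun x => f x - partial_expansion psi psit f J x)
      @[J --> \oo] --> 0%E]].

Definition single_scale psi (j : int) (f : E -> C) : Prop :=
  exists Lam d, (forall l, l \in Lam -> l.1.2 = j) /\ f = wcomb psi Lam d.

End wavelets.

Section constants.
Context (R : realType) (n : nat).
Local Notation E := 'rV[R]_n.
Local Notation C := R[i].

Definition log2 (x : R) : R := ln x / ln 2.

Definition band_width (a b c1 c2 : R) : nat :=
  absz (Num.ceil (Num.max (Num.max (log2 (b / c1)) (log2 (c2 / a))) 0)).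

Definition band (M : nat) : seq int :=
  [seq i%:Z - M%:Z | i <- iota 0 M.*2.+1].

Definition C_M (s : R) (M : nat) : R := \sum_(i <- band M) 2 `^ (i%:~R * s).

Definition C'_M (s q : R) (M : nat) : R :=
  (\sum_(i <- band M) 2 `^ (i%:~R * s * q)) `^ q^-1.

Definition K_eta (p : R) (M : nat) (phi psi : E -> C) : R :=
  \big[Num.max/0]_(i <- band M) K_U p (convol (dilate phi i) psi).

Definition c_flat (s p q : R) (M : nat) (phi psi psit : E -> C) : R :=
  (1 - 2 ^- n) `^ p^-1 * 2 `^ (- s) /
    (K_L p psit * K_eta p M phi psi * C'_M s q M).

Definition c_sharp (s p : R) (M : nat) (psi psit : E -> C) : R :=
  (1 - 2 ^- n) `^ p^-1 * 2 `^ (- s) * K_U p psi * K_L p psit * C_M s M.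

Definition theta (p : R) : R := 2^-1 * Num.max 1 (p - 1)^-1.

End constants.

(* Main.v *)
Require Import Defs.
From HB Require Import structures.
From mathcomp Require Import all_boot all_order all_algebra finmap.
From mathcomp Require Import complex.
From mathcomp Require Import all_classical all_reals all_analysis.
From mathcomp Require Import measurable_realfun zify ring lra.
Import Order.TTheory GRing.Theory Num.Theory.
Import numFieldNormedType.Exports.

Set Implicit Arguments.
Unset Strict Implicit.
Unset Printing Implicit Defensive.

Local Open Scope classical_set_scope.
Local Open Scope ring_scope.

(* With j = m + 1, the extremal function is the sum of the (2 ^ j) ^ n wavelets
   psi1_{j,k} with Q_{j,k} in the unit cube, the k-th one with coefficient of
   modulus 2 ^ (- j n / 2) w(Q_{j,k}) ^ (-1/p), so that all terms weigh the same
   in L^p_w.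
   Slicing the envelope of a generator h into layers gives
   |h(2 ^ j x - k)| <= sum_i (beta_i - beta_(i+1)) 1[x in H_i], with H_i the cube
   of side (2 i + 1) 2 ^ (-j) around Q_{j,k}.  Convexity of t ^ p, the bounded
   overlap of the H_i and the A_p condition on H_i then give, for these
   coefficients c_k,
     || sum_(k in S) c_k h_{j,k} || <= K_U(h) [w]_Ap ^ (1/p) #|S| ^ (1/p)
   and, dually, #|S| ^ (1/p) <= K_L(h) [w]_Ap ^ (1/p) || g || whenever <g, h_{j,k}>
   equals c_k for all k in S.
   Discarding N of the 2 ^ n N terms bounds the N-term error from above; from
   below, an N-term approximant leaves by biorthogonality at least (2 ^ n - 1) N
   coefficients unchanged.  The Littlewood-Paley block phi_(j+i) * f is the same
   combination of the scaled function phi_i * psi1, and vanishes unless |i| <= M,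
   which bounds the Besov norm from above; f is the sum of these blocks, which
   bounds it from below. *)

(** * Borel sets, affine changes of variables and complex integrals *)

(** The exponents in [K_U] and [K_L] are the ones that leave no residual constant. Layer [i] enters
    with weight [gap i * a i], where [a i = (2 i + 1) ^ e]; convexity costs [a i ^ (- p)], overlap
    and A_p comparison cost powers of [vol i = (2 i + 1) ^ n], and these cancel exactly for
    [e = n + n / p'] above and [e = n + n / p] below. Each estimate carries one factor [[w]_Ap ^
    (1/p)]; either bound on the ratio combines one upper with one dual estimate, whence the exponent
    [2 / p]. The dual generators are only known to decay in the mean, while their envelopes need
    pointwise decay. It is recovered by writing a band-limited [h] as the finite sum of its blocks
    [phi_i * h], convolutions with Schwartz functions. This identity, and the vanishing of all other
    blocks, must hold at every point, which calls for injectivity of the Fourier transform on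
    continuous integrable functions. No constant in the denominator of [c_flat] is assumed positive:
    were one zero, the estimates would bound a positive quantity, [#|S| ^ (1/p)] or the Besov norm,
    by zero. *)

Section measurability.
Context (R : realType) (n : nat).
Local Notation E := 'rV[R]_n.
Local Notation mu := (lebesgue_rV R n).

Lemma measurable_ball_rV (x : E) (e : R) : measurable (ball x e : set E).
Proof.
have [e0|e0] := ltP 0 e; last first.
  rewrite (_ : ball x e = set0)//; apply/seteqP; split => // y [e0' _].
  by move: (lt_le_trans e0' e0); rewrite ltxx.
rewrite (_ : ball x e = \bigcap_(i in [set: 'I_n])
   ((fun y : E => y ord0 i) @^-1` (ball (x ord0 i) e))).
  apply: fin_bigcap_measurable => // i _.
  rewrite -[X in measurable X]setTI; apply: measurable_coord => //.
  by apply: open_measurable; exact: ball_open.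
apply/seteqP; split => y /=.
  by move=> [_ h] i _; exact: h.
by move=> h; split => // i j; rewrite ord1; exact: h.
Qed.

(** The sigma-algebra is generated by coordinates, not by open sets, so [U] is exhausted by
    countably many measurable sets: the balls with rational centre and radius [1 / (m + 1)]
    contained in it. *)
Lemma open_measurable_rV (U : set E) : open U -> measurable U.
Proof.
move=> oU.
pose q2r (q : 'rV[rat]_n) : E := map_mx ratr q.
pose F (qm : 'rV[rat]_n * nat) : set E :=
  if `[< ball (q2r qm.1) qm.2.+1%:R^-1 `<=` U >] then ball (q2r qm.1) qm.2.+1%:R^-1
  else set0.
rewrite (_ : U = \bigcup_(qm in [set: 'rV[rat]_n * nat]) F qm); last first.
  apply/seteqP; split => [x Ux|x [[q m] _]]; last first.
    by rewrite /F; case: asboolP => // + /=; exact.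
  have /nbhs_ballP [e /= e0 eU] : nbhs x U by exact: open_nbhs_nbhs.
  (* Half of [e]: a ball of this radius around a rational point that is this close to [x] stays
     within distance [e] of [x]. *)
  have [m me] : exists m : nat, m.+1%:R^-1 < e / 2.
    have e20 : 0 < e / 2 by rewrite divr_gt0.
    have [N _ h] := near_infty_natSinv_lt (PosNum e20).
    by exists N; exact: (h N (leqnn N)).
  have qx i : exists q : rat, ball (x ord0 i) m.+1%:R^-1 (ratr q).
    have [|q] := @rat_in_itvoo R (x ord0 i - m.+1%:R^-1) (x ord0 i + m.+1%:R^-1).
      by rewrite ltrD2l gtrN ?invr_gt0 ?ltr0n.
    by rewrite in_itv/= => h; exists q; rewrite ball_itv /= in_itv.
  have [q hq] := choice qx.
  pose Q : 'rV[rat]_n := \row_i q i.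
  have xQ : ball x m.+1%:R^-1 (q2r Q).
    split; first by rewrite invr_gt0 ltr0n.
    by move=> i j; rewrite ord1 !mxE; exact: hq.
  exists (Q, m) => //; rewrite /F /=; case: asboolP => [_|].
    exact: ball_sym.
  case; move=> y Qy; apply: eU.
  apply: (@le_ball _ _ _ (m.+1%:R^-1 + m.+1%:R^-1)).
    by rewrite (splitr e) lerD// ltW.
  exact: ball_triangle xQ Qy.
apply: countable_bigcupT_measurable => //.
by move=> [q m]; rewrite /F; case: ifP => // _; exact: measurable_ball_rV.
Qed.

Lemma continuous_measurable_rV (f : E -> R) : continuous f ->
  measurable_fun [set: E] f.
Proof.
move=> /continuousP cf; apply: (measurability _ (RGenOpens.measurableE R)).
move=> _ [_ [a [b ->] <-]]; rewrite setTI; apply: open_measurable_rV.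
exact/cf/interval_open.
Qed.

End measurability.

(** Provides the rescaled image measure as a measure known only by its values, the form in which
    uniqueness of measures is applied to affine maps. *)
Lemma pushforward_scale d d' (T1 : measurableType d) (T2 : measurableType d')
    (R : realType) (m : {measure set T1 -> \bar R}) (f : T1 -> T2) (r : {nonneg R}) :
  measurable_fun [set: T1] f ->
  exists m' : {measure set T2 -> \bar R},
    forall X, m' X = (r%:num%:E * m (f @^-1` X))%E.
Proof. by move=> mf; unshelve eexists (mscale r (pushforward m f)). Qed.

Section affine.
Context (R : realType).

(** The image measure multiplied by [|c|] agrees with Lebesgue measure on half-open intervals, hence
    everywhere. *)
Lemma lebesgue_measure_affine (c u : R) (A : set (measurableTypeR R)) :
  c != 0 -> measurable A ->
  lebesgue_measure ((fun t => c * t + u) @^-1` A) =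
    (`|c|^-1%:E * lebesgue_measure A)%E.
Proof.
move=> c0 mA.
pose f0 : measurableTypeR R -> measurableTypeR R := fun t => c * t + u.
have mf : measurable_fun [set: measurableTypeR R] f0.
  by apply: measurable_funD => //; exact: measurable_funM.
have nc0 : 0 <= `|c| by [].
have [m mE0] := pushforward_scale lebesgue_measure (NngNum nc0) mf.
have mE : forall X, ocitv X -> lebesgue_measure X = m X.
  move=> _ [[a b] _ <-]; rewrite mE0 /= /f0.
  have [c_gt0|c_lt0|ce0] := ltgtP 0 c; last 1 first.
  - by move: c0; rewrite -ce0 eqxx.
  - rewrite (_ : _ @^-1` _ = `] (a - u) / c, (b - u) / c]%classic); last first.
      apply/seteqP; split => x /=; rewrite !in_itv/= ltr_pdivrMr// ler_pdivlMr// (mulrC x) ltrBlDr lerBrDr//.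
    rewrite !lebesgue_measure_itv/= !lte_fin ltr_pM2r ?invr_gt0// ltrD2r.
    case: ifPn => ab; last by rewrite mule0.
    rewrite -!EFinB -EFinM gtr0_norm//; congr EFin.
    by rewrite -mulrBl mulrCA divff// mulr1; ring.
  (* A negative [c] moves the closed end of the interval to the left, which does not change the
     length. *)
  - rewrite (_ : _ @^-1` _ = `[ (b - u) / c, (a - u) / c[%classic); last first.
      apply/seteqP; split => x /=; rewrite !in_itv/= ltr_ndivlMr// ler_ndivrMr// (mulrC x) ltrBlDr lerBrDr andbC//.
    rewrite !lebesgue_measure_itv/= !lte_fin ltr_nM2r ?invr_lt0// ltrD2r.
    case: ifPn => ab; last by rewrite mule0.
    rewrite -!EFinB -EFinM ltr0_norm//; congr EFin.
    by rewrite -mulrBl mulrCA mulNr divff// mulrN1; ring.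
by rewrite (lebesgue_measure_unique mE mA) mE0 /= muleA -EFinM mulVf ?normr_eq0// mul1e.
Qed.

Context (n : nat).
Local Notation E := 'rV[R]_n.
Local Notation mu := (lebesgue_rV R n).

Definition box (A : 'I_n -> set (measurableTypeR R)) : set E :=
  [set x | forall i, A i (x ord0 i)].

Lemma measurable_box A : (forall i, measurable (A i)) -> measurable (box A).
Proof.
move=> mA; rewrite (_ : box A = \bigcap_(i in [set: 'I_n])
   ((fun y : E => y ord0 i) @^-1` A i)).
  apply: fin_bigcap_measurable => // i _.
  by rewrite -[X in measurable X]setTI; exact: (@measurable_coord R n i _ _ (mA i)).
by apply/seteqP; split => y /= h i; [move=> _|]; exact: h.
Qed.

Lemma lebesgue_box A : (forall i, measurable (A i)) ->
  mu (box A) = (\prod_(i < n) lebesgue_measure (A i))%E.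
Proof. exact: lebesgue_rV_box. Qed.

Lemma measurable_affine (c : R) (v : E) :
  measurable_fun [set: E] (fun x : E => c *: x + v).
Proof.
apply: measurable_fun_rV => i; under eq_fun do rewrite !mxE.
by apply: measurable_funD => //; apply: measurable_funM => //; exact: measurable_coord.
Qed.

(** Boxes are stable under intersection, generate the sigma-algebra (a coordinate preimage is a box
    whose other sides are full), and [[-k, k] ^ n] exhausts the space with finite measure. *)
Lemma measure_rV_unique (m : {measure set E -> \bar R}) :
  (forall A : 'I_n -> set (measurableTypeR R), (forall i, measurable (A i)) ->
     m (box A) = (\prod_(i < n) lebesgue_measure (A i))%E) ->
  forall A, measurable A -> mu A = m A.
Proof.
move=> mE A mA.
pose G : set (set E) := [set B | exists2 A, (forall i, measurable (A i)) & B = box A].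
pose g (k : nat) : set E := box (fun=> `[- k%:R, k%:R]%classic : set (measurableTypeR R)).
apply: (@measure_unique _ R E G g _ _ _ _ mu m) => //.
- apply/seteqP; split.
    apply: smallest_sub; first exact: smallest_sigma_algebra.
    rewrite -bigcup_seq => _ [i _] [B mB <-]; rewrite setTI.
    apply: sub_sigma_algebra; exists (fun j => if j == i then B else setT).
      by move=> j; case: ifP.
    apply/seteqP; split => x /= h; last by have := h i; rewrite eqxx.
    by move=> j; case: ifPn => // /eqP ->.
  apply: smallest_sub; first exact: sigma_algebra_measurable.
  by move=> _ [B mB ->]; exact: measurable_box.
- move=> _ _ [B mB ->] [D mD ->]; exists (fun i => B i `&` D i).
    by move=> i; exact: measurableI.
  by apply/seteqP; split => x /= => [[h1 h2] i|h]; split => // i; have [] := h i.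
- by move=> k; exists (fun=> `[- k%:R, k%:R]%classic).
- rewrite -subTset => x _.
  exists (Num.truncn `|x|).+1 => // i /=; rewrite in_itv/= -ler_norml.
  apply: (@le_trans _ _ `|x|).
    have /mapP[j Hj ->] : `|x ord0 i| \in [seq `|x y.1 y.2| | y : 'I_1 * 'I_n].
      by apply/mapP; exists (ord0, i) => //=; rewrite mem_enum.
    by rewrite [leRHS]/Num.norm /= mx_normrE; apply/bigmax_geP; right => /=; exists j.
  by rewrite ltW// truncnS_gt.
- by move=> _ [B mB ->]; rewrite mE//; exact: lebesgue_box.
- move=> k; suff h : (mu (g k) < +oo)%E by exact: h.
  have [r rE] : exists r : R,
      lebesgue_measure (`[- k%:R, k%:R]%classic : set (measurableTypeR R)) = r%:E.
    by rewrite lebesgue_measure_itv/= -EFinB; case: ifP => _; eexists.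
  by rewrite /g lebesgue_box//; under eq_bigr do rewrite rE; rewrite prodEFin ltry.
Qed.

Lemma lebesgue_rV_affine (c : R) (v : E) (A : set E) : c != 0 -> measurable A ->
  mu ((fun x => c *: x + v) @^-1` A) = ((`|c| ^- n)%:E * mu A)%E.
Proof.
move=> c0 mA.
have nc0 : 0 <= `|c| ^+ n by rewrite exprn_ge0.
have [m mE0] := pushforward_scale mu (NngNum nc0) (measurable_affine c v).
suff uE : forall A, measurable A -> mu A = m A.
  by rewrite [in RHS]uE// mE0 /= muleA -EFinM mulVf ?expf_neq0 ?normr_eq0// mul1e.
apply: measure_rV_unique => B mB; rewrite mE0 /=.
rewrite (_ : _ @^-1` _ = box (fun i => (fun t => c * t + v ord0 i) @^-1` B i)); last first.
  by apply/seteqP; split => x /= h i; have := h i; rewrite /= !mxE.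
rewrite lebesgue_box; last first.
  move=> i; rewrite -[X in measurable X]setTI.
  suff mf : measurable_fun setT (fun t : measurableTypeR R => c * t + v ord0 i : measurableTypeR R) by exact: mf.
  by apply: measurable_funD => //; exact: measurable_funM.
rewrite (eq_bigr (fun i => (`|c|^-1%:E * lebesgue_measure (B i))%E)); last first.
  by move=> i _; exact: lebesgue_measure_affine.
rewrite big_split/= prodEFin prodr_const card_ord muleA -EFinM.
by rewrite exprVn mulfV ?expf_neq0 ?normr_eq0// mul1e.
Qed.

End affine.

Section change_of_variables.
Context (R : realType) (n : nat).
Local Notation E := 'rV[R]_n.
Local Notation mu := (lebesgue_rV R n).

Lemma ge0_integral_affine (c : R) (v : E) (f : E -> \bar R) : c != 0 ->
  measurable_fun [set: E] f -> (forall x, (0 <= f x)%E) ->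
  (\int[mu]_x (f (c *: x + v)%R) = (`|c| ^- n)%:E * \int[mu]_x f x)%E.
Proof.
move=> c0 mf f0.
have mg := measurable_affine c v.
have -> : (\int[mu]_x (f (c *: x + v)%R) =
    \int[pushforward mu (fun x : E => (c *: x + v)%R)]_x f x)%E.
  by rewrite ge0_integral_pushforward.
have nc0 : 0 <= `|c| ^- n by rewrite invr_ge0 exprn_ge0.
rewrite -(@ge0_integral_mscale _ _ _ mu _ measurableT (NngNum nc0))//.
apply: eq_measure_integral => A mA _.
exact: lebesgue_rV_affine.
Qed.

Lemma integrable_affine (c : R) (v : E) (f : E -> R) : c != 0 ->
  mu.-integrable setT (EFin \o f) ->
  mu.-integrable setT (fun x => (f (c *: x + v))%:E).
Proof.
move=> c0 /integrableP[mf foo].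
apply/integrableP; split.
  exact: (measurableT_comp mf (measurable_affine c v)).
rewrite (@ge0_integral_affine c v (fun x => `|(f x)%:E|%E))//.
  by rewrite lte_mul_pinfty// lee_fin invr_ge0 exprn_ge0.
exact: measurableT_comp.
Qed.

Lemma Rintegral_affine (c : R) (v : E) (f : E -> R) : c != 0 ->
  mu.-integrable setT (EFin \o f) ->
  \int[mu]_x f (c *: x + v) = `|c| ^- n * \int[mu]_x f x.
Proof.
move=> c0 fi; have /integrableP[mf foo] := fi.
rewrite /Rintegral.
rewrite -[(`|c| ^- n)]/(fine ((`|c| ^- n)%:E)) -fineM//; last exact: integrable_fin_num.
congr fine.
rewrite integralE [in RHS]integralE.
have := @funepos_comp _ _ _ (EFin \o f) (fun x : E => c *: x + v).
have := @funeneg_comp _ _ _ (EFin \o f) (fun x : E => c *: x + v).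
rewrite /comp => -> ->.
rewrite (@ge0_integral_affine c v _ c0 (measurable_funepos mf) (funepos_ge0 _)).
rewrite (@ge0_integral_affine c v _ c0 (measurable_funeneg mf) (funeneg_ge0 _)).
rewrite -muleBr//; apply: fin_num_adde_defl.
by rewrite fin_numN integrable_neg_fin_num.
Qed.

End change_of_variables.

Section complex_modulus.
Context (R : realType).
Implicit Types x y z : R[i].

Lemma cmod_ge0 z : 0 <= cmod z.
Proof. by case: z => a b; exact: sqrtr_ge0. Qed.

Lemma cmod0 : cmod (0 : R[i]) = 0.
Proof. exact: ComplexField.Normc.normc0. Qed.

Lemma cmodM x y : cmod (x * y) = cmod x * cmod y.
Proof. exact: ComplexField.Normc.normcM. Qed.

Lemma ler_cmodD x y : cmod (x + y) <= cmod x + cmod y.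
Proof. exact: le_normcD. Qed.

Lemma cmodN x : cmod (- x) = cmod x.
Proof. exact: normcN. Qed.

Lemma cmod_real (a : R) : cmod (a%:C)%C = `|a|.
Proof. by rewrite /cmod /= expr0n addr0 sqrtr_sqr. Qed.

Lemma ler_Re_cmod z : `|complex.Re z| <= cmod z.
Proof.
by case: z => a b; rewrite /cmod /= -sqrtr_sqr; apply: ler_wsqrtr; rewrite lerDl sqr_ge0.
Qed.

Lemma ler_Im_cmod z : `|complex.Im z| <= cmod z.
Proof.
by case: z => a b; rewrite /cmod /= -sqrtr_sqr; apply: ler_wsqrtr; rewrite lerDr sqr_ge0.
Qed.

Lemma ler_cmod_ReIm z : cmod z <= `|complex.Re z| + `|complex.Im z|.
Proof.
case: z => a b; rewrite /cmod /=.
rewrite -[leRHS]ger0_norm ?addr_ge0// -sqrtr_sqr; apply: ler_wsqrtr.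
rewrite sqrrD !real_normK ?num_real//.
by rewrite -addrA lerD2l lerDr mulrn_wge0// mulr_ge0.
Qed.

Lemma ReD x y : complex.Re (x + y) = complex.Re x + complex.Re y.
Proof. by case: x y => ? ? [? ?]. Qed.

Lemma ImD x y : complex.Im (x + y) = complex.Im x + complex.Im y.
Proof. by case: x y => ? ? [? ?]. Qed.

Lemma ReM x y : complex.Re (x * y) =
  complex.Re x * complex.Re y - complex.Im x * complex.Im y.
Proof. by case: x y => ? ? [? ?]. Qed.

Lemma ImM x y : complex.Im (x * y) =
  complex.Re x * complex.Im y + complex.Im x * complex.Re y.
Proof. by case: x y => ? ? [? ?]. Qed.

Lemma ReN x : complex.Re (- x) = - complex.Re x.
Proof. by case: x. Qed.

Lemma ImN x : complex.Im (- x) = - complex.Im x.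
Proof. by case: x. Qed.

Lemma complex_ext x y : complex.Re x = complex.Re y ->
  complex.Im x = complex.Im y -> x = y.
Proof. by case: x y => ? ? [? ?] /= -> ->. Qed.

Lemma ReMr z (u : R) : complex.Re (z * (u%:C)%C) = complex.Re z * u.
Proof. by case: z => a b /=; rewrite mulr0 subr0. Qed.

Lemma ImMr z (u : R) : complex.Im (z * (u%:C)%C) = complex.Im z * u.
Proof. by case: z => a b /=; rewrite mulr0 add0r. Qed.

Lemma cmod_conj z : cmod (z^*)%C = cmod z.
Proof. by case: z => a b; rewrite /cmod /= sqrrN. Qed.

Lemma cmod_sum I (r : seq I) (P : pred I) (F : I -> R[i]) :
  cmod (\sum_(i <- r | P i) F i) <= \sum_(i <- r | P i) cmod (F i).
Proof.
elim/big_ind2: _ => [|u v x y uv xy|//]; first by rewrite cmod0.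
by rewrite (le_trans (ler_cmodD _ _))// lerD.
Qed.

End complex_modulus.

Section complex_integral.
Context (R : realType) (n : nat).
Local Notation E := 'rV[R]_n.
Local Notation C := R[i].
Local Notation mu := (lebesgue_rV R n).
Implicit Types f g : E -> C.

Lemma cmeasurable_cst (c : C) : cmeasurable (fun _ : E => c).
Proof. by split. Qed.

Lemma cmeasurableD f g : cmeasurable f -> cmeasurable g ->
  cmeasurable (fun x => f x + g x).
Proof.
move=> [f1 f2] [g1 g2]; split.
  by under eq_fun do rewrite ReD; exact: measurable_funD.
by under eq_fun do rewrite ImD; exact: measurable_funD.
Qed.

Lemma cmeasurableM f g : cmeasurable f -> cmeasurable g ->
  cmeasurable (fun x => f x * g x).
Proof.
move=> [f1 f2] [g1 g2]; split.
  under eq_fun do rewrite ReM.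
  by apply: measurable_funB; exact: measurable_funM.
under eq_fun do rewrite ImM.
by apply: measurable_funD; exact: measurable_funM.
Qed.

Lemma cmeasurable_sum I (r : seq I) (P : pred I) (F : I -> E -> C) :
  (forall i, P i -> cmeasurable (F i)) ->
  cmeasurable (fun x => \sum_(i <- r | P i) F i x).
Proof.
move=> mF; elim: r => [|i r IH].
  rewrite (_ : (fun x => _) = fun=> 0); first exact: cmeasurable_cst.
  by apply/funext => x; rewrite big_nil.
case Pi : (P i); last first.
  rewrite (_ : (fun x => _) = fun x => \sum_(j <- r | P j) F j x)//.
  by apply/funext => x; rewrite big_cons Pi.
rewrite (_ : (fun x => _) = fun x => F i x + \sum_(j <- r | P j) F j x); last first.
  by apply/funext => x; rewrite big_cons Pi.
by apply: cmeasurableD => //; exact: mF.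
Qed.

Lemma cmeasurable_conj f : cmeasurable f -> cmeasurable (fun x => (f x)^*%C).
Proof.
move=> [f1 f2]; split.
  rewrite (_ : (fun x => _) = fun x => complex.Re (f x))//.
  by apply/funext => x; case: (f x).
rewrite (_ : (fun x => _) = fun x => - complex.Im (f x)); first exact: measurableT_comp.
by apply/funext => x; case: (f x).
Qed.

Lemma cmeasurable_comp f (h : E -> E) : measurable_fun setT h ->
  cmeasurable f -> cmeasurable (f \o h).
Proof. by move=> mh [f1 f2]; split; [exact: (measurableT_comp f1 mh)|exact: (measurableT_comp f2 mh)]. Qed.

Lemma cmodE (z : C) : cmod z = Num.sqrt (complex.Re z ^+ 2 + complex.Im z ^+ 2).
Proof. by case: z. Qed.

Lemma measurable_cmod d (T : measurableType d) (f : T -> C) :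
  measurable_fun setT (fun x => complex.Re (f x)) ->
  measurable_fun setT (fun x => complex.Im (f x)) ->
  measurable_fun setT (fun x => cmod (f x)).
Proof.
move=> f1 f2; under eq_fun do rewrite cmodE.
apply: (measurableT_comp (f := @Num.sqrt R)).
  apply: continuous_measurable_fun; exact: sqrt_continuous.
by apply: measurable_funD; exact: measurable_funX.
Qed.

Lemma cmeasurable_cmod f : cmeasurable f -> measurable_fun setT (fun x => cmod (f x)).
Proof. by move=> [f1 f2]; exact: measurable_cmod. Qed.

Lemma ccontinuous_measurable f : ccontinuous f -> cmeasurable f.
Proof. by move=> [f1 f2]; split; exact: continuous_measurable_rV. Qed.

Lemma integrable_leR (f g : E -> R) : measurable_fun setT f ->
  (forall x, `|f x| <= g x) -> mu.-integrable setT (EFin \o g) ->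
  mu.-integrable setT (EFin \o f).
Proof.
move=> mf fg; apply: le_integrable => //; first exact/measurable_EFinP.
by move=> x _; rewrite /= lee_fin (le_trans (fg x))// ler_norm.
Qed.

Lemma cintegrable_le f (g : E -> R) : cmeasurable f ->
  (forall x, cmod (f x) <= g x) -> mu.-integrable setT (EFin \o g) ->
  cintegrable f.
Proof.
move=> [f1 f2] fg gi; split.
  by apply: integrable_leR gi => // x; rewrite (le_trans (ler_Re_cmod _)).
by apply: integrable_leR gi => // x; rewrite (le_trans (ler_Im_cmod _)).
Qed.

Lemma cintegrable_measurable f : cintegrable f -> cmeasurable f.
Proof.
by move=> [/measurable_int f1 /measurable_int f2]; split; exact/measurable_EFinP.
Qed.

Lemma cintegrable_cmod f : cintegrable f ->
  mu.-integrable setT (fun x => (cmod (f x))%:E).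
Proof.
move=> fi; have mf := cintegrable_measurable fi; have [f1 f2] := fi.
apply: (@integrable_leR _ (fun x => `|complex.Re (f x)| + `|complex.Im (f x)|)).
- exact: cmeasurable_cmod.
- by move=> x; rewrite ger0_norm ?cmod_ge0// ler_cmod_ReIm.
- have := integrableD measurableT (integrable_norm f1) (integrable_norm f2).
  by apply: eq_integrable.
Qed.

Lemma cintegrableD f g : cintegrable f -> cintegrable g ->
  cintegrable (fun x => f x + g x).
Proof.
move=> fi gi.
apply: (@cintegrable_le _ (fun x => cmod (f x) + cmod (g x))).
- by apply: cmeasurableD; exact: cintegrable_measurable.
- by move=> x; exact: ler_cmodD.
- have := integrableD measurableT (cintegrable_cmod fi) (cintegrable_cmod gi).
  by apply: eq_integrable.
Qed.

Lemma cintegrableMb f g (K : R) : cintegrable f -> cmeasurable g ->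
  (forall x, cmod (g x) <= K) -> cintegrable (fun x => f x * g x).
Proof.
move=> fi mg gK.
apply: (@cintegrable_le _ (fun x => K * cmod (f x))).
- by apply: cmeasurableM => //; exact: cintegrable_measurable.
- by move=> x; rewrite cmodM mulrC ler_wpM2r// cmod_ge0.
- have := integrableZl measurableT K (cintegrable_cmod fi).
  by apply: eq_integrable.
Qed.

Lemma cintegrableZl (c : C) f : cintegrable f -> cintegrable (fun x => c * f x).
Proof.
move=> fi; under eq_fun do rewrite mulrC.
by apply: (@cintegrableMb _ _ (cmod c)) => //; exact: cmeasurable_cst.
Qed.

Lemma cintegrable0 : cintegrable (fun _ : E => 0 : C).
Proof.
apply: (@cintegrable_le _ (fun=> 0)); first exact: cmeasurable_cst.
  by move=> x; rewrite cmod0.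
exact: integrable0.
Qed.

Lemma cintegrable_sum I (r : seq I) (P : pred I) (F : I -> E -> C) :
  (forall i, P i -> cintegrable (F i)) ->
  cintegrable (fun x => \sum_(i <- r | P i) F i x).
Proof.
move=> mF; elim: r => [|i r IH].
  rewrite (_ : (fun x => _) = fun=> 0); first exact: cintegrable0.
  by apply/funext => x; rewrite big_nil.
case Pi : (P i); last first.
  rewrite (_ : (fun x => _) = fun x => \sum_(j <- r | P j) F j x)//.
  by apply/funext => x; rewrite big_cons Pi.
rewrite (_ : (fun x => _) = fun x => F i x + \sum_(j <- r | P j) F j x); last first.
  by apply/funext => x; rewrite big_cons Pi.
by apply: cintegrableD => //; exact: mF.
Qed.

Lemma cintegral_ReE f : complex.Re (cintegral f) = \int[mu]_x complex.Re (f x).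
Proof. by []. Qed.

Lemma cintegral_ImE f : complex.Im (cintegral f) = \int[mu]_x complex.Im (f x).
Proof. by []. Qed.

Lemma eq_cintegral f g : f =1 g -> cintegral f = cintegral g.
Proof. by move=> /funext ->. Qed.

Lemma cintegral0 : cintegral (fun _ : E => 0 : C) = 0.
Proof.
by apply: complex_ext; rewrite ?cintegral_ReE ?cintegral_ImE/= /Rintegral integral0.
Qed.

Lemma cintegralD f g : cintegrable f -> cintegrable g ->
  cintegral (fun x => f x + g x) = cintegral f + cintegral g.
Proof.
move=> [f1 f2] [g1 g2]; apply: complex_ext.
  rewrite ReD !cintegral_ReE -RintegralD//.
  by apply: eq_Rintegral => x _; exact: ReD.
rewrite ImD !cintegral_ImE -RintegralD//.
by apply: eq_Rintegral => x _; exact: ImD.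
Qed.

Lemma cintegralZl (c : C) f : cintegrable f ->
  cintegral (fun x => c * f x) = c * cintegral f.
Proof.
move=> [f1 f2]; apply: complex_ext.
  rewrite ReM !cintegral_ReE !cintegral_ImE -!RintegralZl// -RintegralB//.
  - by apply: eq_Rintegral => x _; exact: ReM.
  - exact: (integrableZl measurableT (complex.Re c) f1).
  - exact: (integrableZl measurableT (complex.Im c) f2).
rewrite ImM !cintegral_ReE !cintegral_ImE -!RintegralZl// -RintegralD//.
- by apply: eq_Rintegral => x _; exact: ImM.
- exact: (integrableZl measurableT (complex.Re c) f2).
- exact: (integrableZl measurableT (complex.Im c) f1).
Qed.

Lemma cintegralZr (c : C) f : cintegrable f ->
  cintegral (fun x => f x * c) = cintegral f * c.
Proof.
move=> fi; rewrite mulrC -cintegralZl//; apply: eq_cintegral => x; exact: mulrC.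
Qed.

Lemma cintegral_sum I (r : seq I) (P : pred I) (F : I -> E -> C) :
  (forall i, P i -> cintegrable (F i)) ->
  cintegral (fun x => \sum_(i <- r | P i) F i x) =
  \sum_(i <- r | P i) cintegral (F i).
Proof.
move=> mF; elim: r => [|i r IH].
  rewrite big_nil (_ : (fun x => _) = fun=> 0); first exact: cintegral0.
  by apply/funext => x; rewrite big_nil.
rewrite big_cons; case: ifPn => Pi; last first.
  rewrite -IH; apply: eq_cintegral => x.
  by rewrite big_cons (negbTE Pi).
rewrite (_ : (fun x => _) = fun x => F i x + \sum_(j <- r | P j) F j x); last first.
  by apply/funext => x; rewrite big_cons Pi.
by rewrite cintegralD ?IH//; [exact: mF|exact: cintegrable_sum].
Qed.

Lemma cintegrable_affine f (c : R) (v : E) : c != 0 -> cintegrable f ->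
  cintegrable (fun x => f (c *: x + v)).
Proof.
move=> c0 [f1 f2]; split.
  exact: (@integrable_affine _ _ _ _ (fun x => complex.Re (f x))).
exact: (@integrable_affine _ _ _ _ (fun x => complex.Im (f x))).
Qed.

Lemma cintegral_affine f (c : R) (v : E) : c != 0 -> cintegrable f ->
  cintegral (fun x => f (c *: x + v)) = (`|c| ^- n)%:C%C * cintegral f.
Proof.
move=> c0 [f1 f2]; apply: complex_ext.
  rewrite ReM/= mul0r subr0.
  exact: (@Rintegral_affine _ _ _ _ (fun x => complex.Re (f x))).
rewrite ImM/= mul0r addr0.
exact: (@Rintegral_affine _ _ _ _ (fun x => complex.Im (f x))).
Qed.

(** Rotation trick: with [z] the integral, [|z| ^ 2] is the integral of the real part of [z^* f],
    which is at most [|z|] times the integral of [|f|]. *)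
Lemma ler_cmod_cintegral f : cintegrable f ->
  cmod (cintegral f) <= \int[mu]_x cmod (f x).
Proof.
move=> fi; set z := cintegral f.
have [z0|z0] := eqVneq (cmod z) 0.
  by rewrite z0; apply: Rintegral_ge0 => x _; exact: cmod_ge0.
have zz : cmod z ^+ 2 = complex.Re ((z^*)%C * z).
  by rewrite cmodE sqr_sqrtr ?addr_ge0 ?sqr_ge0//; case: (z) => a b /=; ring.
have h : cmod z ^+ 2 <= cmod z * \int[mu]_x cmod (f x).
  rewrite zz /z -cintegralZl// -/z cintegral_ReE -RintegralZl//; last exact: cintegrable_cmod.
  apply: le_Rintegral => //.
  - by have [] := @cintegrableZl (z^*)%C f fi.
  - exact: (integrableZl measurableT (cmod z) (cintegrable_cmod fi)).
  - move=> x _; rewrite (le_trans (ler_norm _))// (le_trans (ler_Re_cmod _))//.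
    by rewrite cmodM cmod_conj.
by move: h; rewrite expr2 ler_pM2l// lt0r z0 cmod_ge0.
Qed.

End complex_integral.

(** * Injectivity of the Fourier transform *)

Section fourier_uniqueness.
Context (R : realType) (n : nat).
Local Notation E := 'rV[R]_n.
Local Notation C := R[i].
Local Notation mu := (lebesgue_rV R n).
Implicit Types (f g h : E -> C) (F G : E -> R).

(** The exponential [e ^ (- 2 pi i x . xi)]; by conversion [fourier f xi] is the integral of
    [f x * character xi x]. *)
Definition character (xi x : E) : C :=
  (cos (2 * pi * dotv x xi) -i* sin (2 * pi * dotv x xi))%C.

Lemma cmod_character xi x : cmod (character xi x) = 1.
Proof. by rewrite cmodE /= sqrrN cos2Dsin2 sqrtr1. Qed.

Lemma measurable_dotv (xi : E) : measurable_fun setT (fun x : E => dotv x xi).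
Proof.
rewrite /dotv; apply: measurable_sum => i; apply: measurable_funM => //.
exact: measurable_coord.
Qed.

Lemma measurable_character xi : cmeasurable (character xi).
Proof.
have md : measurable_fun setT (fun x : E => 2 * pi * dotv x xi).
  by apply: measurable_funM => //; exact: measurable_dotv.
split.
  apply: (measurableT_comp (f := @cos R)) => //.
  by apply: continuous_measurable_fun; exact: continuous_cos.
apply: (@measurable_funN _ _ _ setT (fun x : E => sin (2 * pi * dotv x xi))).
apply: (measurableT_comp (f := @sin R)) => //.
by apply: continuous_measurable_fun; exact: continuous_sin.
Qed.

Lemma cintegrable_character f xi : cintegrable f ->
  cintegrable (fun x => f x * character xi x).
Proof.
move=> fi; apply: (@cintegrableMb _ _ _ _ 1) => //.
  exact: measurable_character.
by move=> x; rewrite cmod_character.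
Qed.

(* Bounded functions preserving the kernel of the Fourier transform form an
   algebra stable under bounded pointwise limits and containing the
   trigonometric functions, hence indicators of boxes: this avoids Fourier
   inversion. *)
Definition fourier_null h := cintegrable h /\ forall xi, fourier h xi = 0.

Definition null_multiplier F :=
  [/\ measurable_fun setT F, exists K, forall x, `|F x| <= K &
      forall h, fourier_null h -> fourier_null (fun x => h x * (F x)%:C%C)].

Lemma cmeasurable_real F : measurable_fun setT F -> cmeasurable (fun x => (F x)%:C%C).
Proof. by move=> mF; split. Qed.

Lemma cintegrable_mulr_real f F K : cintegrable f -> measurable_fun setT F ->
  (forall x, `|F x| <= K) -> cintegrable (fun x => f x * (F x)%:C%C).
Proof.
move=> fi mF FK; apply: (@cintegrableMb _ _ _ _ K) => //.
by move=> x; rewrite cmod_real.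
Qed.

Lemma null_multiplier_cst c : null_multiplier (fun=> c).
Proof.
split => //; first by exists `|c|.
move=> h [hi h0]; split; first exact: (@cintegrable_mulr_real _ _ `|c|).
move=> xi; rewrite /fourier.
transitivity (c%:C%C * fourier h xi); last by rewrite h0 mulr0.
rewrite -cintegralZl; last exact: cintegrable_character.
by apply: eq_cintegral => x; ring.
Qed.

Lemma null_multiplierD F G : null_multiplier F -> null_multiplier G ->
  null_multiplier (fun x => F x + G x).
Proof.
move=> [mF [K FK] hF] [mG [L GL] hG]; split.
- exact: measurable_funD.
- by exists (K + L) => x; rewrite (le_trans (ler_normD _ _))// lerD.
- move=> h hh; have [Fi F0] := hF _ hh; have [Gi G0] := hG _ hh; split.
    rewrite (_ : (fun x => _) = fun x => h x * (F x)%:C%C + h x * (G x)%:C%C).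
      exact: cintegrableD.
    by apply/funext => x; rewrite rmorphD mulrDr.
  move=> xi.
  transitivity (fourier (fun x => h x * (F x)%:C%C) xi +
                fourier (fun x => h x * (G x)%:C%C) xi); last by rewrite F0 G0 addr0.
  rewrite /fourier -cintegralD; [|exact: cintegrable_character..].
  by apply: eq_cintegral => x; rewrite rmorphD mulrDr mulrDl.
Qed.

Lemma null_multiplierM F G : null_multiplier F -> null_multiplier G ->
  null_multiplier (fun x => F x * G x).
Proof.
move=> [mF [K FK] hF] [mG [L GL] hG]; split.
- exact: measurable_funM.
- by exists (K * L) => x; rewrite normrM ler_pM.
- move=> h hh; have := hG _ (hF _ hh).
  rewrite (_ : (fun x => h x * (F x)%:C%C * (G x)%:C%C) =
    (fun x => h x * (F x * G x)%:C%C))//.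
  by apply/funext => x; rewrite rmorphM mulrA.
Qed.

Lemma null_multiplier_prod I (r : seq I) (F : I -> E -> R) :
  (forall i, null_multiplier (F i)) -> null_multiplier (fun x => \prod_(i <- r) F i x).
Proof.
move=> hF; elim: r => [|i r IH].
  rewrite (_ : (fun x => _) = fun=> 1); first exact: null_multiplier_cst.
  by apply/funext => x; rewrite big_nil.
rewrite (_ : (fun x => _) = fun x => F i x * \prod_(j <- r) F j x).
  exact: null_multiplierM.
by apply/funext => x; rewrite big_cons.
Qed.

Lemma Rintegral_dominated (f_ : (E -> R)^nat) (f g : E -> R) :
  (forall k, measurable_fun setT (f_ k)) ->
  (forall x, f_ ^~ x @ \oo --> f x) ->
  mu.-integrable setT (EFin \o g) -> (forall k x, `|f_ k x| <= g x) ->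
  (\int[mu]_x f_ k x) @[k --> \oo] --> \int[mu]_x f x.
Proof.
move=> mf_ ff gi fg.
have mf : measurable_fun setT f by apply: (measurable_fun_cvg mf_) => x _; exact: ff.
have ff' x : (fun k => (f_ k x)%:E) @ \oo --> (f x)%:E.
  by apply/fine_cvgP; split; [exact: nearW|exact: ff].
have mf_E k : measurable_fun setT (fun x => (f_ k x)%:E) by exact/measurable_EFinP.
have mfE : measurable_fun setT (EFin \o f) by exact/measurable_EFinP.
have cvgE : {ae mu, forall x, setT x -> (fun k => (f_ k x)%:E) @ \oo --> (f x)%:E}.
  by apply: aeW => x _; exact: ff'.
have bndE : {ae mu, forall x k, setT x -> (`|(f_ k x)%:E| <= (g x)%:E)%E}.
  by apply: aeW => x k _; rewrite /= lee_fin.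
have [fi _ lim] := dominated_convergence measurableT mf_E mfE cvgE gi bndE.
apply: fine_cvg.
by rewrite fineK; [exact: lim|exact: integrable_fin_num].
Qed.

Lemma cintegral_dominated (f_ : (E -> C)^nat) (f : E -> C) (g : E -> R) :
  (forall k, cmeasurable (f_ k)) ->
  (forall x, (fun k => complex.Re (f_ k x)) @ \oo --> complex.Re (f x)) ->
  (forall x, (fun k => complex.Im (f_ k x)) @ \oo --> complex.Im (f x)) ->
  mu.-integrable setT (EFin \o g) -> (forall k x, cmod (f_ k x) <= g x) ->
  (fun k => complex.Re (cintegral (f_ k))) @ \oo --> complex.Re (cintegral f) /\
  (fun k => complex.Im (cintegral (f_ k))) @ \oo --> complex.Im (cintegral f).
Proof.
move=> mf fR fI gi fg; split; rewrite ?cintegral_ReE ?cintegral_ImE.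
  apply: (@Rintegral_dominated _ _ g) => // [k|k x]; first by have [] := mf k.
  by rewrite (le_trans (ler_Re_cmod _)).
apply: (@Rintegral_dominated _ _ g) => // [k|k x]; first by have [] := mf k.
by rewrite (le_trans (ler_Im_cmod _)).
Qed.

(** The uniform bound makes [K * cmod (h x)] a majorant, so by dominated convergence the Fourier
    integrals, all zero, converge to those of the limit. *)
Lemma null_multiplier_lim (F_ : (E -> R)^nat) F K :
  (forall k, null_multiplier (F_ k)) -> (forall k x, `|F_ k x| <= K) ->
  (forall x, F_ ^~ x @ \oo --> F x) -> null_multiplier F.
Proof.
move=> hF FK FF.
have mF : measurable_fun setT F.
  by apply: (@measurable_fun_cvg _ _ _ setT F_) => [k|x _]; [have [] := hF k|exact: FF].
have FK' x : `|F x| <= K.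
  apply: (ler_cvg_to (cvg_norm (FF x)) (cvg_cst K)).
  by apply: nearW => k; exact: FK.
split => //; first by exists K.
move=> h hh; have [hi h0] := hh; split; first exact: (@cintegrable_mulr_real _ _ K).
move=> xi.
have [] := @cintegral_dominated
  (fun k x => h x * (F_ k x)%:C%C * character xi x)
  (fun x => h x * (F x)%:C%C * character xi x) (fun x => K * cmod (h x)).
- move=> k; apply: cmeasurableM; last exact: measurable_character.
  apply: cmeasurableM; first exact: cintegrable_measurable.
  by apply: cmeasurable_real; have [] := hF k.
- move=> x; have reE (u : R) : complex.Re (h x * u%:C%C * character xi x) =
      complex.Re (h x * character xi x) * u.
    by rewrite mulrAC ReMr.
  rewrite reE; under eq_fun do rewrite reE.
  by apply: cvgM; [exact: cvg_cst|exact: FF].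
- move=> x; have imE (u : R) : complex.Im (h x * u%:C%C * character xi x) =
      complex.Im (h x * character xi x) * u.
    by rewrite mulrAC ImMr.
  rewrite imE; under eq_fun do rewrite imE.
  by apply: cvgM; [exact: cvg_cst|exact: FF].
- exact: (integrableZl measurableT K (cintegrable_cmod hi)).
- move=> k x; rewrite !cmodM cmod_character mulr1 cmod_real mulrC.
  by rewrite ler_wpM2r// cmod_ge0.
have e k : cintegral (fun x => h x * (F_ k x)%:C%C * character xi x) = 0.
  by have [_ _ /(_ _ hh) [_ /(_ xi)]] := hF k.
under eq_fun do rewrite e; move=> HR.
under eq_fun do rewrite e; move=> HI.
apply: complex_ext.
  by apply/esym; apply: cvg_unique HR => //; exact: cvg_cst.
by apply/esym; apply: cvg_unique HI => //; exact: cvg_cst.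
Qed.

End fourier_uniqueness.

(** * The sign function as a limit of polynomials *)

Section sign_iteration.
Context (R : realType).

(* Iterating this polynomial on [-1, 1] converges to the sign; applied to sines
   of long period it produces half-spaces. *)
Definition sign_step (t : R) : R := (3 * t - t ^+ 3) / 2.

Lemma sign_stepN t : sign_step (- t) = - sign_step t.
Proof. by rewrite /sign_step; field. Qed.

Lemma iter_sign_stepN k t : iter k sign_step (- t) = - iter k sign_step t.
Proof. by elim: k => //= k ->; rewrite sign_stepN. Qed.

Lemma sign_step_itv t : 0 <= t <= 1 -> t <= sign_step t <= 1.
Proof.
move=> /andP[t0 t1]; apply/andP; split; rewrite -subr_ge0 /sign_step.
  rewrite (_ : _ - _ = t * (1 - t) * (1 + t) / 2); last by field.
  apply: divr_ge0 => //; apply: mulr_ge0; last exact: addr_ge0.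
  by apply: mulr_ge0 => //; rewrite subr_ge0.
rewrite (_ : _ - _ = (1 - t) ^+ 2 * (2 + t) / 2); last by field.
apply: divr_ge0 => //; apply: mulr_ge0; first exact: sqr_ge0.
exact: addr_ge0.
Qed.

Lemma iter_sign_step_itv k t : 0 <= t <= 1 -> t <= iter k sign_step t <= 1.
Proof.
move=> h; elim: k => [|k /andP[h1 h2]] /=; first by rewrite lexx; case/andP: h.
have h0 : 0 <= iter k sign_step t by case/andP: h => t0 _; exact: le_trans h1.
have /andP[h3 h4] := sign_step_itv (introT andP (conj h0 h2)).
by rewrite h4 andbT (le_trans h1).
Qed.

Lemma iter_sign_step_le1 k t : `|t| <= 1 -> `|iter k sign_step t| <= 1.
Proof.
have main u : 0 <= u <= 1 -> `|iter k sign_step u| <= 1.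
  move=> u01; have /andP[h1 h2] := iter_sign_step_itv k u01.
  by rewrite ger0_norm// (le_trans _ h1)//; case/andP: u01.
have [t0|t0] := leP 0 t.
  by rewrite ger0_norm// => t1; apply: main; rewrite t0.
rewrite ltr0_norm// => t1; rewrite -[t]opprK iter_sign_stepN normrN; apply: main.
by rewrite t1 oppr_ge0 ltW.
Qed.

(** Since [1 - sign_step u = (1 - (u + u ^ 2) / 2) (1 - u)] and the iterates [u] stay above [t],
    each step shrinks the distance to 1 by a factor of at most [1 - t / 2]. *)
Lemma iter_sign_step_rate k t : 0 <= t <= 1 ->
  1 - iter k sign_step t <= (1 - t / 2) ^+ k.
Proof.
move=> t01; have /andP[t0 t1] := t01; elim: k => [|k IH] /=; first by rewrite expr0 gerBl.
have /andP[] := iter_sign_step_itv k t01; set u := iter k _ t => h1 h2.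
have u0 : 0 <= u := le_trans t0 h1.
rewrite /sign_step [leRHS]exprS.
rewrite (_ : 1 - _ = (1 - (u + u ^+ 2) / 2) * (1 - u)); last by field.
apply: ler_pM => //; rewrite ?subr_ge0//.
  by rewrite ler_pdivrMr// mul1r; nra.
by rewrite lerD2l lerN2; nra.
Qed.

Lemma cvg_iter_sign_step t : `|t| <= 1 ->
  (fun k => iter k sign_step t) @ \oo --> Num.sg t.
Proof.
have main u : 0 < u <= 1 -> (fun k => iter k sign_step u) @ \oo --> (1 : R).
  move=> /andP[u0 u1].
  have u01 : 0 <= u <= 1 by rewrite u1 ltW.
  have c1 : (fun k => 1 - (1 - u / 2) ^+ k) @ \oo --> (1 : R).
    rewrite -[X in _ --> X]subr0; apply: cvgB; first exact: cvg_cst.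
    by apply: cvg_expr; rewrite ger0_norm; lra.
  apply: (@squeeze_cvgr _ _ _ _ (fun k => 1 - (1 - u / 2) ^+ k) (fun=> 1)) => //; last exact: cvg_cst.
  apply: nearW => k.
  rewrite lerBlDr -lerBlDl iter_sign_step_rate//=.
  by have /andP[] := iter_sign_step_itv k u01.
have [t0|t0|<-] := ltgtP 0 t.
- by move=> t1; rewrite gtr0_sg//; apply: main; rewrite t0 (le_trans _ t1)// ler_norm.
- move=> t1; rewrite ltr0_sg// -[t]opprK; under eq_fun do rewrite iter_sign_stepN.
  apply: cvgN; apply: main; rewrite oppr_gt0 t0 (le_trans _ t1)//.
  by rewrite ltr0_norm.
- move=> _; rewrite sgr0 (_ : (fun k => _) = fun=> 0); first exact: cvg_cst.
  by apply/funext => k; elim: k => //= k ->; rewrite /sign_step; field.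
Qed.

End sign_iteration.

Section box_multipliers.
Context (R : realType) (n : nat).
Local Notation E := 'rV[R]_n.
Local Notation C := R[i].
Local Notation mu := (lebesgue_rV R n).

Lemma dotvBr (x xi eta : E) : dotv x (xi - eta) = dotv x xi - dotv x eta.
Proof. by rewrite /dotv -sumrB; apply: eq_bigr => i _; rewrite !mxE mulrBr. Qed.

Lemma dotvDr (x xi eta : E) : dotv x (xi + eta) = dotv x xi + dotv x eta.
Proof. by rewrite /dotv -big_split; apply: eq_bigr => i _; rewrite !mxE mulrDr. Qed.

(** Multiplication by a trigonometric function shifts frequencies: the transform of [h F] at [xi] is
    a combination of the transforms of [h] at [xi - eta] and [xi + eta]. *)
Lemma null_multiplier_trig (eta : E) (F : E -> R) (c d : C) :
  measurable_fun setT F -> (forall x, `|F x| <= 1) ->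
  (forall xi x, (F x)%:C%C * character xi x =
     c * character (xi - eta) x + d * character (xi + eta) x) ->
  null_multiplier F.
Proof.
move=> mF F1 Fe; split => //; first by exists 1.
move=> h [hi h0]; split; first exact: (@cintegrable_mulr_real _ _ _ _ 1).
move=> xi; transitivity (c * fourier h (xi - eta) + d * fourier h (xi + eta)).
  have ci e := cintegrable_character e hi.
  rewrite /fourier -!cintegralZl//; try exact: ci.
  rewrite -cintegralD; try (apply: cintegrableZl; exact: ci).
  apply: eq_cintegral => x; rewrite -mulrA [X in h x * X]Fe.
  by rewrite mulrDr !(mulrCA (h x)).
by rewrite !h0 !mulr0 addr0.
Qed.

Lemma null_multiplier_cos (eta : E) :
  null_multiplier (fun x : E => cos (2 * pi * dotv x eta)).
Proof.
apply: (@null_multiplier_trig eta _ ((1 / 2)%:C%C) ((1 / 2)%:C%C)).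
- apply: (measurableT_comp (f := @cos R)).
    by apply: continuous_measurable_fun; exact: continuous_cos.
  by apply: measurable_funM => //; exact: measurable_dotv.
- by move=> x; rewrite cos_max.
- move=> xi x; rewrite /character dotvBr dotvDr.
  rewrite (_ : 2 * pi * (_ - _) = 2 * pi * dotv x xi - 2 * pi * dotv x eta); last by ring.
  rewrite (_ : 2 * pi * (_ + _) = 2 * pi * dotv x xi + 2 * pi * dotv x eta); last by ring.
  rewrite cosB cosD sinB sinD.
  by apply: complex_ext => /=; field.
Qed.

Lemma null_multiplier_sin (eta : E) :
  null_multiplier (fun x : E => sin (2 * pi * dotv x eta)).
Proof.
(* The coefficients are [1 / (2 i)] and [- 1 / (2 i)] from Euler's formula for the sine. *)
apply: (@null_multiplier_trig eta _ (0 +i* (- (1 / 2)))%C (0 +i* (1 / 2))%C).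
- apply: (measurableT_comp (f := @sin R)).
    by apply: continuous_measurable_fun; exact: continuous_sin.
  by apply: measurable_funM => //; exact: measurable_dotv.
- by move=> x; rewrite sin_max.
- move=> xi x; rewrite /character dotvBr dotvDr.
  rewrite (_ : 2 * pi * (_ - _) = 2 * pi * dotv x xi - 2 * pi * dotv x eta); last by ring.
  rewrite (_ : 2 * pi * (_ + _) = 2 * pi * dotv x xi + 2 * pi * dotv x eta); last by ring.
  rewrite cosB cosD sinB sinD.
  by apply: complex_ext => /=; field.
Qed.

Lemma null_multiplierZ (c : R) (F : E -> R) :
  null_multiplier F -> null_multiplier (fun x => c * F x).
Proof. by move=> hF; apply: (@null_multiplierM _ _ (fun=> c) F) => //; exact: null_multiplier_cst. Qed.

Lemma null_multiplier_sin_coord (i : 'I_n) (a K : R) :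
  null_multiplier (fun x : E => sin ((x ord0 i - a) / K)).
Proof.
pose eta : E := (2 * pi * K)^-1 *: delta_mx ord0 i.
have e x : 2 * pi * dotv x eta = x ord0 i / K.
  rewrite /dotv (bigD1 i)//= big1 ?addr0.
    have pi0 : 2 * pi != 0 :> R by rewrite mulf_neq0// gt_eqF// pi_gt0.
    by rewrite !mxE !eqxx mulr1 (invfM (2 * pi) K) mulrCA [_ * (_ / _)]mulrA divff// mul1r.
  by move=> j ji; rewrite !mxE (negbTE ji) andbF !mulr0.
have -> : (fun x : E => sin ((x ord0 i - a) / K)) = fun x =>
   cos (a / K) * sin (2 * pi * dotv x eta) +
   (- sin (a / K)) * cos (2 * pi * dotv x eta).
  by apply/funext => x; rewrite e mulrBl sinB; ring.
apply: null_multiplierD; apply: null_multiplierZ.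
  exact: null_multiplier_sin.
exact: null_multiplier_cos.
Qed.

Lemma null_multiplier_sign_step (F : E -> R) :
  null_multiplier F -> null_multiplier (fun x => sign_step (F x)).
Proof.
move=> hF; rewrite /sign_step.
rewrite (_ : (fun x => _) = fun x => 3 / 2 * F x + (- (1 / 2)) * (F x * (F x * F x))).
  apply: null_multiplierD; apply: null_multiplierZ => //.
  by do 2 apply: null_multiplierM => //.
by apply/funext => x; field.
Qed.

(** A double limit. For fixed [k], iterating [sign_step] on the sine of [(x_i - a) / (k + 1)] gives
    the sign of that sine; once [k + 1] exceeds [|x_i - a|] the argument lies in [(- pi, pi)], where
    the sine has the sign of its argument. *)
Lemma null_multiplier_sg_coord (i : 'I_n) (a : R) :
  null_multiplier (fun x : E => Num.sg (x ord0 i - a)).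
Proof.
apply: (@null_multiplier_lim _ _
  (fun k x => Num.sg (sin ((x ord0 i - a) / k.+1%:R))) _ 1).
- move=> k; pose F (x : E) := sin ((x ord0 i - a) / k.+1%:R).
  apply: (@null_multiplier_lim _ _ (fun l x => iter l (@sign_step R) (F x)) _ 1).
  + elim=> [|l IH] /=; first exact: null_multiplier_sin_coord.
    exact: null_multiplier_sign_step.
  + by move=> l x; apply: iter_sign_step_le1; rewrite sin_max.
  + by move=> x; apply: cvg_iter_sign_step; rewrite sin_max.
- by move=> k x; rewrite normr_sg; case: (_ != 0).
- move=> x; set y := x ord0 i - a.
  apply: cvg_near_cst.
  have [N yN] : exists N : nat, `|y| < N%:R.
    by exists (Num.truncn `|y|).+1; rewrite truncnS_gt.
  have sg_pos (z : R) k : 0 < z -> `|z| < k.+1%:R -> Num.sg (sin (z / k.+1%:R)) = 1.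
    move=> z0; rewrite gtr0_norm// => zk; rewrite gtr0_sg// sin_gt0_pi//.
    rewrite divr_gt0//= ltr_pdivrMr// (lt_le_trans zk)// ler_peMl//.
    by rewrite (le_trans _ (pi_ge2 _))// ler1n.
  exists N => // k /= Nk.
  have yk : `|y| < k.+1%:R by rewrite (lt_le_trans yN)// ler_nat (leq_trans Nk).
  have [y0|y0|<-] := ltgtP 0 y.
  + by rewrite (gtr0_sg y0) sg_pos.
  + rewrite (ltr0_sg y0) -[y]opprK mulNr sinN sgrN sg_pos ?normrN// oppr_gt0//.
  + by rewrite mul0r sin0.
Qed.

End box_multipliers.

Section fourier_injective.
Context (R : realType) (n : nat).
Local Notation E := 'rV[R]_n.
Local Notation C := R[i].
Local Notation mu := (lebesgue_rV R n).

(** Sequential form of continuity: convolutions acquire it directly from dominated convergence, and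
    the uniqueness argument only tests it along sequences. *)
Definition seq_continuous (f : E -> C) := forall (u : nat -> E) (x : E),
  u @ \oo --> x ->
  (fun k => complex.Re (f (u k))) @ \oo --> complex.Re (f x) /\
  (fun k => complex.Im (f (u k))) @ \oo --> complex.Im (f x).

Lemma ccontinuous_seq f : ccontinuous f -> seq_continuous f.
Proof.
move=> [fR fI] u x ux; split.
  exact: (@continuous_cvg _ _ _ _ _ u (fun x => complex.Re (f x)) x (fR x) ux).
exact: (@continuous_cvg _ _ _ _ _ u (fun x => complex.Im (f x)) x (fI x) ux).
Qed.

Lemma seq_continuousD f g : seq_continuous f -> seq_continuous g ->
  seq_continuous (fun x => f x + g x).
Proof.
move=> fc gc u x ux; have [f1 f2] := fc u x ux; have [g1 g2] := gc u x ux; split.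
  by rewrite ReD; under eq_fun do rewrite ReD; exact: cvgD.
by rewrite ImD; under eq_fun do rewrite ImD; exact: cvgD.
Qed.

Lemma seq_continuousN f : seq_continuous f -> seq_continuous (fun x => - f x).
Proof.
move=> fc u x ux; have [f1 f2] := fc u x ux; split.
  by rewrite ReN; under eq_fun do rewrite ReN; exact: cvgN.
by rewrite ImN; under eq_fun do rewrite ImN; exact: cvgN.
Qed.

Lemma seq_continuous_sum I (r : seq I) (F : I -> E -> C) :
  (forall i, seq_continuous (F i)) -> seq_continuous (fun x => \sum_(i <- r) F i x).
Proof.
move=> hF; elim: r => [|i r IH].
  rewrite (_ : (fun x => _) = fun=> 0); last by apply/funext => x; rewrite big_nil.
  by move=> u x _; split; exact: cvg_cst.
rewrite (_ : (fun x => _) = fun x => F i x + \sum_(j <- r) F j x).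
  exact: seq_continuousD.
by apply/funext => x; rewrite big_cons.
Qed.

(* The indicator of the box of centre a and half-side d, up to its faces. *)
Definition box_function (a : E) (d : R) (x : E) : R :=
  \prod_(i < n) (2^-1 * (Num.sg (x ord0 i - (a ord0 i - d)) +
                         -1 * Num.sg (x ord0 i - (a ord0 i + d)))).

Lemma null_multiplier_box a d : null_multiplier (box_function a d).
Proof.
apply: null_multiplier_prod => i; apply: null_multiplierZ.
apply: null_multiplierD; last apply: null_multiplierZ;
  exact: null_multiplier_sg_coord.
Qed.

Lemma box_function_ge0 a d x : 0 < d -> 0 <= box_function a d x.
Proof.
move=> d0; apply: prodr_ge0 => i _; apply: mulr_ge0 => //; rewrite mulN1r subr_ge0.
have [h|h|h] := sgrP (x ord0 i - (a ord0 i + d)).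
- by rewrite gtr0_sg//; lra.
- by rewrite gtr0_sg//; lra.
- by have [//|_|_] := sgrP (x ord0 i - (a ord0 i - d)); lra.
Qed.

Lemma box_function_out (a : E) d (x : E) i : 0 < d -> d < `|x ord0 i - a ord0 i| -> box_function a d x = 0.
Proof.
move=> d0 h; rewrite /box_function (bigD1 i)//= (_ : 2^-1 * _ = 0) ?mul0r//.
have [h0|h0] := leP 0 (x ord0 i - a ord0 i).
  by move: h; rewrite ger0_norm// => h; rewrite !gtr0_sg; lra.
by move: h; rewrite ltr0_norm// => h; rewrite !ltr0_sg; lra.
Qed.

Lemma box_function_in (a : E) d (x : E) : (forall i, `|x ord0 i - a ord0 i| < d) ->
  box_function a d x = 1.
Proof.
move=> h; rewrite /box_function big1// => i _.
move: (h i); rewrite ltr_norml => /andP[h1 h2].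
by rewrite gtr0_sg ?ltr0_sg; lra.
Qed.

(** Were [g] positive on some box around [a], its vanishing integral there would make that box, of
    measure [(2 e) ^ n > 0], a null set. So every box around [a] has a point where [g <= 0], and
    continuity along such points passes this to [a]. *)
Lemma box_integral_zero (g : E -> R) (a : E) :
  mu.-integrable setT (EFin \o g) ->
  (forall u : nat -> E, u @ \oo --> a -> g \o u @ \oo --> g a) ->
  (forall d, 0 < d -> \int[mu]_x (g x * box_function a d x) = 0) -> g a <= 0.
Proof.
move=> gi gc g0; rewrite leNgt; apply/negP => ga.
have /choice[u hu] : forall k : nat, exists x : E,
    (forall i, `|x ord0 i - a ord0 i| <= k.+1%:R^-1) /\ g x <= 0.
  move=> k; apply: contrapT => hno.
  have d0 : 0 < k.+1%:R^-1 :> R by rewrite invr_gt0.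
  move: (k.+1%:R^-1) d0 hno => e d0 hno.
  pose F := box_function a e.
  have [mF [K FK] _] := null_multiplier_box a e.
  have gpos x : F x != 0 -> 0 < g x.
    move=> Fx; rewrite ltNge; apply/negP => gx; apply: hno; exists x; split => // i.
    by rewrite leNgt; apply/negP => /(box_function_out d0); exact/eqP.
  have gF0 x : 0 <= g x * F x.
    have [->|/gpos/ltW gx] := eqVneq (F x) 0; first by rewrite mulr0.
    by rewrite mulr_ge0// box_function_ge0.
  have mg : measurable_fun setT g.
    by move/measurable_int : gi => /measurable_EFinP.
  have mgF : measurable_fun setT (fun x => g x * F x) by exact: measurable_funM.
  have gFi : mu.-integrable setT (EFin \o (fun x => g x * F x)).
    apply: (@integrable_leR _ _ _ (fun x => K * `|g x|)) => //.
      by move=> x; rewrite normrM mulrC ler_wpM2r.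
    exact: (integrableZl measurableT K (integrable_norm gi)).
  have /(ae_eq_integral_abs mu measurableT) : (\int[mu]_x `|(g x * F x)%:E| = 0)%E.
    transitivity (\int[mu]_x (g x * F x)%:E)%E.
      by apply: eq_integral => x _; rewrite /= ger0_norm.
    have := congr1 EFin (g0 _ d0); rewrite /Rintegral fineK//.
    exact: (integrable_fin_num measurableT gFi).
  move=> /(_ _)[]; first exact/measurable_EFinP.
  move=> N [mN N0 hN].
  have := @lebesgue_box _ n (fun i => `]a ord0 i - e, a ord0 i + e[%classic).
  move=> /(_ (fun i => measurable_itv _)).
  set B := box _ => muB.
  have : (mu B <= mu N)%E.
    apply: le_measure; rewrite ?inE//.
      by apply: measurable_box => i; exact: measurable_itv.
    move=> x Bx; apply: hN => /= /(_ I) []; apply/eqP.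
    have Fx : F x = 1.
      apply: box_function_in => i; move: (Bx i) => /=.
      by rewrite in_itv/= ltr_norml => /andP[h1 h2]; apply/andP; split; lra.
    by rewrite Fx mulr1 gt_eqF// gpos// Fx oner_eq0.
  rewrite N0 muB; apply/negP; rewrite -ltNge.
  rewrite (eq_bigr (fun=> (2 * e)%:E)); last first.
    move=> i _; rewrite lebesgue_measure_itv/= lte_fin.
    by rewrite ifT; [rewrite -EFinB; congr EFin; lra|lra].
  by rewrite prodEFin lte_fin prodr_gt0// => i _; rewrite mulr_gt0.
have ua : u @ \oo --> a.
  apply/cvgrPdist_le => e e0.
  have [N _ hN] := near_infty_natSinv_lt (PosNum e0).
  exists N => // k /= Nk.
  rewrite [leLHS]/Num.norm /= mx_normrE; apply/bigmax_leP; split; first exact: ltW.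
  move=> [i j] _ /=; rewrite !mxE (ord1 i) distrC.
  by rewrite (le_trans ((hu k).1 j))// ltW//; exact: hN.
suff : g a <= 0 by rewrite leNgt ga.
by apply: (ler_cvg_to (gc u ua) (cvg_cst 0)); apply: nearW => k; exact: (hu k).2.
Qed.

(** Box functions are null multipliers, so [h] times a box function has zero transform, whose value
    at frequency 0 is the integral of [h] over the box. Continuity turns vanishing integrals over
    all boxes centred at [a] into [h a = 0]. *)
Lemma fourier_inj0 (h : E -> C) : cintegrable h -> seq_continuous h ->
  (forall xi, fourier h xi = 0) -> forall x, h x = 0.
Proof.
move=> hi hc h0 a.
have hint d : cintegral (fun x => h x * (box_function a d x)%:C%C) = 0.
  have [_ _ /(_ _ (conj hi h0)) [Fi /(_ 0) F0]] := null_multiplier_box a d.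
  rewrite -F0; apply: eq_cintegral => x.
  have -> : dotv x 0 = 0 by rewrite /dotv big1// => i _; rewrite mxE mulr0.
  by rewrite mulr0 cos0 sin0 oppr0 [(1 +i* 0)%C](_ : _ = 1) ?mulr1.
have Re0 d : \int[mu]_x (complex.Re (h x) * box_function a d x) = 0.
  have := congr1 (@complex.Re R) (hint d); rewrite cintegral_ReE /= => <-.
  by apply: eq_Rintegral => x _; rewrite ReMr.
have Im0 d : \int[mu]_x (complex.Im (h x) * box_function a d x) = 0.
  have := congr1 (@complex.Im R) (hint d); rewrite cintegral_ImE /= => <-.
  by apply: eq_Rintegral => x _; rewrite ImMr.
have [ri ii] := hi.
have neg (g : E -> R) : mu.-integrable setT (EFin \o g) ->
  (forall u : nat -> E, u @ \oo --> a -> g \o u @ \oo --> g a) ->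
  (forall d, \int[mu]_x (g x * box_function a d x) = 0) -> g a = 0.
  move=> gi gc g0; apply/eqP; rewrite eq_le; apply/andP; split.
    exact: box_integral_zero.
  rewrite -oppr_le0; apply: (@box_integral_zero (fun x => - g x)).
  - exact: (integrableN gi).
  - by move=> u ua; apply: cvgN; exact: gc.
  - move=> d _; have [mF [K FK] _] := null_multiplier_box a d.
    rewrite (_ : (fun x => _) = fun x => -1 * (g x * box_function a d x)); last first.
      by apply/funext => x; ring.
    rewrite RintegralZl ?g0 ?mulr0//.
    apply: (@integrable_leR _ _ _ (fun x => K * `|g x|)) => //.
    + apply: measurable_funM => //.
      by move/measurable_int : gi => /measurable_EFinP.
    + by move=> x; rewrite normrM mulrC ler_wpM2r.
    + exact: (integrableZl measurableT K (integrable_norm gi)).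
apply: complex_ext.
  by apply: (neg (fun x => complex.Re (h x))) => // u ua; have [] := hc u a ua.
by apply: (neg (fun x => complex.Im (h x))) => // u ua; have [] := hc u a ua.
Qed.

End fourier_injective.

(** * Decay, convolution and Littlewood-Paley blocks *)

Lemma measurable_fun_powR (R : realType) d (T : measurableType d) (f : T -> R) (p : R) :
  measurable_fun setT f -> measurable_fun setT (fun x => f x `^ p).
Proof.
move=> mf; exact: (@measurableT_comp _ _ _ _ _ _ (@powR R ^~ p) setT f
  (measurable_powR p) mf).
Qed.

Section decay.
Context (R : realType) (n : nat).
Local Notation E := 'rV[R]_n.
Local Notation C := R[i].
Local Notation mu := (lebesgue_rV R n).

Lemma ler_coord_norm (x : E) i : `|x ord0 i| <= `|x|.
Proof.
rewrite [leRHS]/Num.norm /= mx_normrE; apply/bigmax_geP; right => /=.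
by exists (ord0, i).
Qed.

Lemma ler_norm_rV (x : E) (c : R) : 0 <= c -> (forall i, `|x ord0 i| <= c) -> `|x| <= c.
Proof.
move=> c0 h; rewrite [leLHS]/Num.norm /= mx_normrE; apply/bigmax_leP; split => //.
by move=> [i j] _ /=; rewrite (ord1 i).
Qed.

Lemma ler_norm_enorm (x : E) : `|x| <= enorm x.
Proof.
apply: ler_norm_rV => [|i]; first exact: sqrtr_ge0.
rewrite -sqrtr_sqr; apply: ler_wsqrtr; rewrite /dotv (bigD1 i)//= -expr2 lerDl.
by apply: sumr_ge0 => j _; rewrite -expr2 sqr_ge0.
Qed.

Lemma enormZ (c : R) (x : E) : 0 <= c -> enorm (c *: x) = c * enorm x.
Proof.
move=> c0; rewrite /enorm /dotv.
rewrite (_ : \sum_i _ = c ^+ 2 * \sum_(i < n) x ord0 i * x ord0 i); last first.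
  by rewrite mulr_sumr; apply: eq_bigr => i _; rewrite !mxE; ring.
by rewrite sqrtrM ?sqr_ge0// sqrtr_sqr ger0_norm.
Qed.

Lemma measurable_norm_rV : measurable_fun setT (fun x : E => `|x|).
Proof. by apply: continuous_measurable_rV; exact: norm_continuous. Qed.

Lemma measurable_cube (a : E) (l : R) : measurable (cube a l).
Proof.
rewrite (_ : cube a l = box (fun i => `[a ord0 i, a ord0 i + l]%classic)).
  by apply: measurable_box => i; exact: measurable_itv.
by apply/seteqP; split => x h i; have := h i; rewrite /= in_itv.
Qed.

Lemma lebesgue_cube (a : E) (l : R) : 0 <= l -> mu (cube a l) = (l ^+ n)%:E.
Proof.
move=> l0; rewrite (_ : cube a l = box (fun i => `[a ord0 i, a ord0 i + l]%classic)).
  rewrite lebesgue_box; last by move=> i; exact: measurable_itv.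
  rewrite (eq_bigr (fun=> l%:E)); first by rewrite prodEFin prodr_const card_ord.
  move=> i _; rewrite lebesgue_measure_itv/= lte_fin ltrDl.
  case: ltP => [_|l0']; first by rewrite -EFinB; congr EFin; ring.
  by congr EFin; apply/eqP; rewrite eq_le l0 l0'.
by apply/seteqP; split => x h i; have := h i; rewrite /= in_itv.
Qed.

(** The sum of the first [N] terms is at most [2 - 2 / (N + 1)]; the induction step is
    [1 / t ^ 2 <= 2 / t - 2 / (t + 1)], true for [t >= 1]. *)
Lemma nneseries_inv_sqr_lty : (\sum_(0 <= m <oo) ((m.+1%:R ^- 2 : R)%:E) < +oo)%E.
Proof.
apply: (@le_lt_trans _ _ 2%:E); last exact: ltry.
apply: lime_le; first by apply: is_cvg_nneseries => m _ _; rewrite lee_fin invr_ge0 exprn_ge0.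
apply: nearW => N; rewrite sumEFin lee_fin.
apply: (@le_trans _ _ (2 - 2 / N.+1%:R)).
  elim: N => [|N IH]; first by rewrite big_geq// divr1 subrr.
  rewrite big_nat_recr//= (le_trans (lerD IH (lexx _)))//.
  have h1 : 0 < N.+1%:R :> R by [].
  rewrite (_ : N.+2%:R = N.+1%:R + 1 :> R); last by rewrite -natr1.
  have : 1 <= N.+1%:R :> R by rewrite ler1n.
  move: (N.+1%:R : R) h1 => t t0 t1.
  rewrite -lerBrDl -subr_ge0.
  rewrite (_ : _ - _ = (t - 1) / (t ^+ 2 * (t + 1))); last first.
    by field; rewrite !gt_eqF//; lra.
  by rewrite divr_ge0 ?subr_ge0// mulr_ge0 ?sqr_ge0//; lra.
by rewrite gerBl divr_ge0.
Qed.

(** The integrand is dominated by the sum over [m] of [(m + 1) ^ (- (n + 2))] times the indicator of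
    the cube of side [2 (m + 1)]; the power [n + 2] leaves a multiple of the series of inverse
    squares after integration. *)
Lemma integrable_norm_decay :
  mu.-integrable setT (fun x : E => ((1 + `|x|) ^- n.+2)%:E).
Proof.
have mf : measurable_fun setT (fun x : E => (1 + `|x|) ^- n.+2).
  under eq_fun do rewrite -powR_invn ?addr_ge0//.
  apply: measurable_fun_powR.
  by apply: measurable_funD => //; exact: measurable_norm_rV.
apply/integrableP; split; first exact/measurable_EFinP.
pose B (m : nat) : set E := cube (const_mx (- m.+1%:R)) (2 * m.+1%:R).
have BP m x : `|x| <= m.+1%:R -> B m x.
  move=> h i; rewrite mxE; have := le_trans (ler_coord_norm x i) h.
  by rewrite ler_norml => /andP[h1 h2]; apply/andP; split; lra.
pose u (m : nat) (x : E) : \bar R := ((m.+1%:R ^- n.+2)%:E * (\1_(B m) x)%:E)%E.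
have u0 m x : (0 <= u m x)%E.
  by rewrite /u -EFinM lee_fin mulr_ge0// invr_ge0 exprn_ge0.
have mu_ m : measurable_fun setT (u m).
  apply: measurable_funeM; apply/measurable_EFinP/measurable_indicP.
  exact: measurable_cube.
apply: (@le_lt_trans _ _ (\int[mu]_x \sum_(m <oo) u m x)%E).
  apply: ge0_le_integral => //.
  - by apply/measurable_EFinP; exact: measurableT_comp.
  - apply: ge0_emeasurable_sum => // k x _ _; exact: u0.
  move=> x _; rewrite /= ger0_norm ?invr_ge0 ?exprn_ge0 ?addr_ge0//.
  set k := Num.truncn `|x|.
  have kx : k%:R <= `|x| by rewrite truncn_le.
  have xk : `|x| <= k.+1%:R by rewrite ltW// truncnS_gt.
  apply: (@le_trans _ _ (u k x)).
    rewrite /u indicE mem_set ?mule1; last exact: BP.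
    rewrite lee_fin lef_pV2 ?posrE ?exprn_gt0 ?ltr_pwDl//.
    by rewrite lerXn2r ?nnegrE ?addr_ge0// -natr1 addrC lerD2l.
  apply: (@le_trans _ _ (\sum_(0 <= m < k.+1) u m x)%E).
    by rewrite big_nat_recr//= leeDr// sume_ge0.
  exact: nneseries_lim_ge.
rewrite integral_nneseries//.
apply: (@le_lt_trans _ _ (\sum_(0 <= m <oo) ((2 ^+ n)%:E * (m.+1%:R ^- 2 : R)%:E))%E).
  apply: lee_nneseries => [m _ _|m _]; first exact: integral_ge0.
  have mBm : measurable_fun setT (fun x : E => (\1_(B m) x : R)%:E).
    by apply/measurable_EFinP/measurable_indicP; exact: measurable_cube.
  rewrite /u ge0_integralZl//.
  have -> : (\int[mu]_x (\1_(B m) x)%:E = ((2 * m.+1%:R) ^+ n)%:E)%E.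
    rewrite integral_indic//; last exact: measurable_cube.
    by rewrite setIT; apply: lebesgue_cube; rewrite mulr_ge0.
  rewrite -!EFinM lee_fin exprMn mulrCA ler_wpM2l ?exprn_ge0//.
  by rewrite -addn2 exprD invfM mulrAC mulVf ?mul1r// expf_neq0.
rewrite nneseriesZl; last by move=> m _; rewrite lee_fin invr_ge0 exprn_ge0.
by rewrite lte_mul_pinfty// ?nneseries_inv_sqr_lty// lee_fin exprn_ge0.
Qed.

(** Formulated with the maximum norm, which is the norm of the envelopes and of the cubes. *)
Definition decays (r : R) (h : E -> C) :=
  exists K : R, forall x, (1 + `|x|) `^ r * cmod (h x) <= K.

Lemma decaysS r r' h : r' <= r -> decays r h -> decays r' h.
Proof.
move=> rr [K hK]; exists K => x; apply: le_trans (hK x).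
by rewrite ler_wpM2r ?cmod_ge0// ler_powR// lerDl.
Qed.

Lemma decays_integrable r h : cmeasurable h -> decays (r + n.+2%:R) h ->
  mu.-integrable setT (fun x => ((1 + `|x|) `^ r * cmod (h x))%:E).
Proof.
move=> mh [K hK].
apply: (@integrable_leR _ _ _ (fun x => K * (1 + `|x|) ^- n.+2)).
- apply: measurable_funM; last exact: cmeasurable_cmod.
  apply: measurable_fun_powR.
  by apply: measurable_funD => //; exact: measurable_norm_rV.
- move=> x; rewrite ger0_norm ?mulr_ge0 ?powR_ge0 ?cmod_ge0//.
  have x0 : 0 < 1 + `|x| by rewrite ltr_pwDl.
  rewrite ler_pdivlMr ?exprn_gt0// -powR_mulrn ?(ltW x0)//.
  by rewrite mulrAC -powRD ?(gt_eqF x0) ?implybT// hK.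
- exact: (integrableZl measurableT K integrable_norm_decay).
Qed.

Lemma decays_cintegrable h : cmeasurable h -> decays n.+2%:R h -> cintegrable h.
Proof.
move=> mh hd; apply: (@cintegrable_le _ _ _ (fun x => (1 + `|x|) `^ 0 * cmod (h x))) => //.
  by move=> x; rewrite powRr0 mul1r.
by apply: decays_integrable => //; rewrite add0r.
Qed.

Lemma decays_bounded r h : 0 <= r -> decays r h -> exists K, forall x, cmod (h x) <= K.
Proof.
move=> r0 /(decaysS r0)[K hK]; exists K => x.
by have := hK x; rewrite powRr0 mul1r.
Qed.

Lemma in_M_decays tau (h : E -> C) : 0 <= 2 * n%:R + tau -> in_M tau h ->
  decays (2 * n%:R + tau) h.
Proof.
move=> t0 [K hK]; exists K => x; apply: le_trans (hK x).
rewrite ler_wpM2r ?cmod_ge0// ge0_ler_powR// ?nnegrE ?addr_ge0 ?sqrtr_ge0//.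
by rewrite lerD2l ler_norm_enorm.
Qed.

Lemma schwartz_continuous (h : E -> C) : schwartz h -> ccontinuous h.
Proof.
by move=> [hs _]; split => x; have [d1 d2] := hs [::] x; exact: differentiable_continuous.
Qed.

Lemma schwartz_decays r (h : E -> C) : schwartz h -> decays r h.
Proof.
move=> [_ hd]; have [K hK] := hd [::] (Num.truncn `|r|).+1.
exists K => x; apply: le_trans (hK x).
have -> : cpderiv [::] h x = h x by rewrite /cpderiv /=; case: (h x).
rewrite ler_wpM2r ?cmod_ge0//.
apply: (@le_trans _ _ ((1 + `|x|) `^ (Num.truncn `|r|).+1%:R)).
  by rewrite ler_powR ?lerDl// (le_trans (ler_norm _))// ltW// truncnS_gt.
rewrite powR_mulrn ?addr_ge0// lerXn2r ?nnegrE ?addr_ge0 ?sqrtr_ge0//.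
by rewrite lerD2l ler_norm_enorm.
Qed.

End decay.

Section convolution.
Context (R : realType) (n : nat).
Local Notation E := 'rV[R]_n.
Local Notation C := R[i].
Local Notation mu := (lebesgue_rV R n).
Implicit Types phi h : E -> C.

(** Slices are assumed integrable at every point, so that the real-valued inner integrals are
    genuine everywhere and not only almost everywhere. *)
Lemma Fubini_real (G : E * E -> R) : measurable_fun setT G ->
  (\int[mu]_x \int[mu]_y `|G (x, y)|%:E < +oo)%E ->
  (forall x, mu.-integrable setT (fun y => (G (x, y))%:E)) ->
  (forall y, mu.-integrable setT (fun x => (G (x, y))%:E)) ->
  mu.-integrable setT (fun x => (\int[mu]_y G (x, y))%:E) /\
  \int[mu]_x \int[mu]_y G (x, y) = \int[mu]_y \int[mu]_x G (x, y).
Proof.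
move=> mG Goo Gx Gy.
have Gi : (mu \x mu)%E.-integrable setT (EFin \o G).
  by apply/(@integrable12ltyP _ _ _ _ _ mu mu); first exact/measurable_EFinP.
have ex x : (\int[mu]_y G (x, y))%:E = (\int[mu]_y (G (x, y))%:E)%E.
  by rewrite fineK//; exact: integrable_fin_num.
have ey y : (\int[mu]_x G (x, y))%:E = (\int[mu]_x (G (x, y))%:E)%E.
  by rewrite fineK//; exact: integrable_fin_num.
split.
  have := integrable_fubini_F Gi; by apply: eq_integrable.
transitivity (fine (\int[mu]_x \int[mu]_y (G (x, y))%:E)%E).
  by congr fine; apply: eq_integral => x _; exact: ex.
rewrite (Fubini Gi); congr fine; apply: eq_integral => y _.
exact/esym/ey.
Qed.

Definition cmeasurable2 (H : E * E -> C) :=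
  measurable_fun setT (fun z => complex.Re (H z)) /\
  measurable_fun setT (fun z => complex.Im (H z)).

Lemma cmeasurable2M H H' : cmeasurable2 H -> cmeasurable2 H' ->
  cmeasurable2 (fun z => H z * H' z).
Proof.
move=> [f1 f2] [g1 g2]; split.
  under eq_fun do rewrite ReM.
  by apply: measurable_funB; exact: measurable_funM.
under eq_fun do rewrite ImM.
by apply: measurable_funD; exact: measurable_funM.
Qed.

Lemma cmeasurable2_comp h (g : E * E -> E) : cmeasurable h ->
  measurable_fun setT g -> cmeasurable2 (fun z => h (g z)).
Proof. by move=> [h1 h2] mg; split; [exact: (measurableT_comp h1 mg)|exact: (measurableT_comp h2 mg)]. Qed.

Lemma measurable_sub_rV : measurable_fun setT (fun z : E * E => z.1 - z.2).
Proof.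
apply: measurable_fun_rV => i; under eq_fun do rewrite !mxE.
apply: measurable_funB.
  exact: (measurableT_comp (measurable_coord i) measurable_fst).
exact: (measurableT_comp (measurable_coord i) measurable_snd).
Qed.

Lemma Fubini_complex (H : E * E -> C) : cmeasurable2 H ->
  (\int[mu]_x \int[mu]_y (cmod (H (x, y)))%:E < +oo)%E ->
  (forall x, cintegrable (fun y => H (x, y))) ->
  (forall y, cintegrable (fun x => H (x, y))) ->
  cintegrable (fun x => cintegral (fun y => H (x, y))) /\
  cintegral (fun x => cintegral (fun y => H (x, y))) =
  cintegral (fun y => cintegral (fun x => H (x, y))).
Proof.
move=> [mR mI] Hoo Hx Hy.
have mc : measurable_fun setT (fun z => (cmod (H z))%:E).
  by apply/measurable_EFinP; exact: measurable_cmod.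
have le (F : E * E -> R) : measurable_fun setT F -> (forall z, `|F z| <= cmod (H z)) ->
    (\int[mu]_x \int[mu]_y `|F (x, y)|%:E < +oo)%E.
  move=> mF FH; apply: le_lt_trans Hoo.
  have maF : measurable_fun setT (fun z => (`|F z|)%:E).
    by apply/measurable_EFinP; exact: measurableT_comp.
  apply: ge0_le_integral => //.
  - by move=> x _; apply: integral_ge0.
  - by apply: (measurable_fun_fubini_tonelli_F (fun z => (`|F z|)%:E)).
  - by apply: (measurable_fun_fubini_tonelli_F (fun z => (cmod (H z))%:E)) => // z; rewrite lee_fin cmod_ge0.
  - move=> x _; apply: ge0_le_integral => //.
    + exact: (measurableT_comp maF (pair1_measurable x)).
    + exact: (measurableT_comp mc (pair1_measurable x)).
    + by move=> y _; rewrite lee_fin.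
have [i1 e1] := Fubini_real mR (le _ mR (fun z => ler_Re_cmod _))
  (fun x => (Hx x).1) (fun y => (Hy y).1).
have [i2 e2] := Fubini_real mI (le _ mI (fun z => ler_Im_cmod _))
  (fun x => (Hx x).2) (fun y => (Hy y).2).
by split; [split|apply: complex_ext].
Qed.

Lemma cintegrable_cmod_lty h : cintegrable h -> (\int[mu]_x (cmod (h x))%:E < +oo)%E.
Proof.
move=> /cintegrable_cmod/integrableP[_]; apply: le_lt_trans.
by rewrite le_eqVlt; apply/orP; left; apply/eqP; apply: eq_integral => x _;
  rewrite gee0_abs// lee_fin cmod_ge0.
Qed.

Lemma sub_affine (x y : E) : x - y = (-1) *: y + x.
Proof. by rewrite scaleN1r addrC. Qed.

Lemma cintegrable_reflect phi x : cintegrable phi ->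
  cintegrable (fun y => phi (x - y)).
Proof.
move=> ip; under eq_fun do rewrite sub_affine.
by apply: cintegrable_affine => //; rewrite oppr_eq0 oner_eq0.
Qed.

Lemma cintegrable_translate phi y : cintegrable phi ->
  cintegrable (fun x => phi (x - y)).
Proof.
move=> ip; under eq_fun do rewrite -[X in X - _]scale1r.
by apply: cintegrable_affine => //; rewrite oner_eq0.
Qed.

Lemma cintegral_translate phi y : cintegrable phi ->
  cintegral (fun x => phi (x - y)) = cintegral phi.
Proof.
move=> ip; under eq_fun do rewrite -[X in X - _]scale1r.
rewrite cintegral_affine ?oner_eq0// normr1 expr1n invr1.
by rewrite [X in X * _](_ : _ = 1)// mul1r.
Qed.

Section fixed_pair.
Variables (phi h : E -> C) (K : R).
Hypotheses (phi_cont : ccontinuous phi) (phi_bound : forall x, cmod (phi x) <= K)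
  (phi_int : cintegrable phi) (h_int : cintegrable h).

Let mphi : cmeasurable phi. Proof. exact: ccontinuous_measurable. Qed.
Let mh : cmeasurable h. Proof. exact: cintegrable_measurable. Qed.

Lemma cmeasurable_reflect x : cmeasurable (fun y => phi (x - y)).
Proof. exact: (cintegrable_measurable (cintegrable_reflect x phi_int)). Qed.

Lemma convol_integrand x : cintegrable (fun y => phi (x - y) * h y).
Proof.
under eq_fun do rewrite mulrC.
by apply: (@cintegrableMb _ _ _ _ K) => //; exact: cmeasurable_reflect.
Qed.

Lemma convol_seq_continuous : seq_continuous (convol phi h).
Proof.
move=> u x ux; apply: (@cintegral_dominated _ _ (fun k y => phi (u k - y) * h y) _
  (fun y => K * cmod (h y))).
- by move=> k; apply: cmeasurableM => //; exact: cmeasurable_reflect.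
- move=> y; have [c1 c2] := @ccontinuous_seq _ _ _ phi_cont _ _ (cvgB ux (cvg_cst y)).
  rewrite ReM; under eq_fun do rewrite ReM.
  by apply: cvgB; apply: cvgM; [exact: c1|exact: cvg_cst|exact: c2|exact: cvg_cst].
- move=> y; have [c1 c2] := @ccontinuous_seq _ _ _ phi_cont _ _ (cvgB ux (cvg_cst y)).
  rewrite ImM; under eq_fun do rewrite ImM.
  by apply: cvgD; apply: cvgM; [exact: c1|exact: cvg_cst|exact: c2|exact: cvg_cst].
- exact: (integrableZl measurableT K (cintegrable_cmod h_int)).
- by move=> k y; rewrite cmodM ler_wpM2r ?cmod_ge0.
Qed.

(** One Fubini argument for this kernel serves twice: at [xi = 0] it yields integrability of the
    convolution, at general [xi] the product formula for its transform. *)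
Let H xi (z : E * E) : C := phi (z.1 - z.2) * character xi z.1 * h z.2.

Let mH xi : cmeasurable2 (H xi).
Proof.
apply: cmeasurable2M; last exact: cmeasurable2_comp.
apply: cmeasurable2M; last first.
  by apply: cmeasurable2_comp => //; exact: measurable_character.
by apply: cmeasurable2_comp => //; exact: measurable_sub_rV.
Qed.

Let Hoo xi : (\int[mu]_x \int[mu]_y (cmod (H xi (x, y)))%:E < +oo)%E.
Proof.
have mc : measurable_fun setT (fun z => (cmod (H xi z))%:E).
  by apply/measurable_EFinP; have [h1 h2] := mH xi; exact: measurable_cmod.
have := @fubini_tonelli _ _ _ _ _ mu mu (fun z => (cmod (H xi z))%:E) mc.
move=> -> //; last by move=> z; rewrite lee_fin cmod_ge0.
pose I := (\int[mu]_x (cmod (phi x))%:E)%E.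
have Ioo : (I < +oo)%E.
  exact: cintegrable_cmod_lty.
have I0 : (0 <= I)%E by apply: integral_ge0 => x _; rewrite lee_fin cmod_ge0.
have Ifin : I \is a fin_num by rewrite ge0_fin_numE.
have mcp : measurable_fun setT (fun x => (cmod (phi x))%:E).
  by apply/measurable_EFinP; exact: cmeasurable_cmod.
have inner y : (\int[mu]_x (cmod (H xi (x, y)))%:E = (cmod (h y))%:E * I)%E.
  under eq_integral do rewrite /H !cmodM cmod_character mulr1 mulrC EFinM /=.
  rewrite ge0_integralZl//; last 3 first.
  - apply/measurable_EFinP; apply: cmeasurable_cmod.
    exact: (cintegrable_measurable (cintegrable_translate y phi_int)).
  - by move=> x _; rewrite lee_fin cmod_ge0.
  - by rewrite lee_fin cmod_ge0.
  congr (_ * _)%E.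
  under eq_integral => x _ do rewrite -[X in X - _]scale1r.
  rewrite (@ge0_integral_affine _ _ 1 (- y) (fun x => (cmod (phi x))%:E)) ?oner_eq0//.
    by rewrite normr1 expr1n invr1 mul1e.
  by move=> x; rewrite lee_fin cmod_ge0.
under eq_integral do rewrite inner.
rewrite ge0_integralZr//; last 2 first.
- by apply/measurable_EFinP; exact: cmeasurable_cmod.
- by move=> x _; rewrite lee_fin cmod_ge0.
have hoo := cintegrable_cmod_lty h_int; rewrite lte_mul_pinfty//.
  by apply: integral_ge0 => x _; rewrite lee_fin cmod_ge0.
by rewrite ge0_fin_numE//; apply: integral_ge0 => x _; rewrite lee_fin cmod_ge0.
Qed.

Let Hx xi x : cintegrable (fun y => H xi (x, y)).
Proof.
rewrite (_ : (fun y => _) = fun y => character xi x * (phi (x - y) * h y)).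
  by apply: cintegrableZl; exact: convol_integrand.
by apply/funext => y; rewrite /H /= mulrAC mulrC mulrA.
Qed.

Let Hy xi y : cintegrable (fun x => H xi (x, y)).
Proof.
rewrite (_ : (fun x => _) = fun x => h y * (phi (x - y) * character xi x)).
  by apply: cintegrableZl; apply: cintegrable_character; exact: cintegrable_translate.
by apply/funext => x; rewrite /H /= mulrC.
Qed.

Lemma character0 x : character (0 : E) x = 1.
Proof.
rewrite /character (_ : dotv x 0 = 0) ?mulr0 ?cos0 ?sin0 ?oppr0//.
by rewrite /dotv big1// => i _; rewrite mxE mulr0.
Qed.

Lemma convol_cintegrable : cintegrable (convol phi h).
Proof.
have [] := Fubini_complex (mH 0) (Hoo 0) (Hx 0) (Hy 0).
move=> + _; rewrite (_ : (fun x => _) = convol phi h)//.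
apply/funext => x; apply: eq_cintegral => y.
by rewrite /H /= character0 mulr1.
Qed.

Lemma characterB xi (x y : E) : character xi x = character xi (x - y) * character xi y.
Proof.
rewrite /character (_ : dotv x xi = dotv (x - y) xi + dotv y xi); last first.
  by rewrite /dotv -big_split/=; apply: eq_bigr => i _; rewrite !mxE; ring.
rewrite mulrDr cosD sinD.
by apply: complex_ext => /=; ring.
Qed.

Lemma fourier_convol xi : fourier (convol phi h) xi = fourier phi xi * fourier h xi.
Proof.
have [_ e] := Fubini_complex (mH xi) (Hoo xi) (Hx xi) (Hy xi).
transitivity (cintegral (fun x => cintegral (fun y => H xi (x, y)))).
  apply: eq_cintegral => x; rewrite -cintegralZr; last exact: convol_integrand.
  by apply: eq_cintegral => y; rewrite /H /= mulrAC.
rewrite e /fourier -[in RHS]cintegralZl; last exact: cintegrable_character.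
apply: eq_cintegral => y.
transitivity (cintegral (fun x => h y * character xi y * (phi (x - y) * character xi (x - y)))).
  apply: eq_cintegral => x; rewrite /H /= [in LHS](characterB xi x y).
  by ring.
rewrite cintegralZl; last first.
  by apply: (@cintegrable_translate (fun x => phi x * character xi x)); exact: cintegrable_character.
rewrite (@cintegral_translate (fun x => phi x * character xi x)) 1?mulrC//.
exact: cintegrable_character.
Qed.

End fixed_pair.

End convolution.

(** * Littlewood-Paley blocks of functions with spectrum in an annulus *)

Section littlewood_paley_blocks.
Context (R : realType) (n : nat).
Local Notation E := 'rV[R]_n.
Local Notation C := R[i].
Local Notation mu := (lebesgue_rV R n).
Implicit Types phi h : E -> C.

Lemma exp2z_gt0 (j : int) : 0 < (2 : R) ^ j.
Proof. by rewrite exprz_gt0. Qed.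

Lemma exp2z_neq0 (j : int) : (2 : R) ^ j != 0.
Proof. by rewrite gt_eqF ?exp2z_gt0. Qed.

Lemma exp2zX (j : int) : (2 : R) ^ (j * n%:Z) = ((2 : R) ^ j) ^+ n.
Proof. by rewrite -exprz_exp. Qed.

Lemma mem_band (M : nat) (i : int) : (i \in band M) = (`|i| <= M%:Z).
Proof.
rewrite ler_norml; apply/mapP/idP => [[k]|/andP[h1 h2]].
  rewrite mem_iota add0n ltnS => /andP[_ kM] ->.
  by apply/andP; split; lia.
exists (absz (i + M%:Z)); last by lia.
by rewrite mem_iota add0n; apply/andP; split => //; lia.
Qed.

Lemma band_uniq (M : nat) : uniq (band M).
Proof. by rewrite map_inj_uniq ?iota_uniq// => x y /addIr []. Qed.

Lemma ln2_gt0 : 0 < ln (2 : R).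
Proof. by rewrite ln_gt0// ltr1n. Qed.

Lemma exp2z_le_log2 (i : int) (x : R) : (2 : R) ^ i <= x -> i%:~R <= log2 x.
Proof.
move=> h; rewrite /log2 ler_pdivlMr ?ln2_gt0//.
rewrite -ln_powR powR_intmul// ler_ln ?posrE ?exp2z_gt0//.
by rewrite (lt_le_trans _ h)// exp2z_gt0.
Qed.

(** Combining the two chains gives [2 ^ i <= b / c1] and [2 ^ (- i) <= c2 / a], which is where the
    two logarithms in [band_width] come from. *)
Lemma band_overlap (a b c1 c2 : R) (i : int) (t : R) : 0 < a -> 0 < c1 ->
  a <= t <= b -> c1 <= (2 : R) ^ (- i) * t <= c2 ->
  i \in band (band_width a b c1 c2).
Proof.
move=> a0 c10 /andP[at_ tb] /andP[ct tc].
have t0 : 0 < t by apply: lt_le_trans at_.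
rewrite mem_band /band_width.
set m := Num.max _ _.
have m0 : 0 <= m by rewrite /m le_max lexx orbT.
have cm : m <= (Num.ceil m)%:~R by exact: ceil_ge.
have c0 : 0 <= Num.ceil m by rewrite -(ler_int R) (le_trans m0).
rewrite gez0_abs// ler_norml; apply/andP; split.
  rewrite lerNl -(ler_int R) (le_trans _ cm)//.
  apply: (@le_trans _ _ (log2 (c2 / a))); last by rewrite /m !le_max lexx orbT.
  apply: exp2z_le_log2; rewrite ler_pdivlMr//.
  by rewrite (le_trans _ tc)// ler_pM2l ?exp2z_gt0.
rewrite -(ler_int R) (le_trans _ cm)//.
apply: (@le_trans _ _ (log2 (b / c1))); last by rewrite /m !le_max lexx.
apply: exp2z_le_log2; rewrite ler_pdivlMr// (le_trans _ tb)//.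
have := ler_pM2l (exp2z_gt0 i) c1 ((2 : R) ^ (- i) * t); rewrite ct mulrA -expfzDr//.
by rewrite subrr expr0z mul1r => ->.
Qed.

Lemma ccontinuous_dilate phi j : ccontinuous phi -> ccontinuous (dilate phi j).
Proof.
move=> [c1 c2]; have cs : continuous (fun x : E => (2 : R) ^ j *: x).
  by move=> x; exact: (@scaler_continuous _ _ ((2 : R) ^ j)).
split=> x.
  rewrite (_ : (fun y => _) = (fun y => (2 : R) ^ (j * n%:Z) * complex.Re (phi ((2 : R) ^ j *: y)))).
    apply: (@cvgMl_tmp _ _ (nbhs x)).
        exact: (@continuous_cvg _ _ _ _ _ (fun y : E => (2 : R) ^ j *: y) (fun y => complex.Re (phi y)) _ (c1 _) (cs x)).
  by apply/funext => y; rewrite /dilate [X in complex.Re X]mulrC ReMr; exact: mulrC.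
rewrite (_ : (fun y => _) = (fun y => (2 : R) ^ (j * n%:Z) * complex.Im (phi ((2 : R) ^ j *: y)))).
  apply: (@cvgMl_tmp _ _ (nbhs x)).
  exact: (@continuous_cvg _ _ _ _ _ (fun y : E => (2 : R) ^ j *: y) (fun y => complex.Im (phi y)) _ (c2 _) (cs x)).
by apply/funext => y; rewrite /dilate [X in complex.Im X]mulrC ImMr; exact: mulrC.
Qed.

Lemma cintegrable_dilate phi j : cintegrable phi -> cintegrable (dilate phi j).
Proof.
move=> ip; apply: cintegrableZl; under eq_fun do rewrite -[X in phi X]addr0.
by apply: cintegrable_affine => //; exact: exp2z_neq0.
Qed.

Lemma dilate_bound phi j K : (forall x, cmod (phi x) <= K) ->
  forall x, cmod (dilate phi j x) <= (2 : R) ^ (j * n%:Z) * K.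
Proof.
by move=> h x; rewrite cmodM cmod_real gtr0_norm ?exp2z_gt0// ler_pM2l ?exp2z_gt0.
Qed.

Lemma fourier_dilate phi j xi : cintegrable phi ->
  fourier (dilate phi j) xi = fourier phi ((2 : R) ^ (- j) *: xi).
Proof.
move=> ip; rewrite /fourier.
pose f z := phi z * character ((2 : R) ^ (- j) *: xi) z.
transitivity (cintegral (fun x => ((2 : R) ^ (j * n%:Z))%:C%C * f ((2 : R) ^ j *: x + 0))).
  apply: eq_cintegral => x; rewrite /dilate /f addr0 mulrA; congr (_ * _).
  rewrite /character (_ : dotv ((2 : R) ^ j *: x) _ = dotv x xi)//.
  rewrite /dotv; apply: eq_bigr => i _; rewrite !mxE mulrACA -expfzDr//.
  by rewrite subrr expr0z mul1r.
have fi : cintegrable f by exact: cintegrable_character.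
rewrite cintegralZl; last by apply: cintegrable_affine => //; exact: exp2z_neq0.
rewrite cintegral_affine ?exp2z_neq0// mulrA -rmorphM/= exp2zX.
by rewrite gtr0_norm ?exp2z_gt0// divff ?mul1r// expf_neq0// exp2z_neq0.
Qed.

Lemma fourier_sum I (r : seq I) (F : I -> E -> C) xi :
  (forall i, cintegrable (F i)) ->
  fourier (fun x => \sum_(i <- r) F i x) xi = \sum_(i <- r) fourier (F i) xi.
Proof.
move=> Fi; rewrite /fourier -cintegral_sum; last by move=> i _; exact: cintegrable_character.
by apply: eq_cintegral => x; rewrite mulr_suml.
Qed.

Lemma fourierB (f g : E -> C) xi : cintegrable f -> cintegrable g ->
  fourier (fun x => f x - g x) xi = fourier f xi - fourier g xi.
Proof.
move=> fi gi.
have -> : - fourier g xi = cintegral (fun x => -1 * (g x * character xi x)).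
  by rewrite cintegralZl ?mulN1r//; exact: cintegrable_character.
rewrite [X in _ = X + _]/fourier -cintegralD.
- by apply: eq_cintegral => x; rewrite mulrBl mulN1r.
- exact: cintegrable_character.
- by apply: cintegrableZl; exact: cintegrable_character.
Qed.

Section annulus.
Variables (a b c1 c2 : R) (phi h : E -> C).
Hypotheses (a_gt0 : 0 < a) (c1_gt0 : 0 < c1) (phi_LP : littlewood_paley c1 c2 phi).
Hypotheses (h_int : cintegrable h) (h_cont : seq_continuous h)
  (h_supp : supported_in_annulus a b (fourier h)).
Local Notation M := (band_width a b c1 c2).

Let phi_S : schwartz phi. Proof. by have [] := phi_LP. Qed.

Let phi_c : ccontinuous phi. Proof. exact: schwartz_continuous. Qed.

Let phi_i : cintegrable phi.
Proof.
apply: decays_cintegrable; first exact: ccontinuous_measurable.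
exact: schwartz_decays.
Qed.

Let phi_b : exists K, forall x, cmod (phi x) <= K.
Proof. by apply: (@decays_bounded _ _ 0) => //; exact: schwartz_decays. Qed.

Let block (i : int) := convol (dilate phi i) h.

Let block_i i : cintegrable (block i).
Proof.
have [K hK] := phi_b.
apply: (convol_cintegrable (ccontinuous_dilate i phi_c) (dilate_bound i hK)) => //.
exact: cintegrable_dilate.
Qed.

Let block_c i : seq_continuous (block i).
Proof.
have [K hK] := phi_b.
apply: (convol_seq_continuous (ccontinuous_dilate i phi_c) (dilate_bound i hK)) => //.
exact: cintegrable_dilate.
Qed.

Let fourier_block i xi :
  fourier (block i) xi = fourier phi ((2 : R) ^ (- i) *: xi) * fourier h xi.
Proof.
have [K hK] := phi_b; rewrite -fourier_dilate//.
apply: (fourier_convol (ccontinuous_dilate i phi_c) (dilate_bound i hK)) => //.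
exact: cintegrable_dilate.
Qed.

Lemma fourier_phi_band i xi : fourier h xi != 0 -> i \notin band M ->
  fourier phi ((2 : R) ^ (- i) *: xi) = 0.
Proof.
move=> h0 iM; have [_ _ _ supp _] := phi_LP; apply: supp.
apply: contra iM => hc; apply: (@band_overlap _ _ _ _ _ (enorm xi)) => //.
  by apply: contraT => /h_supp/eqP; rewrite (negbTE h0).
by rewrite -enormZ// ltW// exp2z_gt0.
Qed.

(** For such [i] the annuli of the two spectra are disjoint, so the block has zero transform; as it
    is continuous and integrable it vanishes at every point. *)
Lemma block_out i : i \notin band M -> forall x, convol (dilate phi i) h x = 0.
Proof.
move=> iM; apply: fourier_inj0 => [||xi]; [exact: block_i|exact: block_c|].
rewrite [LHS]fourier_block; have [->|h0] := eqVneq (fourier h xi) 0; first by rewrite mulr0.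
by rewrite fourier_phi_band ?mul0r.
Qed.

(** The transform of the difference is that of [h] times one minus the sum of the dilated transforms
    of [phi] over the band; where the transform of [h] is nonzero, that band already carries the
    whole partition of unity. *)
Lemma block_sum x : h x = \sum_(i <- band M) convol (dilate phi i) h x.
Proof.
apply/eqP; rewrite -subr_eq0; apply/eqP.
have si : cintegrable (fun x => \sum_(i <- band M) block i x).
  by apply: cintegrable_sum => i _; exact: block_i.
apply: (@fourier_inj0 _ _ (fun x => h x - \sum_(i <- band M) block i x)).
- rewrite (_ : (fun y => _) = fun y => h y + -1 * \sum_(i <- band M) block i y).
    by apply: cintegrableD => //; exact: cintegrableZl.
  by apply/funext => y; rewrite mulN1r.
- by apply: seq_continuousD => //; apply: seq_continuousN; apply: seq_continuous_sum.
move=> xi; rewrite fourierB// fourier_sum//.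
under eq_bigr do rewrite fourier_block.
have [->|h0] := eqVneq (fourier h xi) 0.
  by rewrite big1 ?subr0// => i _; rewrite mulr0.
rewrite -mulr_suml; have [_ _ _ _ /(_ xi)] := phi_LP.
(* The partition of unity is only available off the origin; there the transform of [h] vanishes
   because [0 < a]. *)
have xi0 : xi != 0.
  apply: contraNneq h0 => ->; apply/eqP/h_supp.
  rewrite negb_and -ltNge (_ : enorm 0 = 0) ?a_gt0//.
  by rewrite /enorm /dotv big1 ?sqrtr0// => i _; rewrite mxE mulr0.
move=> /(_ xi0); rewrite (fsbigTE [fset i | i in band M]%fset).
  rewrite (perm_big (band M)); first by move=> ->; rewrite mul1r subrr.
  apply: uniq_perm; rewrite ?fset_uniq ?band_uniq// => i.
  by rewrite !inE.
by move=> i; rewrite !inE => iM; exact: fourier_phi_band.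
Qed.

End annulus.

End littlewood_paley_blocks.

Section wavelet_scaling.
Context (R : realType) (n : nat).
Local Notation E := 'rV[R]_n.
Local Notation C := R[i].
Local Notation mu := (lebesgue_rV R n).
Implicit Types phi h : E -> C.

Definition lattice (k : 'rV[int]_n) : E := map_mx (fun z : int => z%:~R) k.

Lemma cintegrable_wav h j k : cintegrable h -> cintegrable (wav h j k).
Proof.
by move=> ih; apply: cintegrableZl; apply: cintegrable_affine => //; exact: exp2z_neq0.
Qed.

Lemma cmeasurable_wav h j k : cmeasurable h -> cmeasurable (wav h j k).
Proof.
move=> mh; apply: cmeasurableM; first exact: cmeasurable_cst.
exact: (cmeasurable_comp (measurable_affine _ _) mh).
Qed.

Lemma cmod_wav h j k x : cmod (wav h j k x) =
  2 `^ (j%:~R * n%:R / 2) * cmod (h ((2 : R) ^ j *: x - lattice k)).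
Proof. by rewrite cmodM cmod_real ger0_norm ?powR_ge0. Qed.

Lemma wav_bound h j k K : (forall x, cmod (h x) <= K) ->
  forall x, cmod (wav h j k x) <= 2 `^ (j%:~R * n%:R / 2) * K.
Proof. by move=> hK x; rewrite cmod_wav ler_wpM2l ?powR_ge0. Qed.

(** The substitution [z = 2 ^ j y - k] turns [phi] at scale [j'] into [phi] at scale [j' - j], so
    every block of a wavelet is the wavelet of a fixed generator. *)
Lemma convol_wav phi h j j' k x : ccontinuous phi -> cintegrable phi ->
  (exists K, forall x, cmod (phi x) <= K) -> cintegrable h ->
  convol (dilate phi j') (wav h j k) x = wav (convol (dilate phi (j' - j)) h) j k x.
Proof.
move=> cphi iphi [K hK] ih; rewrite /wav -/(lattice k).
set X := (2 : R) ^ j *: x - _.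
have ig : cintegrable (fun z => dilate phi (j' - j) (X - z) * h z).
  apply: (convol_integrand (dilate_bound (j' - j) hK)) => //.
  exact: cintegrable_dilate.
have e y : dilate phi j' (x - y) * wav h j k y =
  (2 `^ (j%:~R * n%:R / 2))%:C%C * (((2 : R) ^ (j * n%:Z))%:C%C *
   (dilate phi (j' - j) (X - ((2 : R) ^ j *: y - lattice k)) * h ((2 : R) ^ j *: y - lattice k))).
  rewrite /wav -/(lattice k) /dilate.
  rewrite (_ : (2 : R) ^ (j' - j) *: (X - _) = (2 : R) ^ j' *: (x - y)); last first.
    rewrite /X (_ : _ - _ = (2 : R) ^ j *: (x - y)); last first.
      by rewrite scalerBr opprB addrA subrK.
    by rewrite scalerA -expfzDr// subrK.
  rewrite (_ : (2 : R) ^ (j' * n%:Z) = (2 : R) ^ (j * n%:Z) * (2 : R) ^ ((j' - j) * n%:Z)).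
    by rewrite rmorphM/=; ring.
  by rewrite -expfzDr// -mulrDl addrC subrK.
transitivity (cintegral (fun y => (2 `^ (j%:~R * n%:R / 2))%:C%C *
  (((2 : R) ^ (j * n%:Z))%:C%C *
   (dilate phi (j' - j) (X - ((2 : R) ^ j *: y - lattice k)) * h ((2 : R) ^ j *: y - lattice k))))).
  by apply: eq_cintegral => y; rewrite -e.
have ia := cintegrable_affine (- lattice k) (exp2z_neq0 R j) ig.
rewrite cintegralZl; last exact: cintegrableZl.
congr (_ * _); rewrite cintegralZl//.
rewrite (cintegral_affine (- lattice k) (exp2z_neq0 R j) ig) mulrA -rmorphM/= exp2zX.
by rewrite gtr0_norm ?exp2z_gt0// divff ?mul1r// expf_neq0// exp2z_neq0.
Qed.

Lemma ler_1norm (x y : E) : 1 + `|x| <= (1 + `|x - y|) * (1 + `|y|).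
Proof.
have h : `|x| <= `|x - y| + `|y| by rewrite -[in leLHS](subrK y x) ler_normD.
have := mulr_ge0 (normr_ge0 (x - y)) (normr_ge0 y); nra.
Qed.

(** [ler_1norm] splits the weight between the factors: the pointwise bound on [phi] takes one share
    and the weighted integral of [h] the other. This version converts decay in the mean into
    pointwise decay. *)
Lemma convol_decays_weight phi h r K : 0 <= r ->
  cmeasurable phi -> (forall x, cintegrable (fun y => phi (x - y) * h y)) ->
  (forall x, (1 + `|x|) `^ r * cmod (phi x) <= K) -> cmeasurable h ->
  mu.-integrable setT (fun x => ((1 + `|x|) `^ r * cmod (h x))%:E) ->
  decays r (convol phi h).
Proof.
move=> r0 mphi ig hK mh ih; exists (K * \int[mu]_y ((1 + `|y|) `^ r * cmod (h y))) => x.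
rewrite (le_trans (ler_wpM2l _ (ler_cmod_cintegral (ig x)))) ?powR_ge0//.
rewrite -RintegralZl//; last exact: cintegrable_cmod.
rewrite -RintegralZl//.
apply: le_Rintegral => //.
- exact: (integrableZl measurableT _ (cintegrable_cmod (ig x))).
- exact: (integrableZl measurableT K ih).
move=> y _; rewrite cmodM.
have h1 : (1 + `|x|) `^ r <= (1 + `|x - y|) `^ r * (1 + `|y|) `^ r.
  rewrite -powRM ?addr_ge0// ge0_ler_powR ?nnegrE ?addr_ge0 ?mulr_ge0 ?addr_ge0//.
  exact: ler_1norm.
apply: (@le_trans _ _ (((1 + `|x - y|) `^ r * (1 + `|y|) `^ r) *
    (cmod (phi (x - y)) * cmod (h y)))).
  by rewrite ler_wpM2r// mulr_ge0// cmod_ge0.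
by rewrite mulrACA ler_wpM2r// mulr_ge0 ?powR_ge0 ?cmod_ge0.
Qed.

(** The same splitting with the roles exchanged: [h] is bounded pointwise and the integrated factor
    is [phi], which therefore needs [n + 2] extra orders of decay. *)
Lemma convol_decays phi h r : 0 <= r -> cmeasurable phi -> cmeasurable h ->
  decays (r + n.+2%:R) phi -> decays r h ->
  (forall x, cintegrable (fun y => phi (x - y) * h y)) ->
  decays r (convol phi h).
Proof.
move=> r0 mphi mh dphi [K hK] ig.
have iphi := decays_integrable mphi dphi.
have irefl x : mu.-integrable setT
    (fun y => ((1 + `|x - y|) `^ r * cmod (phi (x - y)))%:E).
  under eq_fun do rewrite sub_affine.
  by apply: (@integrable_affine _ _ _ _ (fun y => (1 + `|y|) `^ r * cmod (phi y)));
    rewrite ?oppr_eq0 ?oner_eq0.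
exists (K * \int[mu]_y ((1 + `|y|) `^ r * cmod (phi y))) => x.
rewrite (le_trans (ler_wpM2l _ (ler_cmod_cintegral (ig x)))) ?powR_ge0//.
have -> : \int[mu]_y ((1 + `|y|) `^ r * cmod (phi y)) =
    \int[mu]_y ((1 + `|x - y|) `^ r * cmod (phi (x - y))).
  under [in RHS]eq_Rintegral do rewrite sub_affine.
  rewrite (@Rintegral_affine _ _ _ _ (fun y => (1 + `|y|) `^ r * cmod (phi y))) ?oppr_eq0 ?oner_eq0//.
  by rewrite normrN1 expr1n invr1 mul1r.
rewrite -[leLHS]RintegralZl//; last exact: (cintegrable_cmod (ig x)).
rewrite -[leRHS]RintegralZl//; last exact: (irefl x).
apply: le_Rintegral => //.
- exact: (integrableZl measurableT _ (cintegrable_cmod (ig x))).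
- exact: (integrableZl measurableT K (irefl x)).
move=> y _; rewrite cmodM.
have h1 : (1 + `|x|) `^ r <= (1 + `|x - y|) `^ r * (1 + `|y|) `^ r.
  rewrite -powRM ?addr_ge0// ge0_ler_powR ?nnegrE ?addr_ge0 ?mulr_ge0 ?addr_ge0//.
  exact: ler_1norm.
apply: (@le_trans _ _ (((1 + `|x - y|) `^ r * (1 + `|y|) `^ r) *
    (cmod (phi (x - y)) * cmod (h y)))).
  by rewrite ler_wpM2r// mulr_ge0// cmod_ge0.
by rewrite mulrACA [leLHS]mulrC ler_wpM2r// mulr_ge0 ?powR_ge0 ?cmod_ge0.
Qed.

(** With [t] the Euclidean norm, [(1 + t) ^ sigma <= 2 ^ sigma (1 + t ^ sigma)], because [1 + t] is
    at most [2] when [t <= 1] and at most [2 t] otherwise. *)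
Lemma in_D_integrable sigma h : 0 <= sigma -> in_D sigma h ->
  mu.-integrable setT (fun x => ((1 + `|x|) `^ sigma * cmod (h x))%:E).
Proof.
move=> s0 [mh hoo].
have mE : measurable_fun setT (fun x : E => enorm x).
  apply: (measurableT_comp (f := @Num.sqrt R)).
    apply: continuous_measurable_fun; exact: sqrt_continuous.
  by apply: measurable_sum => i; apply: measurable_funM; exact: measurable_coord.
have mc := cmeasurable_cmod mh.
apply: (@integrable_leR _ _ _ (fun x => 2 `^ sigma * ((1 + enorm x `^ sigma) * cmod (h x)))).
- apply: measurable_funM => //; apply: measurable_fun_powR.
  by apply: measurable_funD => //; exact: measurable_norm_rV.
- move=> x; rewrite ger0_norm ?mulr_ge0 ?powR_ge0 ?cmod_ge0// mulrA.
  rewrite ler_wpM2r ?cmod_ge0//; set t := enorm x.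
  have t0 : 0 <= t by exact: sqrtr_ge0.
  apply: (@le_trans _ _ ((1 + t) `^ sigma)).
    by rewrite ge0_ler_powR ?nnegrE ?addr_ge0// lerD2l ler_norm_enorm.
  have [t1|t1] := leP t 1.
    rewrite (@le_trans _ _ (2 `^ sigma))//.
      by rewrite ge0_ler_powR ?nnegrE ?addr_ge0//; lra.
    by rewrite ler_peMr ?powR_ge0// lerDl powR_ge0.
  rewrite (@le_trans _ _ ((2 * t) `^ sigma))//.
    by rewrite ge0_ler_powR ?nnegrE ?addr_ge0 ?mulr_ge0//; lra.
  by rewrite powRM// ler_wpM2l ?powR_ge0// lerDr.
- have H : mu.-integrable setT (fun x => ((1 + enorm x `^ sigma) * cmod (h x))%:E);
    last exact: (integrableZl measurableT (2 `^ sigma) H).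
  apply/integrableP; split.
    apply/measurable_EFinP; apply: measurable_funM => //.
    by apply: measurable_funD => //; exact: measurable_fun_powR.
  apply: le_lt_trans hoo; rewrite le_eqVlt; apply/orP; left; apply/eqP.
  apply: eq_integral => x _; rewrite gee0_abs// lee_fin mulr_ge0 ?cmod_ge0//.
  by rewrite addr_ge0// powR_ge0.
Qed.

End wavelet_scaling.

(** * Convexity and decay envelopes *)

Section power_inequalities.
Context (R : realType).
Implicit Types p t u x y : R.

(** Young's inequality for [t] and [u ^ (p - 1)]; geometrically, the graph of the convex function
    [t ^ p] lies above its tangent at [u]. *)
Lemma powR_tangent p t u : 1 < p -> 0 <= t -> 0 <= u ->
  p * (t * u `^ (p - 1)) <= t `^ p + (p - 1) * u `^ p.
Proof.
move=> p1 t0 u0.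
have p0 : 0 < p by lra.
have pm : 0 < p - 1 by lra.
have pN : p != 0 by rewrite gt_eqF.
have pmN : p - 1 != 0 by rewrite gt_eqF.
have q0 : 0 < p / (p - 1) by rewrite divr_gt0.
have pq1 : p^-1 + (p / (p - 1))^-1 = 1 by rewrite invf_div; field.
have h := @conjugate_powR _ t (u `^ (p - 1)) p (p / (p - 1)) t0 (powR_ge0 _ _) p0 q0 pq1.
have e : (u `^ (p - 1)) `^ (p / (p - 1)) = u `^ p.
  by rewrite -powRrM mulrCA divff// mulr1.
rewrite e in h.
have := ler_wpM2l (ltW p0) h; rewrite (_ : p * (_ + _) = t `^ p + (p - 1) * u `^ p)//.
by field; rewrite pN pmN.
Qed.

(* Makes sum_i (beta_i - beta_(i+1)) beta_i ^ (- th) telescope. *)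
Lemma powR_concave_gap th x y : 0 < th < 1 -> 0 < x -> 0 <= y ->
  (1 - th) * (x - y) * x `^ (- th) <= x `^ (1 - th) - y `^ (1 - th).
Proof.
move=> /andP[th0 th1] x0 y0.
have th0' : th != 0 by rewrite gt_eqF.
have th1' : 1 - th != 0 by rewrite gt_eqF//; lra.
have th1p : 0 < 1 - th by lra.
have := @conjugate_powR _ (x `^ th) (y `^ (1 - th)) th^-1 (1 - th)^-1
  (powR_ge0 _ _) (powR_ge0 _ _).
rewrite !invr_gt0 !invrK -!powRrM !divff// !powRr1 ?(ltW x0)//.
have th11 : th + (1 - th) = 1 by ring.
move=> /(_ th0 th1p th11) h.
have h2 : (1 - th) * (x - y) <= x - x `^ th * y `^ (1 - th) by lra.
have xth : 0 <= x `^ (- th) by exact: powR_ge0.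
apply: le_trans (ler_wpM2r xth h2) _.
rewrite mulrBl mulrAC -powRD ?(gt_eqF x0) ?implybT// subrr powRr0 mul1r.
by rewrite -[X in X * _](powRr1 (ltW x0)) -powRD ?(gt_eqF x0) ?implybT.
Qed.

(* Integrating or summing the tangent inequality and optimizing in u replaces
   Jensen's and Hoelder's inequalities. *)
Lemma powR_dual p X K Y : 1 < p -> 0 <= X -> 0 <= K -> 0 <= Y ->
  (forall u, 0 < u -> p * u `^ (p - 1) * X <= Y + (p - 1) * u `^ p * K) ->
  X `^ p <= K `^ (p - 1) * Y.
Proof.
move=> p1 X0 K0 Y0 key.
have p0 : 0 < p by lra.
have pm0 : 0 < p - 1 by lra.
have [->|XN] := eqVneq X 0.
  by rewrite powR0 ?gt_eqF// mulr_ge0// powR_ge0.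
have Xp : 0 < X by rewrite lt0r XN.
(* With [K = 0] the hypothesis is contradictory for [X > 0]: choosing [u ^ (p - 1) = v] makes its
   left side equal to [Y + 1]. *)
have [KE|KN] := eqVneq K 0.
  pose v := (Y + 1) / (p * X).
  have v0 : 0 < v by rewrite divr_gt0 ?mulr_gt0//; lra.
  have ev : (v `^ (p - 1)^-1) `^ (p - 1) = v.
    by rewrite -powRrM mulVf ?gt_eqF// powRr1// ltW.
  have := key (v `^ (p - 1)^-1) (powR_gt0 _ v0).
  rewrite KE ev mulr0 addr0 (_ : p * v * X = Y + 1); first lra.
  by rewrite /v; field; rewrite XN gt_eqF.
have Kp : 0 < K by rewrite lt0r KN.
(* The value of [u] at which the hypothesis is sharpest. *)
pose u := X / K.
have u0 : 0 < u by rewrite divr_gt0.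
have uK : u * K = X by rewrite /u divfK.
have up : u `^ p = u * u `^ (p - 1) by rewrite mulr_powRB1// ltW.
have key2 : u `^ (p - 1) * X <= Y.
  have e2 : (p - 1) * u `^ p * K = (p - 1) * (u `^ (p - 1) * X).
    by rewrite up -uK; ring.
  by move: (key u u0); rewrite e2; lra.
have -> : X `^ p = K `^ (p - 1) * (u `^ (p - 1) * X).
  rewrite -(mulr_powRB1 X0 p0) -[in X `^ _]uK powRM ?(ltW u0) ?(ltW Kp)//; ring.
by rewrite ler_wpM2l// powR_ge0.
Qed.

Lemma jensen_sum (I : Type) (r : seq I) (l t : I -> R) p K : 1 < p ->
  (forall i, 0 <= l i) -> (forall i, 0 <= t i) ->
  \sum_(i <- r) l i <= K ->
  (\sum_(i <- r) l i * t i) `^ p <= K `^ (p - 1) * \sum_(i <- r) l i * t i `^ p.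
Proof.
move=> p1 l0 t0 hK; apply: powR_dual => //.
- by apply: sumr_ge0 => i _; rewrite mulr_ge0.
- by apply: le_trans hK; apply: sumr_ge0.
- by apply: sumr_ge0 => i _; rewrite mulr_ge0// powR_ge0.
move=> u u0; apply: (@le_trans _ _ (\sum_(i <- r) l i * t i `^ p +
    (p - 1) * u `^ p * \sum_(i <- r) l i)); last first.
  by rewrite lerD2l ler_wpM2l// mulr_ge0 ?powR_ge0//; lra.
rewrite !mulr_sumr -big_split; apply: ler_sum => i _ /=.
have := ler_wpM2l (l0 i) (powR_tangent p1 (t0 i) (ltW u0)).
by congr (_ <= _); ring.
Qed.

(** As for finite sums, but both series live in the extended reals: [K = 0], where the factor
    [K ^ (p - 1)] vanishes and [X = 0] must be shown, and a divergent right side are settled before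
    [powR_dual] applies. *)
Lemma jensen_series (l t : nat -> R) p X K : 1 < p ->
  (forall i, 0 <= l i) -> (forall i, 0 <= t i) -> 0 <= X ->
  (\sum_(0 <= i <oo) (l i)%:E <= K%:E)%E ->
  (X%:E <= \sum_(0 <= i <oo) (l i * t i)%:E)%E ->
  ((X `^ p)%:E <= (K `^ (p - 1))%:E * \sum_(0 <= i <oo) (l i * t i `^ p)%:E)%E.
Proof.
move=> p1 l0 t0 X0 hK hX.
have p0 : 0 < p by lra.
have K0 : 0 <= K.
  by rewrite -lee_fin (le_trans _ hK)// nneseries_ge0// => i _ _; rewrite lee_fin.
have lt0 i : (0 <= (l i * t i `^ p)%:E)%E by rewrite lee_fin mulr_ge0// powR_ge0.
have S0 : (0 <= \sum_(0 <= i <oo) (l i * t i `^ p)%:E)%E.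
  by apply: nneseries_ge0 => i _ _.
pose S := (\sum_(0 <= i <oo) (l i * t i `^ p)%:E)%E.
have [KE|KN] := eqVneq K 0.
  have l00 i : l i = 0.
    apply/eqP; rewrite eq_le l0 andbT -lee_fin.
    apply: (@le_trans _ _ (\sum_(0 <= k < i.+1) (l k)%:E)%E).
      by rewrite big_nat_recr//= leeDr// sume_ge0// => k _; rewrite lee_fin.
    rewrite -KE; apply: le_trans hK.
    by apply: nneseries_lim_ge => k _ _; rewrite lee_fin.
  move: hX; rewrite eseries0 ?lee_fin; last by move=> i _ _; rewrite l00 mul0r.
  move=> X0'; have -> : X = 0 by apply/eqP; rewrite eq_le X0' X0.
  by rewrite powR0 ?gt_eqF// mule_ge0// lee_fin powR_ge0.
have Kp : 0 < K by rewrite lt0r KN.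
have [Yoo|] := boolP (S == +oo%E).
  by rewrite -/S (eqP Yoo) gt0_muley ?leey// lte_fin powR_gt0.
rewrite -ltey => Yoo.
have /fineK YE : S \is a fin_num by rewrite ge0_fin_numE.
rewrite -/S -YE -EFinM lee_fin; apply: powR_dual => //; first by rewrite fine_ge0.
move=> u u0; rewrite -lee_fin EFinD YE /S.
have c0 : 0 <= p * u `^ (p - 1) by rewrite mulr_ge0 ?powR_ge0// ltW.
have c1 : 0 <= (p - 1) * u `^ p by rewrite mulr_ge0 ?powR_ge0//; lra.
apply: (@le_trans _ _ ((p * u `^ (p - 1))%:E * \sum_(0 <= i <oo) (l i * t i)%:E)%E).
  by rewrite EFinM lee_wpmul2l.
rewrite -nneseriesZl; last by move=> i _; rewrite lee_fin mulr_ge0.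
apply: (@le_trans _ _ (\sum_(0 <= i <oo) ((l i * t i `^ p)%:E + ((p - 1) * u `^ p)%:E * (l i)%:E))%E).
  apply: lee_nneseries => [i _ _|i _].
    by rewrite -EFinM lee_fin mulr_ge0// mulr_ge0.
  rewrite -!EFinM -EFinD lee_fin.
  have := ler_wpM2l (l0 i) (powR_tangent p1 (t0 i) (ltW u0)).
  by congr (_ <= _); ring.
rewrite nneseriesD//; last first.
  by move=> i _ _; rewrite -EFinM lee_fin mulr_ge0.
rewrite leeD2l// nneseriesZl; last by move=> i _; rewrite lee_fin.
by rewrite [leRHS]EFinM lee_wpmul2l.
Qed.

End power_inequalities.

Arguments envelope : simpl never.

Section envelopes.
Context (R : realType) (n : nat).
Hypothesis n_gt0 : (0 < n)%N.
Local Notation E := 'rV[R]_n.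
Local Notation C := R[i].
Variables (h : E -> C) (r K : R).
Hypotheses (r_gt0 : 0 < r) (hK : forall x, (1 + `|x|) `^ r * cmod (h x) <= K).

(** Constant rows attain every norm when [0 < n], so the sets behind the envelope are nonempty and
    their suprema are not default values. *)
Lemma norm_const_rV (t : R) : `|const_mx t : E| = `|t|.
Proof.
apply/eqP; rewrite eq_le; apply/andP; split.
  by apply: ler_norm_rV => // i; rewrite mxE.
by have := ler_coord_norm (const_mx t : E) (Ordinal n_gt0); rewrite mxE.
Qed.

Let K_ge0 : 0 <= K.
Proof. by apply: le_trans (hK 0); rewrite mulr_ge0 ?powR_ge0 ?cmod_ge0. Qed.

Let tail (m : nat) : set R := [set cmod (h z) | z in [set z : E | m%:R <= `|z|]].

Let tail_bound m z : m%:R <= `|z| -> cmod (h z) <= K * m.+1%:R `^ (- r).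
Proof.
move=> mz; rewrite powRN ler_pdivlMr ?powR_gt0// mulrC.
apply: le_trans (hK z); rewrite ler_wpM2r ?cmod_ge0//.
by rewrite ge0_ler_powR ?nnegrE ?addr_ge0// ?(ltW r_gt0)// -natr1 addrC lerD2l.
Qed.

Let tail_ub m : has_ubound (tail m).
Proof. by exists (K * m.+1%:R `^ (- r)) => _ [z mz <-]; exact: tail_bound. Qed.

Let tail_neq0 m : tail m !=set0.
Proof.
by exists (cmod (h (const_mx m%:R))); exists (const_mx m%:R) => //=; rewrite norm_const_rV ger0_norm.
Qed.

(** The condition [0 <= |z|] is void, so the layer of index 0 has zero weight and the shift by one
    in the envelope does no harm at its start. *)
Lemma envelope0E : envelope h 0 = envelope h 1.
Proof.
rewrite /envelope; congr sup; apply/seteqP; split => _ [z _ <-]; exists z => //=.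
Qed.

Lemma envelope_ge m z : (m.-1)%:R <= `|z| -> cmod (h z) <= envelope h m.
Proof.
case: m => [_|m mz]; last by apply: ub_le_sup; [exact: tail_ub|exists z].
by rewrite envelope0E; apply: ub_le_sup; [exact: (@tail_ub 0)|exists z => //=].
Qed.

Lemma envelope_ge0 m : 0 <= envelope h m.
Proof.
apply: (le_trans (cmod_ge0 (h (const_mx (m.-1)%:R)))).
by apply: envelope_ge; rewrite norm_const_rV ger0_norm.
Qed.

Lemma envelopeS m : envelope h m.+1 <= envelope h m.
Proof.
case: m => [|m]; first by rewrite envelope0E.
apply: ge_sup; first exact: (@tail_neq0 m.+1).
move=> _ [z mz <-]; apply: envelope_ge => /=.
by apply: le_trans mz; rewrite ler_nat.
Qed.

Lemma envelope_bound m : envelope h m.+1 <= K * m.+1%:R `^ (- r).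
Proof.
by apply: ge_sup; [exact: (@tail_neq0 m)|move=> _ [z mz <-]; exact: tail_bound].
Qed.

Definition envelope_gap i := envelope h i - envelope h i.+1.

Lemma envelope_gap_ge0 i : 0 <= envelope_gap i.
Proof. by rewrite subr_ge0 envelopeS. Qed.

Lemma envelope_cvg0 : envelope h @ \oo --> 0.
Proof.
suff c : (fun m => envelope h m.+1) @ \oo --> 0 by rewrite -cvg_shiftS; exact: c.
apply: (@squeeze_cvgr _ _ _ _ (fun=> 0) (fun m => K * m.+1%:R `^ (- r))) => //.
- by apply: nearW => m; rewrite envelope_ge0 envelope_bound.
- exact: cvg_cst.
rewrite -[X in _ --> X](mulr0 K); apply: (@cvgMl_tmp _ _ \oo).
apply/cvgrPdist_le => e e0.
pose N := (Num.truncn (e^-1 `^ r^-1)).+1.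
exists N => // m /= Nm.
rewrite sub0r normrN ger0_norm ?powR_ge0// powRN.
rewrite invf_ple ?posrE ?powR_gt0//.
have -> : e^-1 = (e^-1 `^ r^-1) `^ r.
  by rewrite -powRrM mulVf ?gt_eqF// powRr1// invr_ge0 ltW.
rewrite ge0_ler_powR ?nnegrE ?powR_ge0 ?(ltW r_gt0)//.
rewrite ltW// (lt_le_trans (truncnS_gt _))// ler_nat.
by rewrite (leq_trans Nm).
Qed.

(** The gaps telescope to [envelope h m - envelope h N], and the last term tends to 0. *)
Lemma envelope_layers m :
  ((envelope h m)%:E <= \sum_(0 <= i <oo) (envelope_gap i * (m <= i)%N%:R)%:E)%E.
Proof.
have part N : (m <= N)%N ->
    ((envelope h m - envelope h N)%:E <= \sum_(0 <= i <oo) (envelope_gap i * (m <= i)%N%:R)%:E)%E.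
  move=> mN; apply: (@le_trans _ _ (\sum_(0 <= i < N) (envelope_gap i * (m <= i)%N%:R)%:E)%E).
    rewrite sumEFin lee_fin; elim: N mN => [|N IH].
      by rewrite leqn0 => /eqP ->; rewrite big_geq// subrr.
    rewrite leq_eqVlt => /predU1P[->|].
      by rewrite subrr sumr_ge0// => i _; rewrite mulr_ge0 ?envelope_gap_ge0.
    rewrite ltnS => mN; rewrite big_nat_recr//= mN mulr1 /envelope_gap.
    by have := IH mN; lra.
  by apply: nneseries_lim_ge => i _ _; rewrite lee_fin mulr_ge0 ?envelope_gap_ge0.
set S := (\sum_(0 <= i <oo) _)%E in part *.
have c : (fun N => (envelope h m - envelope h N)%:E) @ \oo --> (envelope h m)%:E.
  apply/fine_cvgP; split; first exact: nearW.
  rewrite -[X in _ --> X]subr0; apply: cvgB; first exact: cvg_cst.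
  exact: envelope_cvg0.
by apply: (cvge_le _ c); exists m.
Qed.

(** With [th = e / r], decay of order [r] bounds [(2 i + 1) ^ e] by a constant times
    [envelope h i ^ (- th)], and concavity of [t ^ (1 - th)] makes the product with the gap
    telescope. Any [r > e] is therefore enough, without a further order to sum over [i]. *)
Lemma decay_sum_fin e : 0 < e < r ->
  (\sum_(0 <= i <oo) (envelope_gap i * (i.*2.+1)%:R `^ e)%:E)%E = (decay_sum e h)%:E.
Proof.
move=> /andP[e0 er]; rewrite /decay_sum fineK//.
have t0 i : (0 <= (envelope_gap i * (i.*2.+1)%:R `^ e)%:E)%E.
  by rewrite lee_fin mulr_ge0 ?envelope_gap_ge0 ?powR_ge0.
rewrite ge0_fin_numE; last by apply: nneseries_ge0 => i _ _; exact: t0.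
pose th := e / r.
have th01 : 0 < th < 1 by rewrite divr_gt0//= ltr_pdivrMr// mul1r.
have th1 : 0 < 1 - th by case/andP: th01 => _; lra.
pose c := 3 `^ e * K `^ th / (1 - th).
have c0 : 0 <= c by rewrite divr_ge0 ?mulr_ge0 ?powR_ge0// ltW.
have step i : envelope_gap i * (i.*2.+1)%:R `^ e <=
    c * (envelope h i `^ (1 - th) - envelope h i.+1 `^ (1 - th)).
  (* A vanishing envelope is treated apart: a negative power of it is about to be taken. *)
  have := envelope_ge0 i; rewrite le_eqVlt => /predU1P[b0|b0].
    have b1 : envelope h i.+1 = 0.
      by apply/eqP; rewrite eq_le envelope_ge0 [X in _ <= X]b0 envelopeS.
    by rewrite /envelope_gap b1 -b0 subrr mul0r subrr mulr0.
  have key : (i.*2.+1)%:R `^ e <= 3 `^ e * K `^ th * envelope h i `^ (- th).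
    have bi : envelope h i <= K * (i.-1).+1%:R `^ (- r).
      by case: i b0 => [|i] b0; [rewrite envelope0E|]; exact: envelope_bound.
    rewrite powRN ler_pdivlMr ?powR_gt0//.
    (* For [i >= 1] this is [2 i + 1 <= 3 i], and the predecessor-successor form also covers
       [i = 0]. *)
    have i2 : (i.*2.+1)%:R <= 3 * (i.-1).+1%:R :> R.
      by rewrite -natrM ler_nat; case: (i) => //= j; lia.
    apply: (@le_trans _ _ ((3 * (i.-1).+1%:R) `^ e * (K * (i.-1).+1%:R `^ (- r)) `^ th)).
      have thge0 : 0 <= th by case/andP: th01 => /ltW.
      have hA : (i.*2.+1)%:R `^ e <= (3 * (i.-1).+1%:R) `^ e.
        by apply: ge0_ler_powR i2; rewrite ?nnegrE ?mulr_ge0// ltW.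
      have hB : envelope h i `^ th <= (K * (i.-1).+1%:R `^ (- r)) `^ th.
        by apply: ge0_ler_powR bi => //; rewrite nnegrE ?(ltW b0)// mulr_ge0 ?powR_ge0 ?K_ge0.
      by apply: ler_pM; rewrite ?powR_ge0.
    have rth : - r * th = - e by rewrite /th mulNr mulrCA divff ?mulr1// gt_eqF.
    rewrite !powRM ?powR_ge0 ?K_ge0// -powRrM rth mulrACA.
    by rewrite [X in _ * X](_ : _ = 1) ?mulr1// powRN divff// gt_eqF// powR_gt0.
  have gap := powR_concave_gap th01 b0 (envelope_ge0 i.+1).
  apply: (le_trans (ler_wpM2l (envelope_gap_ge0 i) key)).
  have cc : 0 <= 3 `^ e * K `^ th by rewrite mulr_ge0 ?powR_ge0.
  rewrite /c [leRHS]mulrAC ler_pdivlMr//.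
  have := ler_wpM2l cc gap; rewrite /envelope_gap.
  by congr (_ <= _); ring.
apply: (@le_lt_trans _ _ (c * envelope h 0 `^ (1 - th))%:E); last exact: ltry.
apply: lime_le; first by apply: is_cvg_nneseries => i _ _; exact: t0.
apply: nearW => N; rewrite sumEFin lee_fin.
apply: (@le_trans _ _ (c * (envelope h 0 `^ (1 - th) - envelope h N `^ (1 - th)))).
  elim: N => [|N IH]; first by rewrite big_geq// subrr mulr0.
  rewrite big_nat_recr//=; apply: le_trans (lerD IH (step N)) _.
  by rewrite -mulrDr addrA subrK.
by rewrite ler_wpM2l// gerBl powR_ge0.
Qed.

End envelopes.

(** * Muckenhoupt weights and dyadic cubes *)

Lemma lee_poweR (R : realType) (x y : \bar R) (r : R) : 0 <= r ->
  (0 <= x)%E -> (x <= y)%E -> (x `^ r <= y `^ r)%E.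
Proof.
move=> r0 x0 xy; apply: gt0_ler_poweR => //.
  by rewrite in_itv/= leey x0.
by rewrite in_itv/= leey (le_trans x0).
Qed.

Section muckenhoupt.
Context (R : realType) (n : nat).
Local Notation E := 'rV[R]_n.
Local Notation mu := (lebesgue_rV R n).
Variables (p : R) (w : E -> R).
Hypotheses (p_gt1 : 1 < p) (w_Ap : in_Ap p w).

Let p_gt0 : 0 < p. Proof. by rewrite (lt_trans _ p_gt1). Qed.
Let p_neq0 : p != 0. Proof. by rewrite gt_eqF. Qed.
Let pm_gt0 : 0 < p - 1. Proof. by rewrite subr_gt0. Qed.

Lemma measurable_weight : measurable_fun setT w.
Proof. by have [[]] := w_Ap. Qed.

Lemma weight_ae_gt0 : {ae mu, forall x, 0 < w x}.
Proof. by have [[]] := w_Ap. Qed.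

Lemma compact_cube (a : E) l : compact (cube a l).
Proof.
have := @rV_compact R n (fun i => `[a ord0 i, a ord0 i + l]%classic).
move=> /(_ (fun i => @segment_compact _ _ _)).
by congr compact.
Qed.

(* With |w| in place of w (they agree almost everywhere), integrands are
   nonnegative everywhere. *)
Definition wmass (H : set E) : \bar R := (\int[mu]_(x in H) `|w x|%:E)%E.

Lemma wmassE (H : set E) : measurable H -> wmass H = (\int[mu]_(x in H) (w x)%:E)%E.
Proof.
move=> mH; apply: ae_eq_integral => //.
- by apply/measurable_funTS/measurable_EFinP/measurableT_comp => //; exact: measurable_weight.
- by apply/measurable_funTS/measurable_EFinP; exact: measurable_weight.
apply: filterS weight_ae_gt0 => x w0 _; by rewrite gtr0_norm.
Qed.

Lemma wmass_ge0 H : (0 <= wmass H)%E.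
Proof. by apply: integral_ge0. Qed.

Lemma le_wmass H H' : measurable H -> measurable H' -> H `<=` H' ->
  (wmass H <= wmass H')%E.
Proof.
move=> mH mH' HH; apply: ge0_subset_integral => //.
by apply/measurable_funTS/measurable_EFinP/measurableT_comp => //; exact: measurable_weight.
Qed.

Lemma wmass_cube_lty a l : (wmass (cube a l) < +oo)%E.
Proof.
have [[_ + _] _] := w_Ap; move=> /(_ _ (@compact_cube a l)) /integrableP[_].
by [].
Qed.

Lemma wmass_gt0 H : measurable H -> (0 < mu H)%E -> (0 < wmass H)%E.
Proof.
move=> mH H0; rewrite lt0e wmass_ge0 andbT; apply/eqP => w0.
have mE : measurable_fun H (EFin \o w).
  by apply/measurable_funTS/measurable_EFinP; exact: measurable_weight.
have /(ae_eq_integral_abs mu mH mE) w00 := w0.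
have [N [mN N0 hN]] := filterI w00 weight_ae_gt0.
have : (mu H <= mu N)%E.
  apply: le_measure; rewrite ?inE// => x Hx; apply: hN => /= -[/(_ Hx) [wx]].
  by rewrite wx ltxx.
by rewrite N0 leNgt H0.
Qed.

Local Notation A := (fine (Ap_const p w)).

Lemma Ap_constE : Ap_const p w = A%:E.
Proof.
have [_ oo] := w_Ap; rewrite fineK// ge0_fin_numE//.
apply: le_trans (ereal_sup_ubound _); last first.
  by exists 0; exists 1; split; [exact: ltr01|reflexivity].
apply: mule_ge0; last by rewrite poweR_ge0.
rewrite mule_ge0 ?lee_fin ?invr_ge0 ?fine_ge0//.
rewrite -[X in (_ <= X)%E]wmassE ?wmass_ge0//; exact: measurable_cube.
Qed.

(** Mass of the dual weight [w ^ (1 - p')], since [1 - p' = - 1 / (p - 1)]. *)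
Definition dual_mass (H : set E) : \bar R :=
  (\int[mu]_(x in H) (w x `^ (- (p - 1)^-1))%:E)%E.

Lemma Ap_cube (a : E) l : 0 < l ->
  (wmass (cube a l) * dual_mass (cube a l) `^ (p - 1) <=
    (A * (l ^+ n) `^ p)%:E)%E.
Proof.
move=> l0; set Q := cube a l.
have mQ : measurable Q by exact: measurable_cube.
have muQ : fine (mu Q) = l ^+ n by rewrite lebesgue_cube ?ltW.
have ln0 : 0 < l ^+ n by rewrite exprn_gt0.
have : (average Q w * average Q (fun y => w y `^ (- (p - 1)^-1))%R `^ (p - 1) <= A%:E)%E.
  by rewrite -Ap_constE; apply: ereal_sup_ubound; exists a, l.
rewrite /average muQ -wmassE// -/(dual_mass Q).
have d0 : (0 <= dual_mass Q)%E by apply: integral_ge0 => x _; rewrite lee_fin powR_ge0.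
rewrite poweRM//; last by rewrite lee_fin invr_ge0 ltW.
rewrite poweR_EFin muleACA -EFinM => h.
have c0 : 0 < (l ^+ n)^-1 * (l ^+ n)^-1 `^ (p - 1) by rewrite mulr_gt0 ?powR_gt0 ?invr_gt0.
have e : (l ^+ n)^-1 * (l ^+ n)^-1 `^ (p - 1) = ((l ^+ n) `^ p)^-1.
  rewrite mulr_powRB1 ?invr_ge0 ?ltW// -powRN.
  by rewrite -[X in X `^ p](powR_inv1 (ltW ln0)) -powRrM mulN1r.
by move: h; rewrite e lee_pdivrMl ?powR_gt0// -EFinM mulrC.
Qed.

(** Hoelder's inequality for [g w ^ (1/p)] and [w ^ (- 1/p)] on [H], after which A_p on the
    surrounding cube removes the dual mass. With [g = 1] on a dyadic cube it yields doubling, with a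
    general [g] the dual estimate. *)
Lemma Ap_holder (a : E) l (H : set E) (g : E -> R) : 0 < l ->
  measurable H -> H `<=` cube a l -> measurable_fun setT g -> (forall x, 0 <= g x) ->
  ((\int[mu]_(x in H) (g x)%:E) `^ p * wmass (cube a l) <=
   (A * (l ^+ n) `^ p)%:E * \int[mu]_(x in H) (g x `^ p * `|w x|)%:E)%E.
Proof.
move=> l0 mH HQ mg g0; set Q := cube a l.
have mQ : measurable Q by exact: measurable_cube.
have mw := measurable_weight.
pose q := p / (p - 1).
have q0 : 0 < q by rewrite divr_gt0.
have pq : p^-1 + q^-1 = 1 by rewrite /q invf_div; field.
(* The product of these two factors is [\1_H x * g x] only where [0 < w x], hence the almost
   everywhere comparisons of integrals below. *)
pose f1 x := \1_H x * (g x * w x `^ p^-1).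
pose f2 x := \1_H x * w x `^ (- p^-1).
have m1 : measurable_fun setT (\1_H : E -> R) by exact/measurable_indicP.
have mf1 : measurable_fun setT f1.
  by apply: measurable_funM => //; apply: measurable_funM => //; exact: measurable_fun_powR.
have mf2 : measurable_fun setT f2.
  by apply: measurable_funM => //; exact: measurable_fun_powR.
have ind0 x : 0 <= \1_H x :> R by [].
have f10 x : 0 <= f1 x by rewrite !mulr_ge0 ?powR_ge0.
have f20 x : 0 <= f2 x by rewrite !mulr_ge0 ?powR_ge0.
have toH (f : E -> R) : (forall x, 0 <= f x) -> measurable_fun setT f ->
    (\int[mu]_(x in H) (f x)%:E = \int[mu]_x (\1_H x * f x)%:E)%E.
  move=> f0 mf; rewrite integral_mkcond; apply: eq_integral => x _.
  by rewrite patchE indicE; case: (x \in H); rewrite ?mul1r ?mul0r.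
have := @hoelder _ _ _ mu f1 f2 p q mf1 mf2 p_gt0 q0 pq.
have -> : ('N[mu]_1[EFin \o (f1 \* f2)%R] = \int[mu]_(x in H) (g x)%:E)%E.
  rewrite Lnorm1 toH//; apply: ae_eq_integral => //.
  - by apply: measurableT_comp => //; apply/measurable_EFinP; exact: measurable_funM.
  - by apply/measurable_EFinP; exact: measurable_funM.
  apply: filterS weight_ae_gt0 => x w0 _ /=.
  rewrite ger0_norm ?mulr_ge0 ?powR_ge0//.
  suff -> : f1 x * f2 x = \1_H x * g x by [].
  rewrite /f1 /f2 indicE; case: (x \in H); rewrite ?mul1r ?mul0r// -mulrA -powRD ?subrr ?powRr0 ?mulr1//.
  by rewrite (gt_eqF w0) implybT.
have -> : ('N[mu]_p%:E[EFin \o f1] = (\int[mu]_(x in H) (g x `^ p * `|w x|)%:E) `^ p^-1)%E.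
  rewrite unlock; congr (_ `^ _)%E; rewrite toH; last 2 first.
  - by move=> x; rewrite mulr_ge0 ?powR_ge0.
  - by apply: measurable_funM; [exact: measurable_fun_powR|exact: measurableT_comp].
  apply: ae_eq_integral => //.
  - apply/measurable_EFinP; apply: measurable_fun_powR; exact: measurableT_comp.
  - apply/measurable_EFinP; apply: measurable_funM => //.
    by apply: measurable_funM; [exact: measurable_fun_powR|exact: measurableT_comp].
  apply: filterS weight_ae_gt0 => x w0 _ /=.
  rewrite ?poweR_EFin ger0_norm//.
  suff -> : f1 x `^ p = \1_H x * (g x `^ p * `|w x|) by [].
  rewrite /f1 indicE; case: (x \in H); rewrite ?mul1r ?mul0r ?powR0//.
  by rewrite powRM ?powR_ge0// -powRrM mulVf// powRr1 ?ltW// gtr0_norm.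
have -> : ('N[mu]_q%:E[EFin \o f2] = dual_mass H `^ q^-1)%E.
  rewrite unlock; congr (_ `^ _)%E; rewrite /dual_mass toH; last 2 first.
  - by move=> x; rewrite powR_ge0.
  - exact: measurable_fun_powR.
  apply: eq_integral => x _ /=.
  rewrite ?poweR_EFin ger0_norm//.
  suff -> : f2 x `^ q = \1_H x * w x `^ (- (p - 1)^-1) by [].
  rewrite /f2 indicE; case: (x \in H); rewrite ?mul1r ?mul0r ?powR0 ?gt_eqF//.
  by rewrite -powRrM /q mulNr mulrA mulVf// mul1r.
set I := (\int[mu]_(x in H) (g x)%:E)%E.
set G := (\int[mu]_(x in H) (g x `^ p * `|w x|)%:E)%E => hol.
have I0 : (0 <= I)%E by apply: integral_ge0 => x _; rewrite lee_fin.
have G0 : (0 <= G)%E by apply: integral_ge0 => x _; rewrite lee_fin mulr_ge0 ?powR_ge0.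
have D0 K : (0 <= dual_mass K)%E by apply: integral_ge0 => x _; rewrite lee_fin powR_ge0.
have IG : (I `^ p <= G * dual_mass Q `^ (p - 1))%E.
  apply: (@le_trans _ _ ((G `^ p^-1 * dual_mass H `^ q^-1) `^ p)%E).
    by apply: lee_poweR => //; exact: ltW.
  rewrite poweRM ?poweR_ge0// -!poweRrM mulVf// poweRe1//.
  rewrite (_ : q^-1 * p = p - 1); last by rewrite /q invf_div divfK.
  rewrite lee_wpmul2l//; apply: lee_poweR => //; first exact: ltW.
  apply: ge0_subset_integral => //.
    by apply/measurable_funTS/measurable_EFinP; exact: measurable_fun_powR.
  by move=> x _; rewrite lee_fin powR_ge0.
apply: (@le_trans _ _ ((G * dual_mass Q `^ (p - 1)) * wmass Q)%E).
  by rewrite lee_wpmul2r// wmass_ge0.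
rewrite -muleA muleC [X in (X * _ <= _)%E]muleC lee_wpmul2r//.
exact: Ap_cube.
Qed.

(** [Ap_holder] for [g = 1] on the unit cube itself reads [W <= A W] with [0 < W < +oo]. *)
Lemma Ap_ge1 : 1 <= A.
Proof.
have mQ : measurable (cube (0 : E) 1) by exact: measurable_cube.
have := @Ap_holder 0 1 (cube 0 1) (fun=> 1) ltr01 mQ (@subset_refl _ _) (measurable_cst _) (fun=> ler01).
rewrite expr1n powR1 mulr1.
have -> : (\int[mu]_(x in cube (0 : E) 1) 1%:E = 1)%E.
  rewrite integral_cst// mul1e.
  by have := @lebesgue_cube R n 0 1 ler01; rewrite expr1n.
rewrite poweR1r mul1e.
under eq_integral do rewrite mul1r.
rewrite -/(wmass _); set W := wmass _.
have W0 : (0 < W)%E.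
  apply: wmass_gt0 => //.
  by have := @lebesgue_cube R n 0 1 ler01; rewrite expr1n => ->; rewrite lte_fin.
have Woo : (W < +oo)%E by exact: wmass_cube_lty.
have /fineK WE : W \is a fin_num by rewrite ge0_fin_numE// ltW.
have W0' : 0 < fine W by rewrite fine_gt0// W0 Woo.
by rewrite -WE -EFinM lee_fin ler_pMl.
Qed.

End muckenhoupt.

(** * Layers of cubes around a dyadic cube *)

Section lattice_cubes.
Context (R : realType) (n : nat).
Local Notation E := 'rV[R]_n.
Local Notation mu := (lebesgue_rV R n).
Implicit Types (j : int) (k : 'rV[int]_n) (x : E) (i : nat).

(** Distance in maximum norm, counted in cells of scale [j], from the cell containing [x] to
    [Q_{j,k}]. Integer values make the sets [level <= i] half-open cubes of [2 i + 1] cells per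
    side. *)
Definition level j k x : nat :=
  \max_(l < n) `|Num.floor ((2 : R) ^ j * x ord0 l) - k ord0 l|%N.

Definition hcube j k i : set E := [set x | (level j k x <= i)%N].

Definition corner j k i : E := \row_l ((2 : R) ^ (- j) * ((k ord0 l)%:~R - i%:R)).

Lemma level_leP j k x i : reflect
  (forall l, (2 : R) ^ (- j) * ((k ord0 l)%:~R - i%:R) <= x ord0 l <
     (2 : R) ^ (- j) * ((k ord0 l)%:~R + i%:R + 1)) (level j k x <= i)%N.
Proof.
have j0 := exp2z_gt0 R j.
have scale (t y : R) : ((2 : R) ^ (- j) * t <= y) = (t <= (2 : R) ^ j * y).
  by rewrite -(ler_pM2l j0) mulrA -expfzDr// subrr expr0z mul1r.
have scale' (t y : R) : (y < (2 : R) ^ (- j) * t) = ((2 : R) ^ j * y < t).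
  by rewrite -(ltr_pM2l j0) mulrA -expfzDr// subrr expr0z mul1r.
have main (l : 'I_n) : (`|Num.floor ((2 : R) ^ j * x ord0 l) - k ord0 l| <= i)%N =
   ((2 : R) ^ (- j) * ((k ord0 l)%:~R - i%:R) <= x ord0 l <
     (2 : R) ^ (- j) * ((k ord0 l)%:~R + i%:R + 1)).
  rewrite scale scale'; move: ((2 : R) ^ j * _) (k ord0 l) => y z.
  rewrite (_ : z%:~R - i%:R = (z - i%:Z)%:~R); last by rewrite rmorphB.
  rewrite (_ : z%:~R + i%:R + 1 = (z + i%:Z + 1)%:~R); last by rewrite !rmorphD.
  rewrite -floor_ge_int -floor_lt_int; move: (Num.floor y) => f.
  by apply/idP/idP => [h|/andP[h1 h2]]; [apply/andP; split|]; lia.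
apply: (iffP (bigmax_leqP _ _ _)) => h l; first by rewrite -main; exact: h.
by move=> _; rewrite main; exact: h.
Qed.

Lemma hcube_box j k i : hcube j k i =
  box (fun l => `[(2 : R) ^ (- j) * ((k ord0 l)%:~R - i%:R),
                  (2 : R) ^ (- j) * ((k ord0 l)%:~R + i%:R + 1)[%classic).
Proof.
apply/seteqP; split => x /=.
  by move=> /level_leP h l; have := h l; rewrite /= in_itv.
by move=> h; apply/level_leP => l; have := h l; rewrite /= in_itv.
Qed.

Lemma measurable_hcube j k i : measurable (hcube j k i).
Proof. by rewrite hcube_box; apply: measurable_box => l; exact: measurable_itv. Qed.

Lemma hcubeS j k i i' : (i <= i')%N -> hcube j k i `<=` hcube j k i'.
Proof. by move=> ii x /= h; exact: leq_trans ii. Qed.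

Lemma hcube_cube j k i :
  hcube j k i `<=` cube (corner j k i) ((2 : R) ^ (- j) * (i.*2.+1)%:R).
Proof.
move=> x /= /level_leP h l; have /andP[h1 h2] := h l; rewrite mxE h1/=.
apply: (le_trans (ltW h2)); rewrite -mulrDr ler_pM2l ?exp2z_gt0//.
by rewrite -natr1 -addnn natrD; lra.
Qed.

Lemma dyadic_hcube j k : (dyadic j k : set E) = hcube j k 0.
Proof.
apply/seteqP; split => x /=.
  by move=> h; apply/level_leP => l; have := h l; rewrite subr0 addr0.
by move=> /level_leP h l; have := h l; rewrite subr0 addr0.
Qed.

Lemma lebesgue_dyadic j k : mu (dyadic j k) = (((2 : R) ^ (- j)) ^+ n)%:E.
Proof.
rewrite dyadic_hcube hcube_box lebesgue_box; last by move=> l; exact: measurable_itv.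
rewrite (eq_bigr (fun=> ((2 : R) ^ (- j))%:E)); first by rewrite prodEFin prodr_const card_ord.
move=> l _; rewrite lebesgue_measure_itv/= lte_fin.
have j0 := exp2z_gt0 R (- j).
rewrite ltr_pM2l// ifT; last by lra.
by rewrite -EFinB; apply: (congr1 EFin); ring.
Qed.

(** If [c] is the cell of [x], the offsets [k - c + i] lie in [{0, ..., 2 i}] in each coordinate and
    determine [k]; the default value of [inord] is never met for the [k] counted. *)
Lemma level_count j x i (S : seq 'rV[int]_n) : uniq S ->
  (\sum_(k <- S) (level j k x <= i)%N <= (i.*2.+1) ^ n)%N.
Proof.
move=> uS; pose c l : int := Num.floor ((2 : R) ^ j * x ord0 l).
pose f (k : 'rV[int]_n) : {ffun 'I_n -> 'I_(i.*2.+1)} :=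
  [ffun l => inord (absz (k ord0 l - c l + i%:Z))].
pose P k := (level j k x <= i)%N.
have -> : (\sum_(k <- S) (level j k x <= i)%N = size (map f [seq k <- S | P k]))%N.
  rewrite size_map size_filter -sum1_count [RHS]big_mkcond; apply: eq_bigr => k _.
  by rewrite /P; case: (_ <= _)%N.
have fval k l : P k -> (f k l : nat)%:Z = k ord0 l - c l + i%:Z.
  move=> /bigmax_leqP /(_ l isT); rewrite -/(c l) ffunE => h.
  by rewrite inordK; lia.
have fi : {in [seq k <- S | P k] &, injective f}.
  move=> k k'; rewrite !mem_filter => /andP[Pk _] /andP[Pk' _] ff.
  apply/rowP => l.
  have : k ord0 l - c l + i%:Z = k' ord0 l - c l + i%:Z by rewrite -!fval// ff.
  by move=> /addIr/addIr.
have /card_uniqP <- : uniq (map f [seq k <- S | P k]).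
  by rewrite map_inj_in_uniq// filter_uniq.
by apply: leq_trans (max_card _) _; rewrite card_ffun !card_ord.
Qed.

(** Rounding down moves a coordinate by less than one, hence the predecessor, which matches the
    shift [m - 1] in the envelope. *)
Lemma level_norm j k x : ((level j k x).-1)%:R <= `|(2 : R) ^ j *: x - lattice R k|.
Proof.
have [-> |m0] := posnP (level j k x); first exact: normr_ge0.
have n0 : (0 < n)%N.
  by move: m0; rewrite /level; case: (n) x k => // x k; rewrite big_ord0.
have [|l0 h0] := @bigop.eq_bigmax 'I_n
    (fun l => `|Num.floor ((2 : R) ^ j * x ord0 l) - k ord0 l|%N); first by rewrite card_ord.
rewrite -/(level j k x) in h0.
apply: le_trans (ler_coord_norm _ l0); rewrite !mxE.
move: h0; move: ((2 : R) ^ j * x ord0 l0) (k ord0 l0) => y z h0.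
have h1 := floor_le y; have h2 := floorD1_gt y.
rewrite intrD in h2.
have e : (level j k x).-1%:R = `|(Num.floor y - z)%:~R| - 1 :> R.
  have -> : `|(Num.floor y - z)%:~R| = (level j k x)%:R :> R by rewrite h0 natr_absz intr_norm.
  by rewrite -[in RHS](prednK m0) -natr1 addrK.
rewrite e intrB lerBlDr.
move: ((Num.floor y)%:~R : R) (z%:~R : R) h1 h2 => f t h1 h2.
rewrite ler_norml; have := ler_norm (y - t); have := ler_norm (- (y - t)); rewrite normrN.
by move=> h3 h4; apply/andP; split; lra.
Qed.

End lattice_cubes.

Lemma ge0_integralZl_real d (T : measurableType d) (R : realType)
    (m : {measure set T -> \bar R}) (k : R) (f : T -> R) :
  measurable_fun setT f -> (forall x, 0 <= f x) -> 0 <= k ->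
  (\int[m]_x (k%:E * (f x)%:E) = k%:E * \int[m]_x (f x)%:E)%E.
Proof.
move=> mf f0 k0; apply: ge0_integralZl_EFin => //.
  by move=> x _; rewrite lee_fin.
exact/measurable_EFinP.
Qed.

(** * Upper bound for one-scale sums in the weighted norm *)

Section lattice_estimates.
Context (R : realType) (n : nat).
Hypothesis n_gt0 : (0 < n)%N.
Local Notation E := 'rV[R]_n.
Local Notation C := R[i].
Local Notation mu := (lebesgue_rV R n).
Variables (p : R) (w : E -> R).
Hypotheses (p_gt1 : 1 < p) (w_Ap : in_Ap p w).
Local Notation A := (fine (Ap_const p w)).

Let p_gt0 : 0 < p. Proof. by rewrite (lt_trans _ p_gt1). Qed.
Let A_gt0 : 0 < A. Proof. exact: lt_le_trans ltr01 (Ap_ge1 p_gt1 w_Ap). Qed.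

Definition omega j k : R := fine (wmass w (dyadic j k)).

Lemma wmass_dyadicE j k : wmass w (dyadic j k) = (omega j k)%:E.
Proof.
rewrite fineK// ge0_fin_numE ?wmass_ge0//.
apply: le_lt_trans (wmass_cube_lty w_Ap (corner R j k 0) ((2 : R) ^ (- j) * (0.*2.+1)%:R)).
rewrite dyadic_hcube; apply: (le_wmass w_Ap).
- exact: measurable_hcube.
- exact: measurable_cube.
- exact: hcube_cube.
Qed.

Lemma omega_gt0 j k : 0 < omega j k.
Proof.
rewrite -lte_fin -wmass_dyadicE; apply: (wmass_gt0 w_Ap).
  by rewrite dyadic_hcube; exact: measurable_hcube.
by rewrite lebesgue_dyadic lte_fin exprn_gt0// exp2z_gt0.
Qed.

Definition vol i : R := (i.*2.+1)%:R ^+ n.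

Lemma vol_gt0 i : 0 < vol i. Proof. by rewrite exprn_gt0. Qed.

(** Doubling with its explicit constant: [Ap_holder] for [g = 1] on the dyadic cube, the ratio of
    the two volumes being [vol i]. *)
Lemma wmass_cube_le j k i :
  (wmass w (cube (corner R j k i) ((2 : R) ^ (- j) * (i.*2.+1)%:R)) <=
    (A * vol i `^ p * omega j k)%:E)%E.
Proof.
set Q := cube _ _; pose l := (2 : R) ^ (- j) * (i.*2.+1)%:R.
have j0 := exp2z_gt0 R (- j).
have l0 : 0 < l by rewrite mulr_gt0.
have mD : measurable (dyadic j k : set E) by rewrite dyadic_hcube; exact: measurable_hcube.
have DQ : dyadic j k `<=` Q.
  by rewrite dyadic_hcube => x Dx; apply: hcube_cube; apply: (@hcubeS _ _ _ _ 0).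
have := Ap_holder p_gt1 w_Ap l0 mD DQ (measurable_cst (1 : R)) (fun=> ler01).
have -> : (\int[mu]_(x in dyadic j k) (1 : R)%:E = (((2 : R) ^ (- j)) ^+ n)%:E)%E.
  by rewrite integral_cst// mul1e; exact: lebesgue_dyadic.
have -> : (\int[mu]_(x in dyadic j k) (1 `^ p * `|w x|)%:E = (omega j k)%:E)%E.
  by rewrite -wmass_dyadicE; apply: eq_integral => x _; rewrite powR1 mul1r.
have /fineK WE : wmass w Q \is a fin_num.
  by rewrite ge0_fin_numE ?wmass_ge0// (wmass_cube_lty w_Ap).
rewrite -/Q -WE poweR_EFin -!EFinM !lee_fin exprMn powRM ?exprn_ge0 ?(ltW j0)//.
rewrite -/(vol i) => h.
have t0 : 0 < (((2 : R) ^ (- j)) ^+ n) `^ p by rewrite powR_gt0// exprn_gt0.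
rewrite -(ler_pM2l t0); apply: le_trans h _.
by rewrite le_eqVlt; apply/orP; left; apply/eqP; ring.
Qed.

Lemma wmass_hcube_le j k i :
  (wmass w (hcube j k i) <= (A * vol i `^ p * omega j k)%:E)%E.
Proof.
apply: le_trans (wmass_cube_le j k i); apply: (le_wmass w_Ap).
- exact: measurable_hcube.
- exact: measurable_cube.
- exact: hcube_cube.
Qed.

Lemma level_indic j k (x : E) i : (level j k x <= i)%N%:R = \1_(hcube j k i) x :> R.
Proof. by rewrite indicE; congr ((_ : bool)%:R); apply/idP/idP; rewrite inE. Qed.

Lemma measurable_level j k i : measurable_fun setT (fun x : E => (level j k x <= i)%N%:R : R).
Proof.
under eq_fun do rewrite level_indic.
by apply/measurable_indicP; exact: measurable_hcube.
Qed.

Lemma integral_level j k i (g : E -> R) :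
  (\int[mu]_x ((level j k x <= i)%N%:R * g x)%:E = \int[mu]_(x in hcube j k i) (g x)%:E)%E.
Proof.
rewrite [RHS]integral_mkcond; apply: eq_integral => x _.
by rewrite level_indic patchE indicE; case: (_ \in _); rewrite ?mul1r ?mul0r.
Qed.

Lemma sum_level_le j (x : E) i (S : seq 'rV[int]_n) : uniq S ->
  \sum_(k <- S) (level j k x <= i)%N%:R <= vol i.
Proof.
by move=> uS; rewrite -natr_sum /vol -natrX ler_nat; exact: level_count.
Qed.

Lemma conj_exp_inv : 1 / conj_exp p = 1 - p^-1.
Proof. by rewrite /conj_exp; field; rewrite !gt_eqF// subr_gt0. Qed.

Variables (h : E -> C) (r K : R).
Hypotheses (hK : forall x, (1 + `|x|) `^ r * cmod (h x) <= K) (mh : cmeasurable h).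

Section upper.
Local Notation e := (n%:R + n%:R / conj_exp p).
Hypothesis er : e < r.

Let e_gt0 : 0 < e.
Proof.
have n0 : 0 < n%:R :> R by rewrite ltr0n.
have := conj_exp_inv; rewrite mul1r => ->.
have : p^-1 < 1 by rewrite invf_lt1.
by move=> h1; rewrite ltr_wpDr// mulr_ge0// subr_ge0 ltW.
Qed.

Let r_gt0 : 0 < r. Proof. exact: lt_trans er. Qed.
Let a i : R := (i.*2.+1)%:R `^ e.
Let a_gt0 i : 0 < a i. Proof. by rewrite powR_gt0. Qed.
Let gap i := envelope_gap h i.
Let gap_ge0 i : 0 <= gap i. Proof. exact: (envelope_gap_ge0 n_gt0 r_gt0 hK). Qed.

Let Ksum : (\sum_(0 <= i <oo) (gap i * a i)%:E)%E = (K_U p h)%:E.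
Proof. by rewrite (decay_sum_fin n_gt0 r_gt0 hK) ?e_gt0. Qed.

Lemma K_U_ge0 : 0 <= K_U p h.
Proof.
by rewrite -lee_fin -Ksum; apply: nneseries_ge0 => i _ _; rewrite lee_fin mulr_ge0// powR_ge0.
Qed.

(** The three factors come from convexity over the layers, overlap of the cubes inside a layer, and
    doubling; the exponent [n + n / p'] is the one making their product 1. *)
Let apV i : a i `^ (- p) * vol i `^ (p - 1) * vol i `^ p = 1.
Proof.
rewrite /vol /a -powR_mulrn// -!powRrM -!powRD ?pnatr_eq0 ?implybT//.
have -> : e * - p + n%:R * (p - 1) + n%:R * p = 0; last by rewrite powRr0.
have := conj_exp_inv; rewrite mul1r => ->.
by field; rewrite gt_eqF.
Qed.

(** Convexity is used twice at each point, over the layers with weights [gap i * a i] of total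
    [K_U], then over the [k] whose cube of radius [i] contains the point. Only then is the result
    integrated, with doubling applied to each cube. *)
Lemma upper_estimate j (S : seq 'rV[int]_n) (c : 'rV[int]_n -> R) (F : E -> C) :
  uniq S -> (forall k, 0 <= c k) -> cmeasurable F ->
  (forall x, cmod (F x) <= \sum_(k <- S) c k * cmod (h ((2 : R) ^ j *: x - lattice R k))) ->
  (\int[mu]_x (cmod (F x) `^ p * `|w x|)%:E <=
   (K_U p h `^ p * A * \sum_(k <- S) c k `^ p * omega j k)%:E)%E.
Proof.
move=> uS c0 mF hF.
have mw := measurable_weight w_Ap.
pose chi (i : nat) (k : 'rV[int]_n) (x : E) : R := (level j k x <= i)%N%:R.
have chi0 i k x : 0 <= chi i k x by [].
(* The factor left on layer [i] by the two convexity steps. *)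
pose coef i := gap i * a i * (a i `^ (- p) * vol i `^ (p - 1)).
have coef0 i : 0 <= coef i by rewrite !mulr_ge0 ?powR_ge0.
pose Sk (i : nat) (x : E) : R := \sum_(k <- S) chi i k x * c k `^ p.
have Sk0 i x : 0 <= Sk i x by apply: sumr_ge0 => k _; rewrite mulr_ge0 ?powR_ge0.
have point x : ((cmod (F x) `^ p)%:E <=
    (K_U p h `^ (p - 1))%:E * \sum_(0 <= i <oo) (coef i * Sk i x)%:E)%E.
  pose T i := \sum_(k <- S) chi i k x * c k.
  have T0 i : 0 <= T i by apply: sumr_ge0 => k _; rewrite mulr_ge0.
  have lay : ((cmod (F x))%:E <= \sum_(0 <= i <oo) (gap i * a i * (T i / a i))%:E)%E.
    apply: (@le_trans _ _ (\sum_(k <- S) \sum_(0 <= i <oo) (c k * (gap i * chi i k x))%:E)%E).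
      apply: (@le_trans _ _ (\sum_(k <- S) (c k * envelope h (level j k x))%:E)%E).
        rewrite sumEFin lee_fin; apply: le_trans (hF x) _; apply: ler_sum => k _.
        rewrite ler_wpM2l//; apply: (envelope_ge r_gt0 hK); exact: level_norm.
      apply: lee_sum => k _; rewrite EFinM.
      under eq_eseriesr do rewrite EFinM.
      rewrite nneseriesZl; last by move=> i _; rewrite lee_fin mulr_ge0.
      by rewrite lee_wpmul2l ?lee_fin//; exact: (envelope_layers n_gt0 r_gt0 hK).
    rewrite -nneseries_sum; last by move=> k i _; rewrite lee_fin !mulr_ge0.
    apply: lee_nneseries => [i _ _|i _].
      by apply: sume_ge0 => k _; rewrite lee_fin !mulr_ge0.
    have -> : gap i * a i * (T i / a i) = gap i * T i by field; rewrite gt_eqF.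
    by rewrite sumEFin lee_fin /T mulr_sumr; apply: ler_sum => k _; rewrite le_eqVlt; apply/orP; left; apply/eqP; ring.
  apply: le_trans (jensen_series p_gt1 _ _ (cmod_ge0 _) _ lay) _.
  - by move=> i; rewrite mulr_ge0// ltW.
  - by move=> i; rewrite divr_ge0// ltW.
  - by rewrite Ksum.
  rewrite lee_wpmul2l ?lee_fin ?powR_ge0//.
  apply: lee_nneseries => [i _ _|i _].
    by rewrite lee_fin !mulr_ge0 ?powR_ge0// ltW.
  rewrite lee_fin /coef -[leRHS]mulrA ler_wpM2l//; first by rewrite mulr_ge0// ltW.
  rewrite powRM ?invr_ge0 ?(ltW (a_gt0 i))//.
  have -> : (a i)^-1 `^ p = a i `^ (- p).
    by rewrite -[X in X `^ p](powR_inv1 (ltW (a_gt0 i))) -powRrM mulN1r.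
  rewrite [leLHS]mulrC -[leRHS]mulrA ler_wpM2l ?powR_ge0//.
  (* The weights of this second step are the indicators themselves, whose total is at most
     [vol i]. *)
  by apply: (jensen_sum p_gt1) => //; exact: sum_level_le.
have mSk i : measurable_fun setT (Sk i).
  apply: measurable_sum => k; apply: measurable_funM => //; exact: measurable_level.
have maw : measurable_fun setT (fun x : E => `|w x|).
  by apply: (@measurableT_comp _ _ _ _ _ _ (@Num.norm R R)) mw; exact: normr_measurable.
have mG i : measurable_fun setT (fun x => (coef i * Sk i x * `|w x|)%:E).
  by apply/measurable_EFinP; apply: measurable_funM => //; exact: measurable_funM.
have G0 i x : (0 <= (coef i * Sk i x * `|w x|)%:E)%E.
  by rewrite lee_fin; apply: mulr_ge0 => //; exact: mulr_ge0.
have Kp0 : 0 <= K_U p h `^ (p - 1) by exact: powR_ge0.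
apply: (@le_trans _ _ (\int[mu]_x ((K_U p h `^ (p - 1))%:E *
    \sum_(0 <= i <oo) (coef i * Sk i x * `|w x|)%:E))%E).
  apply: ge0_le_integral => //.
  - by move=> x _; rewrite lee_fin mulr_ge0// powR_ge0.
  - apply/measurable_EFinP; apply: measurable_funM => //.
    by apply: measurable_fun_powR; exact: cmeasurable_cmod.
  - apply: measurable_funeM; apply: ge0_emeasurable_sum => //.
  - move=> x _; rewrite EFinM.
    apply: le_trans (lee_wpmul2r _ (point x)) _; first by rewrite lee_fin.
    rewrite -muleA lee_wpmul2l ?lee_fin// muleC -nneseriesZl; last first.
      by move=> i _; rewrite lee_fin mulr_ge0.
    apply: lee_nneseries => [i _ _|i _].
      by rewrite -EFinM lee_fin mulr_ge0// mulr_ge0.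
    by rewrite -EFinM mulrC.
rewrite ge0_integralZl//; last 2 first.
- by apply: ge0_emeasurable_sum.
- by move=> x _; apply: nneseries_ge0.
rewrite integral_nneseries//.
set Sig := \sum_(k <- S) _.
have step i : (\int[mu]_x (coef i * Sk i x * `|w x|)%:E <= (A * Sig)%:E * (gap i * a i)%:E)%E.
  under eq_integral do rewrite -mulrA EFinM.
  rewrite (ge0_integralZl_real _ (measurable_funM (mSk i) maw)
    (fun x => mulr_ge0 (Sk0 i x) (normr_ge0 _)) (coef0 i)).
  apply: (@le_trans _ _ ((coef i)%:E * (\sum_(k <- S) (c k `^ p * (A * vol i `^ p * omega j k))%:E))%E).
    rewrite lee_wpmul2l ?lee_fin//.
    have -> : (\int[mu]_x (Sk i x * `|w x|)%:E =
       \int[mu]_x \sum_(k <- S) ((c k `^ p)%:E * (chi i k x * `|w x|)%:E))%E.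
      apply: eq_integral => x _; rewrite /Sk mulr_suml -sumEFin; apply: eq_bigr => k _.
      by rewrite -EFinM; congr EFin; ring.
    rewrite ge0_integral_sum//; last 2 first.
    - move=> k; apply: measurable_funeM; apply/measurable_EFinP.
      by apply: measurable_funM => //; exact: measurable_level.
    - by move=> k x _; rewrite -EFinM lee_fin !mulr_ge0 ?powR_ge0.
    apply: lee_sum => k _.
    rewrite (ge0_integralZl_real _ (measurable_funM (measurable_level j k i) maw)
      (fun x => mulr_ge0 (chi0 i k x) (normr_ge0 _)) (powR_ge0 _ _)).
    rewrite EFinM lee_wpmul2l ?lee_fin ?powR_ge0// integral_level.
    exact: wmass_hcube_le.
  rewrite sumEFin -!EFinM lee_fin /Sig mulr_sumr mulr_sumr mulr_suml.
  apply: ler_sum => k _; rewrite le_eqVlt; apply/orP; left; apply/eqP.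
  transitivity (A * (c k `^ p * omega j k) * (gap i * a i) *
    (a i `^ (- p) * vol i `^ (p - 1) * vol i `^ p)); last by rewrite apV mulr1.
  by rewrite /coef; ring.
have Sig0 : 0 <= Sig.
  by apply: sumr_ge0 => k _; rewrite mulr_ge0 ?powR_ge0// ltW// omega_gt0.
apply: (@le_trans _ _ ((K_U p h `^ (p - 1))%:E * ((A * Sig)%:E * (K_U p h)%:E))%E).
  rewrite lee_wpmul2l ?lee_fin// -Ksum -nneseriesZl; last first.
    by move=> i _; rewrite lee_fin mulr_ge0// ltW.
  by apply: lee_nneseries => [i _ _|i _]; [exact: integral_ge0|exact: step].
rewrite -!EFinM lee_fin -(mulr_powRB1 K_U_ge0 p_gt0).
by rewrite le_eqVlt; apply/orP; left; apply/eqP; ring.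
Qed.

End upper.

End lattice_estimates.

(** * Dual bound: wavelet coefficients controlled by the weighted norm *)

Section lower_estimate.
Context (R : realType) (n : nat).
Hypothesis n_gt0 : (0 < n)%N.
Local Notation E := 'rV[R]_n.
Local Notation C := R[i].
Local Notation mu := (lebesgue_rV R n).
Variables (p : R) (w : E -> R).
Hypotheses (p_gt1 : 1 < p) (w_Ap : in_Ap p w).
Local Notation A := (fine (Ap_const p w)).

Let p_gt0 : 0 < p. Proof. by rewrite (lt_trans _ p_gt1). Qed.
Let A_ge0 : 0 <= A. Proof. exact: le_trans ler01 (Ap_ge1 p_gt1 w_Ap). Qed.

Variables (h : E -> C) (r K : R).
Hypotheses (hK : forall x, (1 + `|x|) `^ r * cmod (h x) <= K) (ih : cintegrable h).

Local Notation e := (n%:R + n%:R / p).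
Hypothesis er : e < r.

Let e_gt0 : 0 < e.
Proof.
have n0 : 0 < n%:R :> R by rewrite ltr0n.
by rewrite addr_gt0// divr_gt0.
Qed.

Let r_gt0 : 0 < r. Proof. exact: lt_trans er. Qed.
Let a i : R := (i.*2.+1)%:R `^ e.
Let a_gt0 i : 0 < a i. Proof. by rewrite powR_gt0. Qed.
Let gap i := envelope_gap h i.
Let gap_ge0 i : 0 <= gap i. Proof. exact: (envelope_gap_ge0 n_gt0 r_gt0 hK). Qed.

Let Ksum : (\sum_(0 <= i <oo) (gap i * a i)%:E)%E = (K_L p h)%:E.
Proof. by rewrite (decay_sum_fin n_gt0 r_gt0 hK) ?e_gt0. Qed.

Lemma K_L_ge0 : 0 <= K_L p h.
Proof.
by rewrite -lee_fin -Ksum; apply: nneseries_ge0 => i _ _; rewrite lee_fin mulr_ge0// powR_ge0.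
Qed.

(** Here the factors come from convexity over the layers, A_p on the enlarged cube and overlap. The
    overlap is paid to the first power only, so the exponent is [n + n / p]. *)
Let apV i : a i `^ (- p) * vol R n i `^ p * vol R n i = 1.
Proof.
rewrite -[X in _ * X]powRr1 ?ltW ?vol_gt0// /vol /a -powR_mulrn// -!powRrM -!powRD ?pnatr_eq0 ?implybT//.
have -> : e * - p + n%:R * p + n%:R * 1 = 0; last by rewrite powRr0.
by field; rewrite gt_eqF.
Qed.

Variables (j : int) (g : E -> C) (B : R).
Hypotheses (ig : cintegrable g) (gB : forall x, cmod (g x) <= B).

Let mg : cmeasurable g. Proof. exact: cintegrable_measurable. Qed.

Let mcg : measurable_fun setT (fun x => cmod (g x)).
Proof. exact: cmeasurable_cmod. Qed.

Let mH k i : measurable (hcube j k i : set E).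
Proof. exact: measurable_hcube. Qed.

Let T k i : R := fine (\int[mu]_(x in hcube j k i) (cmod (g x))%:E)%E.

Let TE k i : (\int[mu]_(x in hcube j k i) (cmod (g x))%:E)%E = (T k i)%:E.
Proof.
rewrite fineK// ge0_fin_numE; last by apply: integral_ge0 => x _; rewrite lee_fin cmod_ge0.
apply: le_lt_trans (cintegrable_cmod_lty ig).
apply: ge0_subset_integral => //; first exact/measurable_EFinP.
by move=> x _; rewrite lee_fin cmod_ge0.
Qed.

Let T_ge0 k i : 0 <= T k i.
Proof. by rewrite fine_ge0//; apply: integral_ge0 => x _; rewrite lee_fin cmod_ge0. Qed.

(** The factor [2 ^ (j n / 2)] removes the normalization of the wavelets: together with the one
    inside the pairing it becomes [2 ^ (j n)], the inverse volume of a cell. *)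
Let X k : R := cmod (cpair g (wav h j k)) * 2 `^ (j%:~R * n%:R / 2).

Let pow_half : 2 `^ (j%:~R * n%:R / 2) * 2 `^ (j%:~R * n%:R / 2) = ((2 : R) ^ j) ^+ n.
Proof.
rewrite -powRD ?pnatr_eq0 ?implybT// -splitr powRrM.
by rewrite powR_mulrn ?powR_ge0// powR_intmul.
Qed.

(** The envelope of [h] is cut into layers under the integral sign, which bounds the coefficient by
    integrals of [|g|] over the cubes [hcube j k i]; dividing by [a i] prepares the weights for
    convexity. *)
Let cpair_series k : ((X k)%:E <=
  \sum_(0 <= i <oo) (gap i * a i * (((2 : R) ^ j) ^+ n * T k i / a i))%:E)%E.
Proof.
pose b : R := 2 `^ (j%:~R * n%:R / 2).
have b0 : 0 <= b by exact: powR_ge0.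
have iw : cintegrable (fun y => g y * (wav h j k y)^*%C).
  under eq_fun do rewrite mulrC.
  apply: (@cintegrableMb _ _ _ _ B) => //.
  have [i1 i2] := cintegrable_wav j k ih.
  split; first by apply: eq_integrable i1 => // x _; case: (wav h j k x).
  apply: eq_integrable (integrableN i2) => // x _ /=.
  by case: (wav h j k x).
have m1 : measurable_fun setT (fun y => cmod (g y * (wav h j k y)^*%C)).
  by apply: cmeasurable_cmod; exact: cintegrable_measurable.
have gapchi0 i y : 0 <= gap i * (level j k y <= i)%N%:R * cmod (g y).
  by rewrite !mulr_ge0 ?cmod_ge0.
have mgc i : measurable_fun setT (fun y => (gap i * (level j k y <= i)%N%:R * cmod (g y))%:E).
  apply/measurable_EFinP; apply: measurable_funM => //; apply: measurable_funM => //.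
  exact: measurable_level.
apply: (@le_trans _ _ (b%:E * \int[mu]_y (cmod (g y * (wav h j k y)^*%C))%:E)%E).
  rewrite /X -/b mulrC EFinM lee_wpmul2l ?lee_fin//.
  have := ler_cmod_cintegral iw; rewrite -lee_fin /Rintegral fineK//.
  exact: (integrable_fin_num measurableT (cintegrable_cmod iw)).
apply: (@le_trans _ _ (b%:E * (b%:E * \int[mu]_y
    \sum_(0 <= i <oo) (gap i * (level j k y <= i)%N%:R * cmod (g y))%:E))%E).
  have mS : measurable_fun setT (fun y =>
      \sum_(0 <= i <oo) (gap i * (level j k y <= i)%N%:R * cmod (g y))%:E)%E.
    by apply: ge0_emeasurable_sum => // i y _ _; rewrite lee_fin.
  have S0 y : (0 <= \sum_(0 <= i <oo) (gap i * (level j k y <= i)%N%:R * cmod (g y))%:E)%E.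
    by apply: nneseries_ge0 => i _ _; rewrite lee_fin.
  rewrite lee_wpmul2l ?lee_fin//.
  rewrite -(@ge0_integralZl _ _ _ mu setT measurableT _ mS b%:E (fun x _ => S0 x)) ?lee_fin//.
  apply: ge0_le_integral => //.
  - by move=> y _; rewrite lee_fin cmod_ge0.
  - exact/measurable_EFinP.
  - by apply: measurable_funeM; exact: mS.
  move=> y _; rewrite cmodM cmod_conj cmod_wav -/b.
  have -> : cmod (g y) * (b * cmod (h ((2 : R) ^ j *: y - lattice R k))) =
     b * (cmod (g y) * cmod (h ((2 : R) ^ j *: y - lattice R k))) by ring.
  rewrite EFinM lee_wpmul2l ?lee_fin//.
  apply: (@le_trans _ _ ((cmod (g y))%:E * (envelope h (level j k y))%:E)%E).
    rewrite -EFinM lee_fin ler_wpM2l ?cmod_ge0//.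
    by apply: (envelope_ge r_gt0 hK); exact: level_norm.
  apply: (@le_trans _ _ ((cmod (g y))%:E * \sum_(0 <= i <oo) (gap i * (level j k y <= i)%N%:R)%:E)%E).
    by rewrite lee_wpmul2l ?lee_fin ?cmod_ge0//; exact: (envelope_layers n_gt0 r_gt0 hK).
  rewrite -nneseriesZl; last by move=> i _; rewrite lee_fin mulr_ge0.
  apply: lee_nneseries => [i _ _|i _].
    by rewrite -EFinM lee_fin mulr_ge0 ?cmod_ge0// mulr_ge0.
  by rewrite -EFinM mulrC.
rewrite muleA -EFinM /b pow_half integral_nneseries//; last by move=> i y _; rewrite lee_fin.
rewrite -nneseriesZl; last by move=> i _; apply: integral_ge0 => y _; rewrite lee_fin.
apply: lee_nneseries => [i _ _|i _].
  by rewrite mule_ge0 ?lee_fin ?exprn_ge0 ?(ltW (exp2z_gt0 _ _))//; apply: integral_ge0 => y _; rewrite lee_fin.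
have -> : gap i * a i * (((2 : R) ^ j) ^+ n * T k i / a i) =
   ((2 : R) ^ j) ^+ n * (gap i * T k i) by field; rewrite gt_eqF.
rewrite [leRHS]EFinM lee_wpmul2l ?lee_fin ?exprn_ge0 ?(ltW (exp2z_gt0 _ _))//.
have -> : (\int[mu]_y (gap i * (level j k y <= i)%N%:R * cmod (g y))%:E =
   \int[mu]_y ((gap i)%:E * ((level j k y <= i)%N%:R * cmod (g y))%:E))%E.
  by apply: eq_integral => y _; rewrite -EFinM mulrA.
rewrite ge0_integralZl_real//; last 2 first.
- by apply: measurable_funM => //; exact: measurable_level.
- by move=> x; rewrite mulr_ge0 ?cmod_ge0.
by rewrite integral_level TE -EFinM.
Qed.

Let GG := (\int[mu]_x (cmod (g x) `^ p * `|w x|)%:E)%E.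

Let G k i := (\int[mu]_(x in hcube j k i) (cmod (g x) `^ p * `|w x|)%:E)%E.

Let mgw : measurable_fun setT (fun x => cmod (g x) `^ p * `|w x|).
Proof.
apply: measurable_funM; first exact: measurable_fun_powR.
apply: (@measurableT_comp _ _ _ _ _ _ (@Num.norm R R)) (measurable_weight w_Ap).
exact: normr_measurable.
Qed.

Let gw_ge0 x : 0 <= cmod (g x) `^ p * `|w x|.
Proof. by rewrite mulr_ge0 ?powR_ge0. Qed.

Let sum_G i (S : seq 'rV[int]_n) : uniq S ->
  (\sum_(k <- S) G k i <= (vol R n i)%:E * GG)%E.
Proof.
move=> uS; rewrite /G.
rewrite (eq_bigr (fun k => \int[mu]_x ((level j k x <= i)%N%:R * (cmod (g x) `^ p * `|w x|))%:E))%E;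
  last by move=> k _; rewrite integral_level.
rewrite -ge0_integral_sum//; last 2 first.
- move=> k; apply/measurable_EFinP; apply: measurable_funM => //; exact: measurable_level.
- by move=> k x _; rewrite lee_fin mulr_ge0.
rewrite -ge0_integralZl_real//; last by rewrite ltW// vol_gt0.
apply: ge0_le_integral => //.
- by move=> x _; apply: sume_ge0 => k _; rewrite lee_fin mulr_ge0.
- apply: emeasurable_sum => k; apply/measurable_EFinP; apply: measurable_funM => //.
  exact: measurable_level.
- by apply: measurable_funeM; exact/measurable_EFinP.
- move=> x _; rewrite sumEFin -EFinM lee_fin -mulr_suml ler_wpM2r//.
  exact: sum_level_le.
Qed.

(** [Ap_holder] on the cube of radius [i], whose mass is at least that of the dyadic cube inside it;
    the factor [2 ^ (j n)] cancels the volume of a cell. *)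
Let T_omega k i : (((((2 : R) ^ j) ^+ n * T k i) `^ p * omega w j k)%:E <=
  (A * vol R n i `^ p)%:E * G k i)%E.
Proof.
have j0 := exp2z_gt0 R (- j); have jp := exp2z_gt0 R j.
have l0 : 0 < (2 : R) ^ (- j) * (i.*2.+1)%:R by rewrite mulr_gt0.
have := Ap_holder p_gt1 w_Ap l0 (mH k i) (@hcube_cube R n j k i) mcg (fun x => cmod_ge0 _).
rewrite TE poweR_EFin exprMn powRM ?exprn_ge0 ?(ltW j0)// -/(vol R n i) -/(G k i) => hh.
set P := (((2 : R) ^ j) ^+ n) `^ p.
have P0 : 0 <= P by exact: powR_ge0.
have PP : P * (((2 : R) ^ (- j)) ^+ n) `^ p = 1.
  by rewrite /P -powRM ?exprn_ge0 ?ltW// -exprMn -expfzDr// subrr expr0z expr1n powR1.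
apply: (@le_trans _ _ (P%:E * ((T k i `^ p)%:E * wmass w (cube (corner R j k i) ((2 : R) ^ (- j) * (i.*2.+1)%:R))))%E).
  rewrite powRM ?exprn_ge0 ?(ltW jp)// -/P -mulrA !EFinM lee_wpmul2l ?lee_fin//.
  rewrite lee_wpmul2l ?lee_fin ?powR_ge0// -(wmass_dyadicE w_Ap).
  apply: (le_wmass w_Ap).
  - by rewrite dyadic_hcube; exact: measurable_hcube.
  - exact: measurable_cube.
  - by rewrite dyadic_hcube => x Dx; apply: hcube_cube; apply: (@hcubeS _ _ _ _ 0).
apply: le_trans (lee_wpmul2l _ hh) _; first by rewrite lee_fin.
rewrite muleA -EFinM.
have -> : P * (A * ((((2 : R) ^ (- j)) ^+ n) `^ p * vol R n i `^ p)) = A * vol R n i `^ p.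
  by rewrite mulrCA [P * (_ * _)]mulrA PP mul1r.
by [].
Qed.

(** Convexity over the layers for each [k], then [T_omega], and only at the end the sum over [k], in
    which each point is counted at most [vol i] times. *)
Lemma lower_estimate (S : seq 'rV[int]_n) : uniq S -> (GG < +oo)%E ->
  ((\sum_(k <- S) X k `^ p * omega w j k)%:E <= (K_L p h `^ p * A)%:E * GG)%E.
Proof.
move=> uS GGoo.
have Kp0 : 0 <= K_L p h `^ (p - 1) by exact: powR_ge0.
have om0 k : 0 <= omega w j k by exact: ltW (omega_gt0 w_Ap j k).
have GG0 : (0 <= GG)%E by apply: integral_ge0 => x _; rewrite lee_fin.
pose t k i := ((2 : R) ^ j) ^+ n * T k i / a i.
have jn0 : 0 <= ((2 : R) ^ j) ^+ n by rewrite exprn_ge0// ltW// exp2z_gt0.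
have t0 k i : 0 <= t k i by rewrite divr_ge0 ?mulr_ge0// ltW.
have l0 i : 0 <= gap i * a i by rewrite mulr_ge0// ltW.
have Xb k : ((X k `^ p)%:E <= (K_L p h `^ (p - 1))%:E *
    \sum_(0 <= i <oo) (gap i * a i * t k i `^ p)%:E)%E.
  apply: (jensen_series p_gt1 l0 (t0 k) _ _ (cpair_series k)).
    by rewrite mulr_ge0 ?cmod_ge0 ?powR_ge0.
  by rewrite Ksum.
rewrite -sumEFin.
apply: (@le_trans _ _ (\sum_(k <- S) ((K_L p h `^ (p - 1))%:E *
    \sum_(0 <= i <oo) (gap i * a i * t k i `^ p * omega w j k)%:E))%E).
  apply: lee_sum => k _; rewrite EFinM.
  apply: le_trans (lee_wpmul2r _ (Xb k)) _; first by rewrite lee_fin.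
  rewrite -muleA lee_wpmul2l ?lee_fin// muleC -nneseriesZl; last first.
    by move=> i _; rewrite lee_fin mulr_ge0 ?powR_ge0.
  apply: lee_nneseries => [i _ _|i _].
    by rewrite -EFinM lee_fin mulr_ge0// mulr_ge0 ?powR_ge0.
  by rewrite -EFinM mulrC.
rewrite -ge0_sume_distrr; last first.
  by move=> k _; apply: nneseries_ge0 => i _ _; rewrite lee_fin !mulr_ge0 ?powR_ge0// ltW.
rewrite -nneseries_sum; last first.
  by move=> k i _; rewrite lee_fin !mulr_ge0 ?powR_ge0// ltW.
apply: (@le_trans _ _ ((K_L p h `^ (p - 1))%:E * ((A%:E * GG) * (K_L p h)%:E))%E); last first.
  rewrite (muleC (A%:E * GG)%E) !muleA -!EFinM.
  by rewrite [K_L p h `^ (p - 1) * K_L p h]mulrC mulr_powRB1 ?K_L_ge0.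
have /fineK GGE : GG \is a fin_num by rewrite ge0_fin_numE.
rewrite lee_wpmul2l ?lee_fin// -Ksum -GGE -EFinM -nneseriesZl; last first.
  by move=> i _; rewrite lee_fin.
apply: lee_nneseries => [i _ _|i _].
  by apply: sume_ge0 => k _; rewrite lee_fin !mulr_ge0 ?powR_ge0// ltW.
have tk k : t k i `^ p = (((2 : R) ^ j) ^+ n * T k i) `^ p * a i `^ (- p).
  rewrite powRM ?mulr_ge0 ?invr_ge0 ?(ltW (a_gt0 i))//; congr (_ * _).
  by rewrite -[X in X `^ p](powR_inv1 (ltW (a_gt0 i))) -powRrM mulN1r.
apply: (@le_trans _ _ (\sum_(k <- S) ((gap i * a i * a i `^ (- p) * (A * vol R n i `^ p))%:E * G k i))%E).
  apply: lee_sum => k _; rewrite tk.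
  have -> : gap i * a i * ((((2 : R) ^ j) ^+ n * T k i) `^ p * a i `^ (- p)) * omega w j k =
    gap i * a i * a i `^ (- p) * ((((2 : R) ^ j) ^+ n * T k i) `^ p * omega w j k) by ring.
  rewrite EFinM [X in (_ <= X * _)%E]EFinM -muleA.
  apply: lee_wpmul2l; first by rewrite lee_fin mulr_ge0 ?powR_ge0.
  exact: T_omega.
rewrite -ge0_sume_distrr; last by move=> k _; apply: integral_ge0 => x _; rewrite lee_fin.
apply: le_trans (lee_wpmul2l _ (sum_G i uS)) _.
  by rewrite lee_fin !mulr_ge0 ?powR_ge0// ltW.
rewrite -GGE -!EFinM lee_fin le_eqVlt; apply/orP; left; apply/eqP.
transitivity (A * fine GG * (gap i * a i) * (a i `^ (- p) * vol R n i `^ p * vol R n i)).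
  by ring.
by rewrite apV mulr1.
Qed.

End lower_estimate.

(** * The extremal function *)

Section localization.
Context (R : realType) (n : nat).
Local Notation E := 'rV[R]_n.
Local Notation C := R[i].
Local Notation mu := (lebesgue_rV R n).

Lemma dilate_decays r (phi : E -> C) j : 0 <= r -> decays r phi -> decays r (dilate phi j).
Proof.
move=> r0 [K hK]; have jp := exp2z_gt0 R j; have jm := exp2z_gt0 R (- j).
exists ((1 + (2 : R) ^ (- j)) `^ r * (2 : R) ^ (j * n%:Z) * K) => x.
rewrite cmodM cmod_real gtr0_norm ?exp2z_gt0//.
have h : (1 + `|x|) `^ r <= (1 + (2 : R) ^ (- j)) `^ r * (1 + `|(2 : R) ^ j *: x|) `^ r.
  rewrite -powRM ?addr_ge0 ?(ltW jm)//.
  rewrite ge0_ler_powR ?nnegrE ?addr_ge0 ?mulr_ge0 ?addr_ge0 ?(ltW jm)//.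
  rewrite normrZ (gtr0_norm jp).
  have e : (2 : R) ^ (- j) * ((2 : R) ^ j * `|x|) = `|x|.
    by rewrite mulrA -expfzDr// addrC subrr expr0z mul1r.
  rewrite mulrDl mul1r mulrDr mulr1 e.
  have : 0 <= (2 : R) ^ j * `|x| by rewrite mulr_ge0// ltW.
  lra.
apply: (le_trans (ler_wpM2r _ h)); first by rewrite mulr_ge0 ?cmod_ge0// ltW// exp2z_gt0.
rewrite [leLHS](_ : _ = (1 + (2 : R) ^ (- j)) `^ r * (2 : R) ^ (j * n%:Z) *
  ((1 + `|(2 : R) ^ j *: x|) `^ r * cmod (phi ((2 : R) ^ j *: x)))); last by ring.
by rewrite ler_wpM2l// mulr_ge0 ?powR_ge0// ltW// exp2z_gt0.
Qed.

Lemma decays_sum r I (s : seq I) (F : I -> E -> C) : (forall i, decays r (F i)) ->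
  decays r (fun x => \sum_(i <- s) F i x).
Proof.
move=> hF; elim: s => [|i s [K hK]].
  by exists 0 => x; rewrite big_nil cmod0 mulr0.
have [L hL] := hF i; exists (L + K) => x.
rewrite big_cons (le_trans (ler_wpM2l _ (ler_cmodD _ _))) ?powR_ge0//.
by rewrite mulrDr lerD.
Qed.

Lemma Lpw_normE p (w : E -> R) (g : E -> C) : in_Ap p w -> cmeasurable g ->
  Lpw_norm p w g = ((\int[mu]_x (cmod (g x) `^ p * `|w x|)%:E) `^ p^-1)%E.
Proof.
move=> wAp mg; congr (_ `^ _)%E.
have mw := measurable_weight wAp.
have mgp : measurable_fun setT (fun x => cmod (g x) `^ p).
  by apply: measurable_fun_powR; exact: cmeasurable_cmod.
apply: ae_eq_integral => //.
- by apply/measurable_EFinP; exact: measurable_funM.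
- apply/measurable_EFinP; apply: measurable_funM => //.
  apply: (@measurableT_comp _ _ _ _ _ _ (@Num.norm R R)) mw; exact: normr_measurable.
by apply: filterS (weight_ae_gt0 wAp) => x w0 _; rewrite gtr0_norm.
Qed.

Lemma Lpw_norm_le p (w : E -> R) (g : E -> C) (B : R) : 0 < p -> in_Ap p w ->
  cmeasurable g -> 0 <= B ->
  (\int[mu]_x (cmod (g x) `^ p * `|w x|)%:E <= (B `^ p)%:E)%E ->
  (Lpw_norm p w g <= B%:E)%E.
Proof.
move=> p0 wAp mg B0 h; rewrite Lpw_normE//.
have -> : B%:E = ((B `^ p)%:E `^ p^-1)%E.
  by rewrite poweR_EFin -powRrM divff ?gt_eqF// powRr1.
apply: lee_poweR => //; first by rewrite invr_ge0 ltW.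
by apply: integral_ge0 => x _; rewrite lee_fin mulr_ge0 ?powR_ge0.
Qed.

Lemma tempered_distr_of (f : E -> C) : cintegrable f -> tempered (distr_of f).
Proof.
move=> fi.
have fg g : schwartz g -> cintegrable (fun x => f x * g x).
  move=> gS; have [K hK] := @decays_bounded _ _ 0 g (lexx _) (schwartz_decays _ gS).
  apply: (@cintegrableMb _ _ _ _ K) => //.
  exact/ccontinuous_measurable/schwartz_continuous.
split.
  move=> c g h gS hS; rewrite /distr_of.
  transitivity (cintegral (fun x => c * (f x * g x) + f x * h x)).
    by apply: eq_cintegral => x; ring.
  have gi := fg g gS; have hi := fg h hS.
  by rewrite cintegralD ?cintegralZl//; exact: cintegrableZl.
(* The supremum seminorm alone suffices, with the [L^1] norm of [f] as constant. *)
exists 0%N, (\int[mu]_x cmod (f x)) => g B gS hB.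
have gB x : cmod (g x) <= B.
  have := hB [::] x (leqnn _); rewrite expr0 mul1r.
  by rewrite (_ : cpderiv [::] g x = g x)// /cpderiv /=; case: (g x).
rewrite (le_trans (ler_cmod_cintegral (fg g gS)))// mulrC.
have fc := cintegrable_cmod fi.
rewrite -[leRHS]RintegralZl//; apply: le_Rintegral => //.
- exact: cintegrable_cmod (fg g gS).
- exact: (integrableZl measurableT B fc).
- by move=> x _; rewrite cmodM mulrC ler_wpM2r// cmod_ge0.
Qed.

(** The points of [{0, ..., 2 ^ j - 1} ^ n], listed through a finite type so that their number is a
    cardinality computation. *)
Definition unit_lattice (j : nat) : seq 'rV[int]_n :=
  [seq map_mx (fun i : 'I_(2 ^ j) => (i : nat)%:Z) v | v <- enum {: 'rV['I_(2 ^ j)]_n}].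

Lemma unit_lattice_uniq j : uniq (unit_lattice j).
Proof.
rewrite map_inj_uniq ?enum_uniq// => u v uv; apply/rowP => l.
have := congr1 (fun M : 'rV[int]_n => M ord0 l) uv; rewrite !mxE => -[h].
exact: val_inj.
Qed.

Lemma size_unit_lattice j : size (unit_lattice j) = ((2 ^ j) ^ n)%N.
Proof. by rewrite size_map -cardE card_mx card_ord mul1n. Qed.

Lemma mem_unit_lattice (j : nat) (k : 'rV[int]_n) :
  (k \in unit_lattice j) <-> (dyadic j%:Z k `<=` @unit_cube R n).
Proof.
have jp : 0 < (2 : R) ^ (j%:Z) by exact: exp2z_gt0.
have jm : 0 < (2 : R) ^ (- j%:Z) by exact: exp2z_gt0.
have jj : (2 : R) ^ (- j%:Z) * (2 : R) ^ (j%:Z) = 1 by rewrite -expfzDr// addrC subrr expr0z.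
have jn : (2 : R) ^ (j%:Z) = ((2 ^ j)%N%:Z)%:~R by rewrite -exprnP -natrX.
have lt1 (z : int) : (2 : R) ^ (- j%:Z) * (z%:~R + 1) <= 1 <-> z < (2 ^ j)%N%:Z.
  by rewrite -[X in _ <= X]jj ler_pM2l// jn -intrD1 ler_int lezD1.
split.
  move=> /mapP[v _ ->] x hx l; have /andP[h1 h2] := hx l.
  apply/andP; split; first by apply: le_trans h1; rewrite mxE mulr_ge0 ?(ltW jm).
  by apply: (lt_le_trans h2); apply/lt1; rewrite mxE ltz_nat.
move=> hsub.
have cx (t : R) : 0 <= t < 1 -> @unit_cube R n
    (\row_l ((2 : R) ^ (- j%:Z) * ((k ord0 l)%:~R + t))).
  by move=> /andP[t0 t1]; apply: hsub => i; rewrite mxE ler_pM2l// ltr_pM2l// lerDl t0 ltrD2l.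
(* The lower corner of the cube gives both bounds: it lies in the half-open unit cube and [k] is
   integral. *)
have kb l : 0 <= k ord0 l < (2 ^ j)%N%:Z.
  have := cx 0; rewrite lexx ltr01 => /(_ isT l); rewrite mxE addr0 => /andP[h0 h1].
  move: h0; rewrite pmulr_rge0// ler0z => -> /=.
  by move: h1; rewrite -[ltRHS]jj ltr_pM2l// jn ltr_int.
have kl l : (absz (k ord0 l) < 2 ^ j)%N by have := kb l; lia.
apply/mapP; exists (\row_l Ordinal (kl l)); first by rewrite mem_enum.
by apply/rowP => l; rewrite !mxE /= gez0_abs//; have /andP[] := kb l.
Qed.

(** Dividing by the Besov weights leaves [2 ^ (- i s)], whereas [C_M] sums [2 ^ (i s)]; the symmetry
    of the band reconciles them. *)
Lemma band_sumN (M : nat) (F : int -> R) :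
  \sum_(i <- band M) F (- i) = \sum_(i <- band M) F i.
Proof.
rewrite -(big_map -%R xpredT F); apply: perm_big; apply: uniq_perm.
- by rewrite map_inj_uniq ?band_uniq//; exact: oppr_inj.
- exact: band_uniq.
- move=> i; rewrite -[i in LHS]opprK mem_map; last exact: oppr_inj.
  by rewrite !mem_band normrN.
Qed.

End localization.

Section extremal.
Context (R : realType) (n : nat).
Hypothesis n_gt0 : (0 < n)%N.
Local Notation E := 'rV[R]_n.
Local Notation C := R[i].
Local Notation mu := (lebesgue_rV R n).
Variables (p : R) (w : E -> R).
Hypotheses (p_gt1 : 1 < p) (w_Ap : in_Ap p w).
Local Notation A := (fine (Ap_const p w)).

Let p_gt0 : 0 < p. Proof. by rewrite (lt_trans _ p_gt1). Qed.
Let A_ge0 : 0 <= A. Proof. exact: le_trans ler01 (Ap_ge1 p_gt1 w_Ap). Qed.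

(* Up to the factor 2 ^ (- j n / 2) of the wavelets, the coefficient w(Q_{j,k}) ^ (-1/p). *)
Definition flat_coef (j : int) (k : 'rV[int]_n) : R :=
  2 `^ (- (j%:~R * n%:R / 2)) * omega w j k `^ (- p^-1).

Definition flat_comb (h : E -> C) (j : int) (S : seq 'rV[int]_n) (x : E) : C :=
  \sum_(k <- S) (flat_coef j k)%:C%C * wav h j k x.

Lemma flat_coef_ge0 j k : 0 <= flat_coef j k.
Proof. by rewrite mulr_ge0 ?powR_ge0. Qed.

Lemma flat_coefK j k : flat_coef j k * 2 `^ (j%:~R * n%:R / 2) = omega w j k `^ (- p^-1).
Proof.
rewrite /flat_coef mulrAC -powRD ?pnatr_eq0 ?implybT//.
by rewrite addNr powRr0 mul1r.
Qed.

(** Each term of a flat sum counts as 1 in both estimates, so these depend on the index set only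
    through its size. *)
Lemma omega_powK j k : (omega w j k `^ (- p^-1)) `^ p * omega w j k = 1.
Proof.
have o0 := omega_gt0 w_Ap j k.
by rewrite -powRrM mulNr mulVf ?gt_eqF// powR_inv1 ?ltW// mulVf// gt_eqF.
Qed.

Lemma cmeasurable_flat_comb h j S : cmeasurable h -> cmeasurable (flat_comb h j S).
Proof.
move=> mh; apply: cmeasurable_sum => k _.
by apply: cmeasurableM; [exact: cmeasurable_cst|exact: cmeasurable_wav].
Qed.

Lemma cintegrable_flat_comb h j S : cintegrable h -> cintegrable (flat_comb h j S).
Proof.
by move=> ih; apply: cintegrable_sum => k _; apply: cintegrableZl; exact: cintegrable_wav.
Qed.

Lemma flat_comb_bound h j S : (exists K, forall x, cmod (h x) <= K) ->
  exists K, forall x, cmod (flat_comb h j S x) <= K.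
Proof.
move=> [K hK].
exists (\sum_(k <- S) flat_coef j k * (2 `^ (j%:~R * n%:R / 2) * K)) => x.
apply: le_trans (cmod_sum _ _ _) _; apply: ler_sum => k _.
by rewrite cmodM cmod_real ger0_norm ?flat_coef_ge0// ler_wpM2l ?flat_coef_ge0// wav_bound.
Qed.

Lemma flat_comb_le (h : E -> C) r j S : decays r h -> n%:R + n%:R / conj_exp p < r ->
  cmeasurable h -> uniq S ->
  (Lpw_norm p w (flat_comb h j S) <=
    (K_U p h * (A `^ p^-1 * (size S)%:R `^ p^-1))%:E)%E.
Proof.
move=> [K hK] er mh uS.
have K0 := K_U_ge0 n_gt0 p_gt1 hK er.
apply: Lpw_norm_le => //.
- exact: cmeasurable_flat_comb.
- by rewrite !mulr_ge0 ?powR_ge0.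
apply: le_trans (upper_estimate n_gt0 p_gt1 w_Ap hK er (j := j)
  (c := fun k => omega w j k `^ (- p^-1)) uS _ (cmeasurable_flat_comb _ _ mh) _) _.
- by move=> k; exact: powR_ge0.
- move=> x; apply: le_trans (cmod_sum _ _ _) _; apply: ler_sum => k _.
  by rewrite cmodM cmod_real ger0_norm ?flat_coef_ge0// cmod_wav mulrA flat_coefK.
rewrite lee_fin (eq_bigr (fun=> 1)); last by move=> k _; exact: omega_powK.
rewrite big_const_seq count_predT iter_addr addr0 !powRM ?mulr_ge0 ?powR_ge0//.
by rewrite -!powRrM mulVf ?gt_eqF// !powRr1// mulrA.
Qed.

(** Nothing is assumed about the coefficients of [g] outside [S]; this freedom allows [g] to be the
    remainder of an arbitrary N-term approximant. *)
Lemma flat_comb_ge (h g : E -> C) r j S : decays r h -> n%:R + n%:R / p < r ->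
  cintegrable h -> cintegrable g -> (exists B, forall x, cmod (g x) <= B) -> uniq S ->
  (forall k, k \in S -> cpair g (wav h j k) = (flat_coef j k)%:C%C) ->
  (Lpw_norm p w g < +oo)%E ->
  (((size S)%:R `^ p^-1)%:E <= (K_L p h * A `^ p^-1)%:E * Lpw_norm p w g)%E.
Proof.
move=> [K hK] er ih ig [B gB] uS pairE.
have K0 := K_L_ge0 n_gt0 p_gt1 hK er.
have mg := cintegrable_measurable ig.
rewrite Lpw_normE// => goo.
have GG0 : (0 <= \int[mu]_x (cmod (g x) `^ p * `|w x|)%:E)%E.
  by apply: integral_ge0 => x _; rewrite lee_fin mulr_ge0 ?powR_ge0.
have GGoo : (\int[mu]_x (cmod (g x) `^ p * `|w x|)%:E < +oo)%E.
  by apply: lty_poweRy goo; rewrite invr_eq0 gt_eqF.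
have := lower_estimate n_gt0 p_gt1 w_Ap hK ih er j ig gB uS GGoo.
rewrite (eq_big_seq (fun=> 1)); last first.
  move=> k kS; rewrite pairE// cmod_real ger0_norm ?flat_coef_ge0// flat_coefK.
  exact: omega_powK.
rewrite big_const_seq count_predT iter_addr addr0 => /(lee_poweR (r := p^-1)).
rewrite poweR_EFin => /(_ _ _)/le_trans; apply.
- by rewrite invr_ge0 ltW.
- by rewrite lee_fin.
rewrite poweRM ?lee_fin ?mulr_ge0 ?powR_ge0// poweR_EFin powRM ?powR_ge0//.
by rewrite -powRrM divff ?gt_eqF// powRr1.
Qed.

End extremal.

Lemma ler_bigmax (R : realType) (s : seq int) (F : int -> R) i : i \in s ->
  F i <= \big[Num.max/0]_(i <- s) F i.
Proof.
elim: s => // l t IH; rewrite inE big_cons le_max => /orP[/eqP->|/IH h].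
  by rewrite lexx.
by rewrite h orbT.
Qed.

Lemma esum_seq (R : realType) (T : choiceType) (a : T -> \bar R) (s : seq T) : uniq s ->
  (forall i, 0 <= a i)%E -> (forall i, i \notin s -> a i = 0%E) ->
  (\esum_(i in [set: T]) a i = \sum_(i <- s) a i)%E.
Proof.
move=> us a0 as0; rewrite fsbig_seq// -esum_fset// [RHS]esum_mkcond.
apply: eq_esum => i _; case: ifPn => //; rewrite notin_setE => /negP.
exact: as0.
Qed.

(** * The Besov norm of a one-scale sum *)

Section besov_bounds.
Context (R : realType) (n : nat).
Hypothesis n_gt0 : (0 < n)%N.
Local Notation E := 'rV[R]_n.
Local Notation C := R[i].
Local Notation mu := (lebesgue_rV R n).
Variables (p s q : R) (w : E -> R).
Hypotheses (p_gt1 : 1 < p) (q_gt0 : 0 < q) (w_Ap : in_Ap p w).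
Local Notation A := (fine (Ap_const p w)).
Variables (a b c1 c2 : R) (phi h : E -> C) (r : R).
Hypotheses (a_gt0 : 0 < a) (c1_gt0 : 0 < c1) (phi_LP : littlewood_paley c1 c2 phi).
Hypotheses (er : n%:R + n%:R / conj_exp p < r) (h_decays : decays r h).
Hypothesis h_band : band_limited a b h.
Local Notation M := (band_width a b c1 c2).
Variables (j : int) (S : seq 'rV[int]_n).
Hypothesis uS : uniq S.

Let p_gt0 : 0 < p. Proof. by rewrite (lt_trans _ p_gt1). Qed.
Let r_ge0 : 0 <= r.
Proof.
apply: le_trans (ltW er); rewrite addr_ge0// mulr_ge0//.
by have := conj_exp_inv p_gt1; rewrite mul1r => ->; rewrite subr_ge0 invf_le1// ltW.
Qed.
Let h_int : cintegrable h. Proof. by case: h_band. Qed.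
Let h_cont : ccontinuous h. Proof. by case: h_band. Qed.
Let h_supp : supported_in_annulus a b (fourier h). Proof. by case: h_band. Qed.
Let phi_schwartz : schwartz phi. Proof. by case: phi_LP. Qed.
Let phi_cont : ccontinuous phi. Proof. exact: schwartz_continuous. Qed.
Let phi_bound : exists K, forall x, cmod (phi x) <= K.
Proof. exact: (decays_bounded (lexx 0)) (schwartz_decays _ phi_schwartz). Qed.
Let phi_int : cintegrable phi.
Proof.
by apply: decays_cintegrable; [exact: ccontinuous_measurable|exact: schwartz_decays].
Qed.

Let dphi_bound i : exists K, forall x, cmod (dilate phi i x) <= K.
Proof. by case: phi_bound => K hK; eexists; exact: dilate_bound hK. Qed.

Lemma measurable_block i : cmeasurable (convol (dilate phi i) h).
Proof.
have [K hK] := dphi_bound i.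
apply: cintegrable_measurable; apply: (convol_cintegrable _ hK) => //.
  exact: ccontinuous_dilate.
exact: cintegrable_dilate.
Qed.

Lemma block_decays i : decays r (convol (dilate phi i) h).
Proof.
have [K hK] := dphi_bound i.
apply: convol_decays => //.
- exact/ccontinuous_measurable/ccontinuous_dilate.
- exact: ccontinuous_measurable.
- by apply: dilate_decays; [rewrite addr_ge0|exact: schwartz_decays].
- by apply: (convol_integrand hK) => //; exact: cintegrable_dilate.
Qed.

Local Notation block i := (flat_comb p w (convol (dilate phi i) h) j S).

(** By [convol_wav] the scale [j] drops out, leaving the same coefficients on a generator that
    depends only on [i]. *)
Lemma lp_block_flat_comb i x :
  lp_block phi (j + i) (distr_of (flat_comb p w h j S)) x = block i x.
Proof.
have [K hK] := dphi_bound (j + i).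
have ki k : cintegrable (fun y => dilate phi (j + i) (x - y) * wav h j k y).
  apply: (convol_integrand hK); first exact: cintegrable_dilate.
  exact: cintegrable_wav.
transitivity (cintegral (fun y => \sum_(k <- S) (flat_coef p w j k)%:C%C *
    (dilate phi (j + i) (x - y) * wav h j k y))).
  apply: eq_cintegral => y; rewrite /flat_comb mulr_suml.
  by apply: eq_bigr => k _; rewrite -mulrA [wav _ _ _ _ * _]mulrC.
rewrite cintegral_sum; last by move=> k _; exact: cintegrableZl.
apply: eq_bigr => k _; rewrite cintegralZl//; congr (_ * _).
by rewrite -[LHS]/(convol _ _ _) convol_wav// addrAC subrr add0r.
Qed.

Lemma block_flat_comb0 i x : i \notin band M -> block i x = 0.
Proof.
move=> iM; rewrite /flat_comb big1// => k _.
by rewrite /wav (block_out a_gt0 c1_gt0 phi_LP h_int h_supp iM) !mulr0.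
Qed.

Lemma flat_comb_blocks x : flat_comb p w h j S x = \sum_(i <- band M) block i x.
Proof.
rewrite /flat_comb exchange_big/=; apply: eq_bigr => k _; rewrite -mulr_sumr; congr (_ * _).
rewrite /wav -mulr_sumr; congr (_ * _).
exact: (block_sum a_gt0 c1_gt0 phi_LP h_int (ccontinuous_seq h_cont) h_supp).
Qed.

Let f := flat_comb p w h j S.
Let besov := besov_norm phi s p q w (distr_of f).

Lemma besov_flat_combE : besov = ((\sum_(i <- band M)
  (2 `^ ((j + i)%:~R * s * q))%:E * Lpw_norm p w (block i) `^ q) `^ q^-1)%E.
Proof.
rewrite /besov /besov_norm; congr (_ `^ _)%E.
have lpE i : lp_block phi (j + i) (distr_of f) = block i.
  by apply/funext => x; exact: lp_block_flat_comb.
rewrite (@esum_seq _ _ _ [seq j + i | i <- band M]).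
- by rewrite big_map; apply: eq_bigr => i _; rewrite lpE.
- by rewrite map_inj_uniq ?band_uniq//; exact: addrI.
- by move=> i; rewrite mule_ge0 ?poweR_ge0// lee_fin powR_ge0.
move=> l lM; have -> : l = j + (l - j) by rewrite addrC subrK.
rewrite lpE; have iM : l - j \notin band M.
  by apply: contra lM => h'; apply/mapP; exists (l - j) => //; rewrite addrC subrK.
rewrite (_ : block (l - j) = fun=> 0); last by apply/funext => x; exact: block_flat_comb0.
rewrite /Lpw_norm integral0_eq.
  by rewrite !poweR0r ?mule0 ?invr_eq0 ?gt_eqF.
by move=> x _; rewrite cmod0 powR0 ?mul0r// gt_eqF.
Qed.

Lemma K_eta_ge i : i \in band M -> K_U p (convol (dilate phi i) h) <= K_eta p M phi h.
Proof. exact: (@ler_bigmax _ _ (fun i => K_U p (convol (dilate phi i) h))). Qed.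

Lemma K_eta_ge0 : 0 <= K_eta p M phi h.
Proof. by rewrite /K_eta; apply: bigmax_ge_id. Qed.

Lemma besov_flat_comb_le : (besov <=
  (2 `^ (j%:~R * s) * C'_M s q M * (K_eta p M phi h * (A `^ p^-1 * (size S)%:R `^ p^-1)))%:E)%E.
Proof.
have K0 := K_eta_ge0.
set T := _ * (size S)%:R `^ _.
have T0 : 0 <= T by rewrite mulr_ge0 ?powR_ge0.
have X0 : 0 <= K_eta p M phi h * T by rewrite mulr_ge0.
have bl i : i \in band M -> (Lpw_norm p w (block i) <= (K_eta p M phi h * T)%:E)%E.
  move=> iM; apply: le_trans (flat_comb_le n_gt0 p_gt1 w_Ap j (block_decays i) er
    (measurable_block i) uS) _.
  by rewrite lee_fin ler_wpM2r// K_eta_ge.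
set X := _ * T in X0 bl *; clearbody X.
have -> : 2 `^ (j%:~R * s) * C'_M s q M * X =
    (\sum_(i <- band M) 2 `^ ((j + i)%:~R * s * q) * X `^ q) `^ q^-1.
  rewrite -mulr_suml; under eq_bigr => i _ do
    rewrite intrD 2!mulrDl powRD ?pnatr_eq0 ?implybT//.
  rewrite -mulr_sumr !powRM ?mulr_ge0 ?powR_ge0 ?sumr_ge0//.
  have qK (x : R) : 0 <= x -> (x `^ q) `^ q^-1 = x.
    by move=> x0; rewrite -powRrM divff ?gt_eqF// powRr1.
  by rewrite [2 `^ (_ * q)]powRrM !qK ?powR_ge0.
rewrite besov_flat_combE -poweR_EFin -sumEFin; apply: lee_poweR.
- by rewrite invr_ge0 ltW.
- by apply: sume_ge0 => i _; rewrite mule_ge0 ?poweR_ge0// lee_fin powR_ge0.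
rewrite !big_seq; apply: lee_sum => i iM.
rewrite EFinM lee_wpmul2l ?lee_fin ?powR_ge0// -poweR_EFin.
by apply: lee_poweR; rewrite ?bl ?poweR_ge0// ltW.
Qed.

(** A single term of the sum defining the norm, hence valid for every [q > 0], including [q < 1]. *)
Lemma block_le_besov i : i \in band M ->
  ((2 `^ ((j + i)%:~R * s))%:E * Lpw_norm p w (block i) <= besov)%E.
Proof.
move=> iM; rewrite besov_flat_combE.
have -> : ((2 `^ ((j + i)%:~R * s))%:E * Lpw_norm p w (block i) =
    ((2 `^ ((j + i)%:~R * s * q))%:E * Lpw_norm p w (block i) `^ q) `^ q^-1)%E.
  rewrite poweRM ?lee_fin ?powR_ge0 ?poweR_ge0// poweR_EFin -powRrM -poweRrM.
  by rewrite -[_ * s * q * _]mulrA divff ?gt_eqF// mulr1 poweRe1// poweR_ge0.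
apply: lee_poweR.
- by rewrite invr_ge0 ltW.
- by rewrite mule_ge0 ?poweR_ge0// lee_fin powR_ge0.
rewrite (big_rem i)//= leeDl//; apply: sume_ge0 => l _.
by rewrite mule_ge0 ?poweR_ge0// lee_fin powR_ge0.
Qed.

(** Replaces the triangle inequality in the weighted norm: [jensen_sum] is applied at each point to
    the sum of the blocks and then integrated. *)
Lemma flat_comb_le_besov (B : R) : 0 <= B -> (besov <= B%:E)%E ->
  (Lpw_norm p w f <= (2 `^ (- (j%:~R * s)) * C_M s M * B)%:E)%E.
Proof.
move=> B0 bB.
(* Weights proportional to the available bounds on the block norms, so that convexity loses nothing
   against the triangle inequality. *)
pose l (i : int) : R := 2 `^ (- ((j + i)%:~R * s)).
have l0 i : 0 < l i by rewrite powR_gt0.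
have lsum : \sum_(i <- band M) l i = 2 `^ (- (j%:~R * s)) * C_M s M.
  rewrite /C_M -[in RHS]band_sumN mulr_sumr; apply: eq_bigr => i _.
  by rewrite -powRD ?pnatr_eq0 ?implybT// /l intrD mulrNz mulNr mulrDl opprD.
have lsumK : \sum_(i <- band M) l i <= 2 `^ (- (j%:~R * s)) * C_M s M by rewrite lsum.
have K0 : 0 <= 2 `^ (- (j%:~R * s)) * C_M s M.
  by rewrite -lsum sumr_ge0// => i _; exact: ltW.
set K := _ * C_M s M in lsum lsumK K0 *.
have mf : cmeasurable f by apply: cmeasurable_flat_comb; exact: ccontinuous_measurable.
have mb i : cmeasurable (block i) by apply: cmeasurable_flat_comb; exact: measurable_block.
have bl i : i \in band M ->
    (\int[mu]_x (cmod (block i x) `^ p * `|w x|)%:E <= ((l i * B) `^ p)%:E)%E.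
  move=> iM; have h1 : (Lpw_norm p w (block i) <= (l i * B)%:E)%E.
    have := le_trans (block_le_besov iM) bB.
    rewrite -lee_pdivlMl ?powR_gt0// => /le_trans; apply.
    by rewrite -EFinM lee_fin /l powRN.
  have -> : (\int[mu]_x (cmod (block i x) `^ p * `|w x|)%:E = Lpw_norm p w (block i) `^ p)%E.
    rewrite Lpw_normE// -poweRrM mulVf ?gt_eqF// poweRe1//.
    by apply: integral_ge0 => x _; rewrite lee_fin mulr_ge0 ?powR_ge0.
  by rewrite -poweR_EFin; apply: lee_poweR; rewrite ?poweR_ge0// ltW.
apply: Lpw_norm_le => //; first by rewrite mulr_ge0.
have mw := measurable_weight w_Ap.
have mI i : measurable_fun setT (fun x => (cmod (block i x) `^ p * `|w x|)%:E).
  apply/measurable_EFinP; apply: measurable_funM.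
    by apply: measurable_fun_powR; exact: cmeasurable_cmod.
  apply: (@measurableT_comp _ _ _ _ _ _ (@Num.norm R R)) mw; exact: normr_measurable.
apply: (@le_trans _ _ (\int[mu]_x \sum_(i <- band M)
    ((K `^ (p - 1) * (l i * (l i)^-1 `^ p))%:E * (cmod (block i x) `^ p * `|w x|)%:E))%E).
  apply: ge0_le_integral => //.
  - by move=> x _; rewrite lee_fin mulr_ge0 ?powR_ge0.
  - apply/measurable_EFinP; apply: measurable_funM.
      by apply: measurable_fun_powR; exact: cmeasurable_cmod.
    apply: (@measurableT_comp _ _ _ _ _ _ (@Num.norm R R)) mw; exact: normr_measurable.
  - by apply: emeasurable_sum => i _; exact: measurable_funeM.
  move=> x _; under eq_bigr do rewrite -EFinM; rewrite sumEFin lee_fin.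
  rewrite (eq_bigr (fun i => K `^ (p - 1) * (l i * (l i)^-1 `^ p) *
    cmod (block i x) `^ p * `|w x|)) ; last by move=> i _; rewrite !mulrA.
  rewrite -mulr_suml ler_wpM2r//.
  have t0 i : 0 <= cmod (block i x) / l i by rewrite divr_ge0 ?cmod_ge0// ltW.
  have := jensen_sum (r := band M) p_gt1 (fun i => ltW (l0 i)) t0 lsumK.
  rewrite mulr_sumr => J; apply: le_trans (le_trans _ J) _.
    rewrite ge0_ler_powR ?nnegrE ?cmod_ge0 ?(ltW p_gt0)//.
      by apply: sumr_ge0 => i _; rewrite mulr_ge0 ?(ltW (l0 i)).
    rewrite /f flat_comb_blocks; apply: le_trans (cmod_sum _ _ _) _.
    by apply: ler_sum => i _; rewrite mulrC divfK// gt_eqF.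
  apply: ler_sum => i _; rewrite powRM ?cmod_ge0 ?invr_ge0 ?(ltW (l0 i))//.
  by rewrite le_eqVlt; apply/orP; left; apply/eqP; ring.
rewrite ge0_integral_sum//; last 2 first.
- by move=> i; exact: measurable_funeM.
- by move=> i x _; rewrite -EFinM lee_fin !mulr_ge0 ?powR_ge0// ltW.
have -> : (K * B) `^ p = \sum_(i <- band M)
    (K `^ (p - 1) * (l i * (l i)^-1 `^ p)) * (l i * B) `^ p.
  rewrite (eq_bigr (fun i => K `^ (p - 1) * B `^ p * l i)).
    rewrite -mulr_sumr lsum powRM// -(mulr_powRB1 K0 p_gt0); ring.
  move=> i _; rewrite (powRM _ (ltW (l0 i)) B0).
  have e : (l i)^-1 `^ p * l i `^ p = 1.
    by rewrite -powRM ?invr_ge0 ?ltW// mulVf ?gt_eqF// powR1.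
  transitivity (K `^ (p - 1) * B `^ p * l i * ((l i)^-1 `^ p * l i `^ p)); first ring.
  by rewrite e mulr1.
rewrite -sumEFin !big_seq; apply: lee_sum => i iM.
have c0 : 0 <= K `^ (p - 1) * (l i * (l i)^-1 `^ p) by rewrite !mulr_ge0 ?powR_ge0// ltW.
rewrite ge0_integralZl_real ?[leRHS]EFinM ?lee_wpmul2l ?lee_fin ?bl//.
- by have /measurable_EFinP := mI i.
- by move=> x; rewrite mulr_ge0 ?powR_ge0.
Qed.

End besov_bounds.

(** [h] is a finite sum of its own blocks, and convolution with a Schwartz function upgrades the
    weighted integrability in [in_D] to pointwise decay of the same order. *)
Lemma band_limited_decays (R : realType) (n : nat) (a b c1 c2 sigma : R)
    (phi h : 'rV[R]_n -> R[i]) : 0 < a -> 0 < c1 -> littlewood_paley c1 c2 phi ->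
  band_limited a b h -> 0 <= sigma -> in_D sigma h -> decays sigma h.
Proof.
move=> a0 c0 LP hb s0 hD; have [h_cont h_int _ h_supp] := hb.
have phiS : schwartz phi by case: LP.
have phi_cont := schwartz_continuous phiS.
have phi_int : cintegrable phi.
  by apply: decays_cintegrable; [exact: ccontinuous_measurable|exact: schwartz_decays].
have [K0 hK0] := decays_bounded (lexx 0) (schwartz_decays 0 phiS).
have -> : h = fun x => \sum_(i <- band (band_width a b c1 c2)) convol (dilate phi i) h x.
  apply/funext => x.
  exact: (block_sum a0 c0 LP h_int (ccontinuous_seq h_cont) h_supp).
apply: decays_sum => i.
have [K hK] := dilate_decays i s0 (schwartz_decays sigma phiS).
apply: (convol_decays_weight s0 _ _ hK).
- exact/ccontinuous_measurable/ccontinuous_dilate.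
- by apply: (convol_integrand (dilate_bound i hK0)) => //; exact: cintegrable_dilate.
- exact: ccontinuous_measurable.
- exact: in_D_integrable.
Qed.

(** * N-term errors of one-scale sums *)

Section wavelet_families.
Context (R : realType) (n L : nat).
Local Notation E := 'rV[R]_n.
Local Notation C := R[i].
Variables (psi psit : 'I_L -> E -> C).
Hypothesis psi_int : forall e, cintegrable (psi e).
Hypothesis psi_bound : forall e, exists K, forall x, cmod (psi e x) <= K.
Hypothesis psit_int : forall e, cintegrable (psit e).
Hypothesis psit_bound : forall e, exists K, forall x, cmod (psit e x) <= K.
Hypothesis biorth : forall l l', cpair (wsys psi l) (wsys psit l') = (l == l')%:R.

Lemma cintegrable_cpair (f : E -> C) l : cintegrable f ->
  cintegrable (fun x => f x * (wsys psit l x)^*%C).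
Proof.
move=> fi; have [K hK] := psit_bound l.1.1.
apply: (@cintegrableMb _ _ _ _ (2 `^ (l.1.2%:~R * n%:R / 2) * K)) => //.
  exact/cmeasurable_conj/cintegrable_measurable/cintegrable_wav.
by move=> x; rewrite cmod_conj; exact: wav_bound.
Qed.

Lemma cintegrable_wcomb Lam d : cintegrable (wcomb psi Lam d).
Proof. by apply: cintegrable_sum => l _; apply: cintegrableZl; exact: cintegrable_wav. Qed.

Lemma wcomb_bound Lam d : exists K, forall x, cmod (wcomb psi Lam d x) <= K.
Proof.
have /choice[K hK] := psi_bound.
exists (\sum_(l <- Lam) cmod (d l) * (2 `^ (l.1.2%:~R * n%:R / 2) * K l.1.1)) => x.
apply: le_trans (cmod_sum _ _ _) _; apply: ler_sum => l _.
by rewrite cmodM ler_wpM2l ?cmod_ge0// wav_bound.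
Qed.

Lemma cpair_wcomb Lam d l : cpair (wcomb psi Lam d) (wsys psit l) =
  if l \in Lam then d l else 0.
Proof.
transitivity (cintegral (fun x => \sum_(l' <- Lam)
    d l' * (wsys psi l' x * (wsys psit l x)^*%C))).
  by apply: eq_cintegral => x; rewrite mulr_suml; apply: eq_bigr => l' _; rewrite mulrA.
have ci l' : cintegrable (fun x => wsys psi l' x * (wsys psit l x)^*%C).
  by apply: cintegrable_cpair; exact: cintegrable_wav.
rewrite cintegral_sum; last by move=> l' _; exact: cintegrableZl.
transitivity (\sum_(l' <- Lam) d l' * (l' == l)%:R).
  by apply: eq_bigr => l' _; rewrite cintegralZl// -biorth.
case: ifPn => lL.
  rewrite (bigD1_seq l)//= eqxx mulr1 big1 ?addr0//.
  by move=> l' /negPf ->; rewrite mulr0.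
rewrite big_seq big1// => l' l'L; case: eqP => [e|_]; last by rewrite mulr0.
by rewrite -e l'L in lL.
Qed.

Variables (p : R) (w : E -> R) (e0 : 'I_L) (j : int).

Definition level_set (S : seq 'rV[int]_n) : {fset windex n L} :=
  seq_fset tt [seq (e0, j, k) | k <- S].

Definition flat_coefs (l : windex n L) : C := (flat_coef p w l.1.2 l.2)%:C%C.

Lemma flat_coefsE k : flat_coefs (e0, j, k) = (flat_coef p w j k)%:C%C.
Proof. by []. Qed.

Lemma level_inj : injective (fun k : 'rV[int]_n => (e0, j, k)).
Proof. by move=> k k' [->]. Qed.

Lemma mem_level_set S l : (l \in level_set S) = [&& l.1.1 == e0, l.1.2 == j & l.2 \in S].
Proof.
rewrite seq_fsetE; case: l => -[e i] k /=.
apply/mapP/and3P => [[k' k'S [-> -> ->]]|[/eqP-> /eqP-> kS]]; first by [].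
by exists k.
Qed.

Lemma card_level_set S : uniq S -> #|` level_set S| = size S.
Proof. by move=> uS; rewrite size_seq_fset undup_id ?map_inj_uniq ?size_map//; exact: level_inj. Qed.

Lemma wcomb_level_set S : uniq S ->
  wcomb psi (level_set S) flat_coefs = flat_comb p w (psi e0) j S.
Proof.
move=> uS; apply/funext => x; rewrite /wcomb /level_set.
rewrite (perm_big _ (seq_fset_perm _ _)) undup_id ?map_inj_uniq//; last exact: level_inj.
by rewrite big_map.
Qed.

(** The approximant keeps the first [N] terms; since all terms weigh the same, any other choice
    would give the same bound. *)
Lemma nterm_error_flat_le S N r : (0 < n)%N -> 1 < p -> in_Ap p w ->
  decays r (psi e0) -> n%:R + n%:R / conj_exp p < r -> uniq S ->
  (nterm_error psi p w N (flat_comb p w (psi e0) j S) <=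
   (K_U p (psi e0) * (fine (Ap_const p w) `^ p^-1 * (size S - N)%N%:R `^ p^-1))%:E)%E.
Proof.
move=> n0 p1 wA hd er uS.
have ud : uniq (drop N S) by exact: drop_uniq.
have ut : uniq (take N S) by exact: take_uniq.
apply: ge_ereal_inf; exists (Lpw_norm p w (flat_comb p w (psi e0) j (drop N S))).
  exists (level_set (take N S)), flat_coefs; split.
    by rewrite card_level_set// size_take_min geq_minl.
  congr Lpw_norm; rewrite wcomb_level_set//; apply/funext => x.
  have -> : flat_comb p w (psi e0) j S x =
      flat_comb p w (psi e0) j (take N S) x + flat_comb p w (psi e0) j (drop N S) x.
    by rewrite -[in LHS](cat_take_drop N S) /flat_comb big_cat.
  by rewrite addrAC subrr add0r.
rewrite -size_drop; apply: (flat_comb_le n0 p1 wA j hd er) => //.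
exact: cintegrable_measurable.
Qed.

Lemma nterm_error_flat_ge S N r : (0 < n)%N -> 1 < p -> in_Ap p w ->
  decays r (psit e0) -> n%:R + n%:R / p < r -> uniq S -> 0 < K_L p (psit e0) ->
  (((K_L p (psit e0) * fine (Ap_const p w) `^ p^-1)^-1 * (size S - N)%N%:R `^ p^-1)%:E <=
   nterm_error psi p w N (flat_comb p w (psi e0) j S))%E.
Proof.
move=> n0 p1 wA hd er uS KL0.
have p0 : 0 < p by exact: lt_trans p1.
have A0 : 0 < fine (Ap_const p w) by exact: lt_le_trans (Ap_ge1 p1 wA).
apply: le_ereal_inf_tmp => _ [Lam [d [LN ->]]].
set g := fun x => _.
rewrite EFinM lee_pdivrMl; last by rewrite mulr_gt0// powR_gt0.
have [goo|] := ltP (Lpw_norm p w g) +oo%E; last first.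
  by rewrite leye_eq => /eqP ->; rewrite gt0_muley ?leey// lte_fin mulr_gt0// powR_gt0.
(* The indices of [S] that the approximant does not touch. *)
pose T := [seq k <- S | (e0, j, k) \notin Lam].
have fE : flat_comb p w (psi e0) j S = wcomb psi (level_set S) flat_coefs.
  by rewrite wcomb_level_set.
have gi : cintegrable g.
  rewrite /g fE; apply: cintegrableD; first exact: cintegrable_wcomb.
  rewrite (_ : (fun x => _) = fun x => -1 * wcomb psi Lam d x).
    by apply: cintegrableZl; exact: cintegrable_wcomb.
  by apply/funext => x; rewrite mulN1r.
have gb : exists B, forall x, cmod (g x) <= B.
  have [B1 hB1] := wcomb_bound (level_set S) flat_coefs.
  have [B2 hB2] := wcomb_bound Lam d.
  exists (B1 + B2) => x; rewrite /g fE (le_trans (ler_cmodD _ _))// cmodN lerD//.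
(* The indices of [S] used by the approximant inject into [Lam], so there are at most [N] of
   them. *)
have szT : (size S - N <= size T)%N.
  rewrite leq_subLR -(count_predC (fun k => (e0, j, k) \in Lam) S) size_filter leq_add2r.
  apply: leq_trans LN; rewrite -size_filter -(size_map (fun k => (e0, j, k))).
  apply: uniq_leq_size.
    by rewrite map_inj_uniq ?filter_uniq//; exact: level_inj.
  by move=> _ /mapP[k + ->]; rewrite mem_filter => /andP[].
apply: (@le_trans _ _ ((size T)%:R `^ p^-1)%:E).
  by rewrite lee_fin ge0_ler_powR ?nnegrE ?ler_nat// invr_ge0 ltW.
apply: (flat_comb_ge (j := j) n0 p1 wA hd er (psit_int e0) gi gb) => //; first exact: filter_uniq.
move=> k; rewrite mem_filter => /andP[kL kS].
rewrite -flat_coefsE.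
have := cpair_wcomb (level_set S) flat_coefs (e0, j, k).
rewrite mem_level_set /= !eqxx kS /= => <-.
have := cpair_wcomb Lam d (e0, j, k); rewrite (negPf kL) => h0.
rewrite -[RHS](subr0 (cpair _ _)) -[in RHS]h0.
transitivity (cintegral (fun x => wcomb psi (level_set S) flat_coefs x *
    (wsys psit (e0, j, k) x)^*%C + -1 * (wcomb psi Lam d x * (wsys psit (e0, j, k) x)^*%C))).
  by apply: eq_cintegral => x; rewrite /g fE mulrBl mulN1r.
rewrite cintegralD ?cintegralZl ?mulN1r//.
- exact/cintegrable_cpair/cintegrable_wcomb.
- exact/cintegrable_cpair/cintegrable_wcomb.
- by apply: cintegrableZl; exact/cintegrable_cpair/cintegrable_wcomb.
Qed.

End wavelet_families.

(** * The ratio at the extremal function *)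

Section extremal_function.
Context (R : realType) (n L : nat).
Hypotheses (n_gt0 : (0 < n)%N) (L_gt0 : (0 < L)%N).
Local Notation E := 'rV[R]_n.
Local Notation C := R[i].
Variables (a b : R) (psi psit : 'I_L -> E -> C) (tau sigma c1 c2 : R) (phi : E -> C).
Variables (s p q : R) (w : E -> R).
Hypotheses (a_gt0 : 0 < a) (psi_pair : wavelet_pair a b psi psit).
Hypotheses (tau_gt0 : 0 < tau) (sigma_gt2n : 2 * n%:R < sigma).
Hypotheses (psi_M : forall e, in_M tau (psi e)) (psit_D : forall e, in_D sigma (psit e)).
Hypotheses (c1_gt0 : 0 < c1) (phi_LP : littlewood_paley c1 c2 phi).
Hypotheses (p_gt1 : 1 < p) (q_gt0 : 0 < q) (w_Ap : in_Ap p w).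
Local Notation A := (fine (Ap_const p w)).
Local Notation e0 := (Ordinal L_gt0).
Local Notation M := (band_width a b c1 c2).
Variable m : nat.
Local Notation S := (unit_lattice n m.+1).

Definition extremal : E -> C := flat_comb p w (psi e0) m.+1%:Z S.

Let p_gt0 : 0 < p. Proof. by rewrite (lt_trans _ p_gt1). Qed.
Let A_ge1 : 1 <= A. Proof. exact: Ap_ge1. Qed.
Let A_gt0 : 0 < A. Proof. exact: lt_le_trans A_ge1. Qed.
Let n0 : 0 < n%:R :> R. Proof. by rewrite ltr0n. Qed.
Let psi_band e : band_limited a b (psi e). Proof. by case: psi_pair => /(_ e)[]. Qed.
Let psit_band e : band_limited a b (psit e). Proof. by case: psi_pair => /(_ e)[]. Qed.
Let psi_int e : cintegrable (psi e). Proof. by case: (psi_band e). Qed.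
Let psit_int e : cintegrable (psit e). Proof. by case: (psit_band e). Qed.
Let biorth l l' : cpair (wsys psi l) (wsys psit l') = (l == l')%:R.
Proof. by case: psi_pair. Qed.

Let r_ge0 : 0 <= 2 * n%:R + tau.
Proof. by rewrite addr_ge0 ?mulr_ge0 ?ltW. Qed.
Let sigma_ge0 : 0 <= sigma.
Proof. by apply: le_trans (ltW sigma_gt2n); rewrite mulr_ge0. Qed.
Let psi_decays e : decays (2 * n%:R + tau) (psi e). Proof. exact: in_M_decays. Qed.
Let psit_decays e : decays sigma (psit e).
Proof. exact: band_limited_decays phi_LP (psit_band e) sigma_ge0 (psit_D e). Qed.
Let psi_bound e : exists K, forall x, cmod (psi e x) <= K.
Proof. exact: decays_bounded (psi_decays e). Qed.
Let psit_bound e : exists K, forall x, cmod (psit e x) <= K.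
Proof. exact: decays_bounded (psit_decays e). Qed.

Let pV_lt1 : p^-1 < 1. Proof. by rewrite invf_lt1. Qed.
(** Since [1 / p'] and [1 / p] are at most 1, decay of order beyond [2 n] makes [K_U] and [K_L]
    finite for every [p]; this is what [tau > 0] and [sigma > 2 n] provide. *)
Let erU : n%:R + n%:R / conj_exp p < 2 * n%:R + tau.
Proof.
have := conj_exp_inv p_gt1; rewrite mul1r => ->.
have h : n%:R * (1 - p^-1) <= n%:R :> R by rewrite ger_pMr// gerBl invr_ge0 ltW.
by rewrite mulrDl mul1r -addrA ltrD2l (le_lt_trans h)// ltrDl.
Qed.
Let erL : n%:R + n%:R / p < sigma.
Proof.
apply: le_lt_trans sigma_gt2n; rewrite mulrDl mul1r lerD2l ger_pMr//.
exact: ltW.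
Qed.

Let uS : uniq S. Proof. exact: unit_lattice_uniq. Qed.

Lemma extremal_wcomb : extremal = wcomb psi (level_set e0 m.+1%:Z S) (flat_coefs p w).
Proof. by rewrite wcomb_level_set. Qed.

Lemma extremal_single_scale : single_scale psi m.+1%:Z extremal.
Proof.
exists (level_set e0 m.+1%:Z S), (flat_coefs p w); split; last exact: extremal_wcomb.
by move=> l; rewrite mem_level_set => /and3P[_ /eqP].
Qed.

Let extremal_int : cintegrable extremal.
Proof. exact: cintegrable_flat_comb. Qed.

(** Biorthogonality kills every coefficient but those of the extremal function, and these sit
    exactly at the pairs [(m + 1, k)] with dyadic cube in the unit cube. Convergence of the
    expansion is thus eventual equality. *)
Lemma partial_expansion_extremal J : (m < J)%N ->
  partial_expansion psi psit extremal J = extremal.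
Proof.
move=> mJ; apply/funext => x; rewrite /partial_expansion.
have pairE l : cpair extremal (wsys psit l) =
    if l \in level_set e0 m.+1%:Z S then flat_coefs p w l else 0.
  by rewrite extremal_wcomb; exact: cpair_wcomb.
rewrite (bigD1 e0)//= [X in _ + X]big1 ?addr0; last first.
  move=> e /negPf ee; rewrite big1// => i _; rewrite fsbig1// => k _.
  by rewrite pairE mem_level_set /= ee mul0r.
rewrite (bigD1_seq m.+1) ?mem_index_iota ?iota_uniq//= [X in _ + X]big1 ?addr0; last first.
  move=> i /negPf im; rewrite fsbig1// => k _.
  by rewrite pairE mem_level_set /= ?eqxx eqz_nat im ?andbF mul0r.
rewrite (_ : [set k | _] = [set` S]); last first.
  by apply/seteqP; split => k /= /mem_unit_lattice.
rewrite -fsbig_seq// /extremal /flat_comb big_seq [RHS]big_seq.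
by apply: eq_bigr => k kS; rewrite pairE mem_level_set /= ?eqxx kS.
Qed.

Let N : nat := (2 ^ (m * n))%N.
Let T : R := (size S)%:R `^ p^-1.
Let a1 : R := A `^ p^-1.
Let kappa : R := (1 - 2 ^- n) `^ p^-1.
Let KU : R := K_U p (psi e0).
Let KL : R := K_L p (psit e0).
Let Keta : R := K_eta p M phi (psi e0).
Let besov := besov_norm phi s p q w (distr_of extremal).
Let err := nterm_error psi p w N extremal.
Let v : R := 2 `^ ((m.+1%:Z)%:~R * s).

Let size_S : size S = (2 ^ n * N)%N.
Proof. by rewrite size_unit_lattice -expnM mulSn expnD. Qed.

Let T_gt0 : 0 < T.
Proof. by rewrite powR_gt0// size_S ltr0n muln_gt0 !expn_gt0. Qed.
Let a1_gt0 : 0 < a1. Proof. by rewrite powR_gt0. Qed.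

Let twon : (2 : R) ^- n < 1.
Proof. by rewrite invf_lt1 ?exprn_gt0// exprn_egt1 -?lt0n ?ltr1n. Qed.
Let kappa_gt0 : 0 < kappa. Proof. by rewrite powR_gt0// subr_gt0. Qed.

(** Origin of [(1 - 2 ^ (- n)) ^ (1/p)]: of the [2 ^ n N] terms, [(2 ^ n - 1) N] survive. *)
Let kappaT : (size S - N)%N%:R `^ p^-1 = kappa * T.
Proof.
rewrite /kappa /T -powRM ?subr_ge0 ?(ltW twon)//; congr (_ `^ _).
rewrite size_S -[X in (_ - X)%N]mul1n -mulnBl !natrM natrB ?expn_gt0// natrX.
by rewrite [RHS]mulrA; congr (_ * _); rewrite mulrBl mul1r mulVf ?expf_neq0.
Qed.

Let Lpw_le : (Lpw_norm p w extremal <= (KU * (a1 * T))%:E)%E.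
Proof.
apply: (flat_comb_le n_gt0 p_gt1 w_Ap _ (psi_decays e0) erU) => //.
exact: cintegrable_measurable.
Qed.

Let besov_le : (besov <= (v * C'_M s q M * (Keta * (a1 * T)))%:E)%E.
Proof.
exact: (besov_flat_comb_le n_gt0 s p_gt1 q_gt0 w_Ap a_gt0 c1_gt0 phi_LP erU
  (psi_decays e0) (psi_band e0) m.+1%:Z uS).
Qed.

Let besov_ge0 : (0 <= besov)%E. Proof. exact: poweR_ge0. Qed.

Let bes : R := fine besov.
Let besE : besov = bes%:E.
Proof. by rewrite fineK// ge0_fin_numE// (le_lt_trans besov_le)// ltry. Qed.
Let bes_ge0 : 0 <= bes. Proof. by rewrite -lee_fin -besE. Qed.

Let Lpw_le_besov : (Lpw_norm p w extremal <= (v^-1 * C_M s M * bes)%:E)%E.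
Proof.
rewrite -powRN; apply: (flat_comb_le_besov p_gt1 q_gt0 w_Ap a_gt0 c1_gt0 phi_LP) => //.
by rewrite -besE.
Qed.

Let KL_ge0 : 0 <= KL.
Proof. by have [K hK] := psit_decays e0; exact: (K_L_ge0 n_gt0 p_gt1 hK erL). Qed.

Let T_le : (T%:E <= (KL * a1)%:E * Lpw_norm p w extremal)%E.
Proof.
apply: (flat_comb_ge n_gt0 p_gt1 w_Ap (psit_decays e0) erL (j := m.+1%:Z)) => //.
- exact: flat_comb_bound.
- move=> k kS; rewrite -[wav _ _ _]/(wsys psit (e0, m.+1%:Z, k)) extremal_wcomb.
  by rewrite cpair_wcomb// mem_level_set /= ?eqxx kS.
- exact: le_lt_trans Lpw_le (ltry _).
Qed.

(** The dual estimate for the extremal function itself, followed by the Besov bound. As [T > 0], it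
    also forces [KL] and the Besov norm to be positive. *)
Let T_le_bes : T <= KL * a1 * (v^-1 * C_M s M * bes).
Proof.
rewrite -lee_fin [leRHS]EFinM; apply: le_trans T_le _.
by apply: lee_wpmul2l => //; rewrite lee_fin mulr_ge0// ltW.
Qed.

Let KL_gt0 : 0 < KL.
Proof.
rewrite lt_neqAle KL_ge0 andbT; apply/eqP => K0.
by have := lt_le_trans T_gt0 T_le_bes; rewrite -K0 !mul0r ltxx.
Qed.

Let bes_gt0 : 0 < bes.
Proof.
rewrite lt_neqAle bes_ge0 andbT; apply/eqP => b0.
by have := lt_le_trans T_gt0 T_le_bes; rewrite -b0 !mulr0 ltxx.
Qed.

Let v_gt0 : 0 < v. Proof. by rewrite powR_gt0. Qed.

Let bes_le : bes <= v * C'_M s q M * (Keta * (a1 * T)).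
Proof. by rewrite -lee_fin -besE. Qed.

Let prod_gt0 : 0 < C'_M s q M * Keta.
Proof.
have := lt_le_trans bes_gt0 bes_le; rewrite !mulrA.
rewrite pmulr_lgt0// pmulr_lgt0// -mulrA pmulr_rgt0//.
Qed.

Let CM_ge0 : 0 <= C_M s M.
Proof. by apply: sumr_ge0 => i _; exact: powR_ge0. Qed.

Let KU_ge0 : 0 <= KU.
Proof. by have [K hK] := psi_decays e0; exact: (K_U_ge0 n_gt0 p_gt1 hK erU). Qed.

Let err_le : (err <= (KU * (a1 * (kappa * T)))%:E)%E.
Proof. by rewrite -kappaT; exact: nterm_error_flat_le erU uS. Qed.

Let err_ge : (((KL * a1)^-1 * (kappa * T))%:E <= err)%E.
Proof. by rewrite -kappaT; exact: nterm_error_flat_ge erL uS KL_gt0. Qed.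

Let er : R := fine err.
Let erE : err = er%:E.
Proof.
rewrite fineK// fin_numElt (lt_le_trans _ err_ge) ?ltNyr//.
by rewrite (le_lt_trans err_le)// ltry.
Qed.
Let er_le : er <= KU * (a1 * (kappa * T)). Proof. by rewrite -lee_fin -erE. Qed.
Let er_ge : (KL * a1)^-1 * (kappa * T) <= er. Proof. by rewrite -lee_fin -erE. Qed.

Let u : R := N%:R `^ (- (s / n%:R)).
Let u_gt0 : 0 < u. Proof. by rewrite powR_gt0// ltr0n expn_gt0. Qed.

(** Origin of the factor [2 ^ (- s)]: the function lives at scale [m + 1], whereas [N = 2 ^ (m n)]
    corresponds to scale [m]. *)
Let uvE : 2 `^ (- s) * (v * u) = 1.
Proof.
rewrite /u /N natrX -powR_mulrn// -powRrM -!powRD ?pnatr_eq0 ?implybT//.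
rewrite natrM -pmulrn -natr1 (_ : - s + _ = 0) ?powRr0//.
by field; rewrite gt_eqF.
Qed.

Let A2E : A `^ (2 / p) = a1 ^+ 2.
Proof. by rewrite -powR_mulrn ?powR_ge0// -powRrM mulrC. Qed.

Let ratioE : (err / (u%:E * besov) = (er / (u * bes))%:E)%E.
Proof. by rewrite erE besE -EFinM inver gt_eqF// mulr_gt0. Qed.

Local Notation cflat := (c_flat s p q M phi (psi e0) (psit e0)).
Local Notation csharp := (c_sharp s p M (psi e0) (psit e0)).

Lemma c_flat_gt0 : 0 < cflat.
Proof.
apply: divr_gt0; first by rewrite mulr_gt0 ?powR_gt0 ?subr_gt0.
by rewrite -mulrA pmulr_rgt0// mulrC.
Qed.

Lemma c_sharp_ge0 : 0 <= csharp.
Proof. by rewrite /c_sharp !mulr_ge0 ?powR_ge0. Qed.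

Lemma besov_extremal_gt0 : (0 < besov < +oo)%E.
Proof. by rewrite besE lte_fin bes_gt0 ltry. Qed.

(** The dual estimate bounds the error from below, the upper estimate applied to the blocks bounds
    the Besov norm from above; [T] cancels. *)
Lemma ratio_ge : ((cflat * A `^ (- (2 / p)))%:E <= err / (u%:E * besov))%E.
Proof.
rewrite ratioE lee_fin ler_pdivlMr ?mulr_gt0//; apply: le_trans er_ge.
rewrite powRN A2E.
have c0 := ltW c_flat_gt0.
apply: (@le_trans _ _ (cflat / a1 ^+ 2 * (u * (v * C'_M s q M * (Keta * (a1 * T)))))).
  apply: ler_wpM2l; first by rewrite divr_ge0 ?sqr_ge0.
  by rewrite ler_pM2l.
have /andP[C0 K0] : (C'_M s q M != 0) && (Keta != 0).
  by rewrite -negb_or -mulf_eq0 gt_eqF.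
rewrite le_eqVlt; apply/orP; left; apply/eqP; rewrite /c_flat -/KL -/Keta -/kappa.
transitivity (2 `^ (- s) * (v * u) * ((KL * a1)^-1 * (kappa * T))).
  by field; rewrite C0 K0 !gt_eqF.
by rewrite uvE mul1r.
Qed.

(** The roles are exchanged: the upper estimate bounds the error, and [T_le_bes] bounds the Besov
    norm from below. *)
Lemma ratio_le : (err / (u%:E * besov) <= (csharp * A `^ (2 / p))%:E)%E.
Proof.
rewrite ratioE lee_fin ler_pdivrMr ?mulr_gt0// A2E; apply: le_trans er_le _.
apply: (@le_trans _ _ (KU * (a1 * (kappa * (KL * a1 * (v^-1 * C_M s M * bes)))))).
  by rewrite !ler_wpM2l// ltW.
have -> : v^-1 = 2 `^ (- s) * u.
  by apply: (mulIf (lt0r_neq0 v_gt0)); rewrite mulVf ?gt_eqF// -mulrA [u * v]mulrC uvE.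
rewrite le_eqVlt; apply/orP; left; apply/eqP; rewrite /c_sharp -/KL -/KU -/kappa.
by ring.
Qed.

Lemma extremal_localized : localized_besov psi psit phi s p q w extremal.
Proof.
split.
- split; first exact: cintegrable_measurable.
  exact: le_lt_trans Lpw_le (ltry _).
- exists (distr_of extremal) => //; split; first exact: tempered_distr_of.
  by have /andP[] := besov_extremal_gt0.
apply: cvg_near_cst; exists m.+1 => // J /= mJ.
rewrite partial_expansion_extremal// /Lpw_norm integral0_eq ?poweR0r ?invr_eq0 ?gt_eqF//.
by move=> x _; rewrite subrr cmod0 powR0 ?mul0r// gt_eqF.
Qed.

End extremal_function.

(** For [p >= 2] because [2 / p <= 1]; for [p < 2] because [2 (p - 1) <= p]. As the A_p constant is
    at least 1, the bounds with [theta] follow from those with [2 / p]. *)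
Lemma theta_exponents (R : realType) (p : R) : 1 < p -> 2 / p <= 2 * theta p.
Proof.
move=> p1; have p0 : 0 < p by exact: lt_trans p1.
rewrite /theta mulrA divff ?mul1r// le_max; have [p2|p2] := leP 2 p.
  by rewrite ler_pdivrMr// mul1r p2.
apply/orP; right; rewrite ler_pdivrMr// mulrC ler_pdivlMr ?subr_gt0//; lra.
Qed.

(** The bound [1 + x <= exp x] gives growth at least linear in [m], hence an explicit threshold. *)
Lemma powR_unbounded (R : realType) (c d K : R) : 0 < c -> 0 < d ->
  exists m : nat, K < c * 2 `^ (m%:R * d).
Proof.
move=> c0 d0; have l0 : 0 < d * ln 2 by rewrite mulr_gt0 ?ln_gt0 ?ltr1n.
have [m h] : exists m : nat, `|K| / (c * (d * ln 2)) < m%:R.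
  by eexists; exact: truncnS_gt.
exists m; rewrite (le_lt_trans (ler_norm K))//; move: h; rewrite (ltr_pdivrMr _ _ (mulr_gt0 c0 l0)).
move=> /lt_le_trans; apply.
rewrite mulrCA ler_pM2l// /powR pnatr_eq0/=.
by apply: le_trans (expR_ge1Dx _); rewrite mulrA lerDr.
Qed.

Theorem corollary1 (R : realType) (n L : nat) (n_gt0 : (0 < n)%N)
    (L_gt0 : (0 < L)%N)
    (a b : R) (psi psit : 'I_L -> 'rV[R]_n -> R[i]) (tau sigma : R)
    (c1 c2 : R) (phi : 'rV[R]_n -> R[i])
    (s p q : R) (w : 'rV[R]_n -> R)
    (a_gt0 : 0 < a) (a_lt_b : a < b)
    (psi_pair : wavelet_pair a b psi psit)
    (tau_gt0 : 0 < tau) (sigma_gt2n : 2 * n%:R < sigma)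
    (psi_M : forall e, in_M tau (psi e))
    (psit_D : forall e, in_D sigma (psit e))
    (c1_gt0 : 0 < c1) (c1_lt_c2 : c1 < c2)
    (phi_LP : littlewood_paley c1 c2 phi)
    (s_gt0 : 0 < s) (p_gt1 : 1 < p) (q_gt0 : 0 < q)
    (w_Ap : in_Ap p w) :
  let psi1 := psi (Ordinal L_gt0) in
  let psit1 := psit (Ordinal L_gt0) in
  let M := band_width a b c1 c2 in
  let cflat := c_flat s p q M phi psi1 psit1 in
  let csharp := c_sharp s p M psi1 psit1 in
  let A := fine (Ap_const p w) in
  let besov f := besov_norm phi s p q w (distr_of f) in
  let ratio N f :=
    (nterm_error psi p w N f / ((N%:R `^ (- (s / n%:R)))%:E * besov f))%E in
  (forall m : nat, exists f : 'rV[R]_n -> R[i],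
     [/\ single_scale psi (m.+1)%:Z f,
         localized_besov psi psit phi s p q w f,
         (0 < besov f < +oo)%E,
         ((cflat * A `^ (- (2 / p)))%:E <= ratio (2 ^ (m * n))%N f
            <= (csharp * A `^ (2 / p))%:E)%E &
         ((cflat * A `^ (- (2 * theta p)))%:E <= ratio (2 ^ (m * n))%N f
            <= (csharp * A `^ (2 * theta p))%:E)%E]) /\
  ~ (exists s' C' : R, s < s' /\
       forall (f : 'rV[R]_n -> R[i]) (N : nat), (1 <= N)%N ->
         localized_besov psi psit phi s p q w f ->
         (nterm_error psi p w N f
            <= (C' * N%:R `^ (- (s' / n%:R)))%:E * besov f)%E).
Proof.
move=> psi1 psit1 M cflat csharp A besov ratio.
have A1 : 1 <= A by exact: Ap_ge1.
have A0 : 0 < A by exact: lt_le_trans A1.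
have th := theta_exponents p_gt1.
(* The constant does not involve [m]; positivity is read off the extremal function for [m = 0]. *)
have cf0 : 0 < cflat.
  exact: (c_flat_gt0 n_gt0 L_gt0 s a_gt0 psi_pair
    tau_gt0 sigma_gt2n psi_M psit_D c1_gt0 phi_LP p_gt1 q_gt0 w_Ap 0).
have cs0 : 0 <= csharp.
  exact: (c_sharp_ge0 n_gt0 L_gt0 s a_gt0 psi_pair
    tau_gt0 sigma_gt2n psi_M psit_D c1_gt0 phi_LP p_gt1).
pose f m := extremal L_gt0 psi p w m.
have lo m : ((cflat * A `^ (- (2 / p)))%:E <= ratio (2 ^ (m * n))%N (f m))%E.
  exact: (ratio_ge n_gt0 L_gt0 s a_gt0 psi_pair
    tau_gt0 sigma_gt2n psi_M psit_D c1_gt0 phi_LP p_gt1 q_gt0 w_Ap).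
have hi m : (ratio (2 ^ (m * n))%N (f m) <= (csharp * A `^ (2 / p))%:E)%E.
  exact: (ratio_le n_gt0 L_gt0 s a_gt0 psi_pair
    tau_gt0 sigma_gt2n psi_M psit_D c1_gt0 phi_LP p_gt1 q_gt0 w_Ap).
have loc m : localized_besov psi psit phi s p q w (f m).
  exact: (extremal_localized n_gt0 L_gt0 s a_gt0 psi_pair
    tau_gt0 sigma_gt2n psi_M psit_D c1_gt0 phi_LP p_gt1 q_gt0 w_Ap).
have pos m : (0 < besov (f m) < +oo)%E.
  exact: (besov_extremal_gt0 n_gt0 L_gt0 s a_gt0 psi_pair
    tau_gt0 sigma_gt2n psi_M psit_D c1_gt0 phi_LP p_gt1 q_gt0 w_Ap).
split.
  move=> m; exists (f m); split => //.
  - exact: extremal_single_scale.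
  - by rewrite lo hi.
  - apply/andP; split.
      apply: le_trans (lo m); rewrite lee_fin ler_wpM2l ?(ltW cf0)//.
      by rewrite ler_powR// lerN2.
    by apply: le_trans (hi m) _; rewrite lee_fin ler_wpM2l// ler_powR.
(* As [N ^ (- t / n) = 2 ^ (- m t)], the lower bound of the ratio and the supposed estimate give
   [cflat * A ^ (- 2 / p) * 2 ^ (m (s' - s)) <= C'] once the Besov norm, positive and finite, is
   cancelled; [m] is taken so large that this fails. *)
move=> [s' [C' [ss' hC]]].
have c0 : 0 < cflat * A `^ (- (2 / p)) by rewrite mulr_gt0 ?powR_gt0.
have ds : 0 < s' - s by rewrite subr_gt0.
have [m] := powR_unbounded C' c0 ds; apply/negP; rewrite -leNgt.
have N1 : (1 <= 2 ^ (m * n))%N by rewrite expn_gt0.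
have /andP[b0 boo] := pos m.
have bE : besov (f m) = (fine (besov (f m)))%:E by rewrite fineK// ge0_fin_numE// ltW.
have fb0 : 0 < fine (besov (f m)) by rewrite -lte_fin -bE.
have NE t : (2 ^ (m * n))%N%:R `^ (- (t / n%:R)) = 2 `^ (- (m%:R * t)) :> R.
  rewrite natrX -powR_mulrn// -powRrM natrM; congr (_ `^ _).
  by field; rewrite pnatr_eq0 -lt0n.
have := lo m; rewrite /ratio NE bE -EFinM inver gt_eqF ?mulr_gt0 ?powR_gt0//.
rewrite muleC lee_pdivlMl ?mulr_gt0 ?powR_gt0// => h.
have := le_trans h (hC (f m) _ N1 (loc m)).
rewrite -/(besov (f m)) bE NE -!EFinM lee_fin mulrAC ler_pM2r//.
move: (cflat * A `^ (- (2 / p))) => c.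
rewrite mulrBr addrC powRD ?pnatr_eq0 ?implybT// mulrA [c * _]mulrC.
by rewrite [2 `^ (- (m%:R * s'))]powRN ler_pdivlMr ?powR_gt0.
Qed.
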